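(* Let $k$ be a positive integer and let $r=\max\{32(2k+1),(2k+2)(2k+4)\}$. If $G$ is a bipartite $2(12k+2r+10)$-edge-connected graph such that $|E(G)|$ is divisible by $4k+4$, then $G$ admits a decomposition into $(2k+2)$-paths.
   Context: All graphs are finite and simple. The length of a path is its number of edges; an $\ell$-path is a path of length $\ell$ (with $\ell+1$ distinct vertices). A decomposition of $G$ into $\ell$-paths is a set of pairwise edge-disjoint subgraphs of $G$, each of which is an $\ell$-path, whose edge sets cover $E(G)$. *)

(* Defs.v *)
From HB Require Import structures.
From mathcomp Require Import all_boot.

Set Implicit Arguments.
Unset Strict Implicit.
Unset Printing Implicit Defensive.

(* Finite simple graphs. *)
Record sgraph := SGraph {
  vertex :> finType;
  adj : rel vertex;
  adj_sym : symmetric adj;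
  adj_irrefl : irreflexive adj
}.

Section Graphs.
Variable G : sgraph.

Definition edges : {set {set G}} :=
  [set [set xy.1; xy.2] | xy : G * G & adj xy.1 xy.2].

Definition bipartite : Prop :=
  exists A : {set G}, forall x y : G, adj x y -> (x \in A) != (y \in A).

Definition adj_del (F : {set {set G}}) : rel G :=
  [rel x y | adj x y && ([set x; y] \notin F)].

(* The one-vertex graph is t-edge-connected for every t, and so is the empty
   graph: both are edgeless. *)
Definition edge_connected (t : nat) : Prop :=
  forall F : {set {set G}}, F \subset edges -> #|F| < t ->
  forall x y : G, connect (adj_del F) x y.

(* A pair (vertex set, edge set); it is a subgraph of G under is_subgraph. *)
Definition pregraph : finType := ({set G} * {set {set G}})%type.

Definition is_subgraph (H : pregraph) : Prop :=
  H.2 \subset edges /\ (forall f, f \in H.2 -> f \subset H.1).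

(* The edges {p_0, p_1}, {p_1, p_2}, ... of a vertex sequence p. *)
Definition consecutive_edges (p : seq G) : {set {set G}} :=
  [set [set xy.1; xy.2] | xy in zip p (behead p)].

Definition is_path_of_length (l : nat) (H : pregraph) : Prop :=
  exists p : seq G, [/\ size p = l.+1, uniq p,
    H.1 = [set x in p] & H.2 = consecutive_edges p].

Definition path_decomposition (l : nat) (D : {set pregraph}) : Prop :=
  [/\ forall H, H \in D -> is_subgraph H /\ is_path_of_length l H,
      forall H K, H \in D -> K \in D -> H != K -> [disjoint H.2 & K.2]
    & \bigcup_(H in D) H.2 = edges].

End Graphs.

(* Main.v *)
Require Import Defs.
From HB Require Import structures.
From mathcomp Require Import all_boot zify.

Set Implicit Arguments.
Unset Strict Implicit.
Unset Printing Implicit Defensive.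

(** Put [l = 2 * k + 2], and let [X] and [Y] be the two sides of [G].

The paths are grown from a labelling of the edges by [l] layers.  Suppose that at
every vertex of [Y], for [j] even, and at every vertex of [X], for [j] odd (or the
other way round), the layers [j] and [j + 1] have the same degree.  Then the edges
of consecutive layers can be matched at these vertices, which gives trails with one
edge of each layer.  Moreover, if those degrees are larger than about [l], the
trails can be made paths ([layered_paths]).  The paths are extended by one edge at
a time, all together.  An extension is wrong only if the new end lies on the path
already; then the new edge is exchanged with that of another path extended at the
same vertex.  The new ends met at one vertex are all different, and few vertices of
a path are on their side, so suitable partners exist.  A partner that is spoilt by
the exchange is turned around and repaired in the same way ([repair_at]).

It remains to label the edges.  The labelling is composed of two families and a
tour.  In a family that is exact on [X], all layers have the same degree [d x] at
each [x] in [X], and the layers [2 * i + 1] and [2 * i + 2] have the same degree at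
each [y] in [Y].  An edge set with degree [2 * n * d x] at [x] and even degrees on
[Y] splits into [2 * n] such layers, by equitable colourings of bipartite
multigraphs ([eulerian_layers]).  To obtain these degrees one needs a means to
prescribe parities on [Y] with full control of the degrees on [X]: along an Euler
tour of a connected even graph one can select edges that make up exactly half of
the degree at each [x], and have arbitrary parities on [Y], up to one global
condition ([parity_selection]).  In this way [balanced_family] produces a family
that is exact on [X] and has prescribed parities on [Y]; the parities prescribed
are those of the degrees in [G].

The connected even graphs come from the edge-connectivity.  By the theorem of
Nash-Williams and Tutte, [G] contains many disjoint spanning trees
([tree_packing]), and a tree becomes even when a join inside another tree is added
([even_supergraph]).  The selected halves must be small with respect to the degrees
[d x].  Therefore each even graph is found in a large group of trees, inside which
a matroid union of graphic matroids and a partition matroid gives a few trees that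
use only a small part of the degrees on the exact side ([light_tree_packing]).

Finally, one tree and the even graphs are put aside ([reservoirs]), and the other
edges are coloured equitably with [2 * l] colours; half of them are used for a
family that is exact on [X], the others for one that is exact on [Y].  At each
vertex one family has a degree divisible by [l] and the other one the parity of
the degree in [G].  So the edges used by none of the families form an even graph,
which is connected because it contains the tree put aside, and the number of its
edges is divisible by [l].  Its Euler tour, labelled cyclically, is balanced
([tour_layers]), and is added to the family that is exact on one of the sides.
Both families are then balanced labellings, and together they contain every edge
exactly once. *)

(** * Vertex sequences and their edges *)

Section Sequences.
Variable G : sgraph.
Implicit Types p q : seq G.

Definition edge_seq p : seq {set G} :=
  if p is x :: q then pairmap (fun a b => [set a; b]) x q else [::].

Lemma edge_seq_cons x y q :
  edge_seq (x :: y :: q) = [set x; y] :: edge_seq (y :: q).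
Proof. by []. Qed.

Lemma edge_seq_cat p q (v0 : G) : p != [::] -> q != [::] ->
  edge_seq (p ++ q) = edge_seq p ++ [set last v0 p; head v0 q] :: edge_seq q.
Proof.
case: p q => [|x p] [|y q] //= _ _.
by rewrite pairmap_cat.
Qed.

Lemma edge_seq_rev p : perm_eq (edge_seq (rev p)) (edge_seq p).
Proof.
elim: p => [|x [|y p] IH] //.
have nz : rev (y :: p) != [::] by rewrite -size_eq0 size_rev.
rewrite rev_cons -cats1 (edge_seq_cat x nz) // edge_seq_cons.
rewrite [head _ _]/= -nth_last nth_rev size_rev //= subnn /=.
by rewrite setUC perm_catC /= perm_cons.
Qed.

Lemma edge_seq_sub p e v : e \in edge_seq p -> v \in e -> v \in p.
Proof.
elim: p => [|x [|y p] IH] //; rewrite edge_seq_cons in_cons.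
case/orP => [/eqP -> | /IH H /H].
  by rewrite !inE => /orP [] /eqP ->; rewrite eqxx ?orbT.
by rewrite [in X in _ -> X]in_cons => ->; rewrite orbT.
Qed.

Lemma size_edge_seq p : size (edge_seq p) = (size p).-1.
Proof. by case: p => //= x p; rewrite size_pairmap. Qed.

Lemma edge_seq_uniq p : uniq p -> uniq (edge_seq p).
Proof.
elim: p => [|x [|y p] IH] // /andP [xn u].
rewrite edge_seq_cons cons_uniq IH // andbT.
apply: contra xn => /edge_seq_sub H; apply: H.
by rewrite !inE eqxx.
Qed.

Lemma adj_neq (x y : G) : adj x y -> x != y.
Proof. by apply: contraTneq => ->; rewrite adj_irrefl. Qed.

Lemma edgesP (e : {set G}) :
  reflect (exists x y : G, adj x y /\ e = [set x; y]) (e \in edges G).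
Proof.
apply: (iffP imsetP) => [[[x y]]|[x [y [xy ->]]]]; last by exists (x, y); rewrite ?inE.
by rewrite inE /= => xy ->; exists x, y.
Qed.

Lemma edge_seq_edges p e : sorted (@adj G) p -> e \in edge_seq p -> e \in edges G.
Proof.
elim: p => [|x [|y p] IH] // /andP [xy s].
rewrite edge_seq_cons in_cons => /orP [/eqP -> | /(IH s) //].
by apply/edgesP; exists x, y.
Qed.

Lemma sorted_adj_rev p : sorted (@adj G) (rev p) = sorted (@adj G) p.
Proof. by rewrite rev_sorted; apply: eq_sorted => x y; rewrite adj_sym. Qed.

(** In a bipartite graph the two sides alternate along a path, so at most
half of the vertices are on the side opposite to the first one. *)
Lemma count_side (col : G -> bool) (colP : forall x y : G, adj x y -> col x != col y)
  (v0 : G) s p : sorted (@adj G) p -> col (head v0 p) != s ->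
  count (fun y => col y == s) p <= (size p)./2.
Proof.
have [n] := ubnP (size p); elim: n p => // n IH [|x [|y p]] //=.
  by move=> _ _ /negbTE ->.
move=> szp /andP [xy sp] xs; rewrite (negbTE xs) add0n.
have ys : col y == s by move: (colP _ _ xy) xs; case: (col x) (col y) (s) => [] [] [].
rewrite ys add1n ltnS.
case: p sp szp => [|z p] //= /andP [yz sp] szp.
apply: (IH (z :: p)) => //; first by rewrite /= in szp *; lia.
by have:= colP _ _ yz; rewrite /= (eqP ys) eq_sym.
Qed.

End Sequences.

(** * Repairing almost-paths *)

Lemma card_sumb (I : finType) (b : pred I) : #|[set z | b z]| = \sum_z b z.
Proof. by rewrite -sum1dep_card big_mkcond; apply: eq_bigr => z _; case: (b z). Qed.

Section SumTwo.
Variables (I : finType) (x y : I) (xy : x != y).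

Lemma sum_two (f : I -> nat) :
  \sum_z f z = f x + f y + \sum_(z | (z != x) && (z != y)) f z.
Proof.
by rewrite (bigD1 x) //= (bigD1 y) 1?eq_sym //= addnA.
Qed.

Lemma leq_sum_two (f f' : I -> nat) :
  (forall z, z != x -> z != y -> f' z = f z) ->
  f x + f y <= f' x + f' y -> \sum_z f z <= \sum_z f' z.
Proof.
move=> ff' le; rewrite !sum_two leq_add //.
by apply: leq_sum => z /andP [zx zy]; rewrite ff'.
Qed.

Lemma eq_sum_two (f f' : I -> nat) :
  (forall z, z != x -> z != y -> f' z = f z) ->
  f x + f y = f' x + f' y -> \sum_z f z = \sum_z f' z.
Proof.
move=> ff' le; rewrite !sum_two le; congr (_ + _).
by apply: eq_bigr => z /andP [zx zy]; rewrite ff'.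
Qed.

Lemma ltn_sum_two (f f' : I -> nat) :
  (forall z, z != x -> z != y -> f' z = f z) ->
  f x + f y < f' x + f' y -> \sum_z f z < \sum_z f' z.
Proof.
move=> ff' le; rewrite !sum_two -addSn leq_add //.
by apply: leq_sum => z /andP [zx zy]; rewrite ff'.
Qed.

End SumTwo.

Section Repair.
Variables (G : sgraph) (col : G -> bool).
Hypothesis colP : forall x y : G, adj x y -> col x != col y.
Variables (v0 : G) (I : finType) (s : bool) (n : nat) (F : {set {set G}}).
Implicit Types (T : I -> seq G) (u v w : G) (x y z : I).

Definition tip (p : seq G) := nth v0 p 0.
Definition hung (p : seq G) := nth v0 p 1.

Definition multiplicity T (e : {set G}) := \sum_x count_mem e (edge_seq (T x)).

(** A family of trails that jointly use every edge of [F] exactly once and of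
which only the first vertex, the tip, may occur again.  The edge at the tip hangs
at the second vertex. *)
Definition almost_paths T :=
  [/\ forall x, sorted (@adj G) (T x), forall x, uniq (behead (T x)),
      forall x, size (T x) = n.+2, forall x, col (tip (T x)) = s
    & forall e, multiplicity T e = (e \in F)].

Definition tips T v := \sum_x (tip (T x) == v).
Definition hanging T u := \sum_x (hung (T x) == u).
Definition good T u := \sum_x (uniq (T x) && (hung (T x) == u)).
Definition bad T := \sum_x ~~ uniq (T x).

Definition swap T x y : I -> seq G := fun z =>
  if z == x then tip (T y) :: behead (T x)
  else if z == y then tip (T x) :: behead (T y) else T z.

Lemma almost_pathsE T x : almost_paths T ->
  exists t u q, [/\ T x = t :: u :: q, adj t u, sorted (@adj G) (u :: q),
                uniq (u :: q) & size q = n].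
Proof.
case=> so un sz _ _.
move: (so x) (un x) (sz x); case: (T x) => [|t [|u q]] //= /andP [tu p] U [sq].
by exists t, u, q.
Qed.

Lemma owner_unique T x y e : almost_paths T ->
  e \in edge_seq (T x) -> e \in edge_seq (T y) -> x = y.
Proof.
case=> _ _ _ _ mult ex ey; apply/eqP; apply/negPn/negP => xy.
have := mult e; rewrite /multiplicity (sum_two xy).
move: ex ey; rewrite -!has_pred1 !has_count => ex ey H.
have : 2 <= (e \in F) by rewrite -H; lia.
by case: (e \in F).
Qed.

Lemma tip_inj T x y : almost_paths T -> hung (T x) = hung (T y) ->
  tip (T x) = tip (T y) -> x = y.
Proof.
move=> aT; have [t [u [q [Tx _ _ _ _]]]] := almost_pathsE x aT.
have [t' [u' [q' [Ty _ _ _ _]]]] := almost_pathsE y aT.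
rewrite Tx Ty /tip /hung /= => hu ht.
apply: (@owner_unique T x y [set t; u] aT).
  by rewrite Tx edge_seq_cons mem_head.
by rewrite Ty edge_seq_cons hu ht mem_head.
Qed.

Section Swap.
Variables (T : I -> seq G) (x y : I).
Hypotheses (aT : almost_paths T) (xy : x != y) (hxy : hung (T x) = hung (T y)).

Lemma swap_l : swap T x y x = tip (T y) :: behead (T x).
Proof. by rewrite /swap eqxx. Qed.
Lemma swap_r : swap T x y y = tip (T x) :: behead (T y).
Proof. by rewrite /swap eq_sym (negbTE xy) eqxx. Qed.
Lemma swap_o z : z != x -> z != y -> swap T x y z = T z.
Proof. by rewrite /swap => /negbTE -> /negbTE ->. Qed.

Lemma swap_hung z : hung (swap T x y z) = hung (T z).
Proof.
by rewrite /swap; case: eqP => [->|_]; [|case: eqP => [->|//]]; rewrite /hung /= nth_behead.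
Qed.

Lemma swap_behead z : behead (swap T x y z) = behead (T z).
Proof. by rewrite /swap; case: eqP => [->|_] //; case: eqP => [->|//]. Qed.

Lemma swap_almost : almost_paths (swap T x y).
Proof.
have [t [u [q [Tx tu sq uq szq]]]] := almost_pathsE x aT.
have [t' [u' [q' [Ty tu' sq' uq' szq']]]] := almost_pathsE y aT.
have uu : u = u' by move: hxy; rewrite Tx Ty.
subst u'.
case: (aT) => so un sz ct mult; split=> [z|z|z|z|e].
- have [->|zx] := eqVneq z x; first by rewrite swap_l Tx Ty /tip /= tu'.
  have [->|zy] := eqVneq z y; first by rewrite swap_r Tx Ty /tip /= tu.
  by rewrite swap_o.
- by rewrite swap_behead.
- have [->|zx] := eqVneq z x; first by rewrite swap_l Tx /= szq.
  have [->|zy] := eqVneq z y; first by rewrite swap_r Ty /= szq'.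
  by rewrite swap_o.
- have [->|zx] := eqVneq z x; first by rewrite swap_l -(ct y).
  have [->|zy] := eqVneq z y; first by rewrite swap_r -(ct x).
  by rewrite swap_o.
- rewrite -mult; apply/esym/(eq_sum_two xy) => [z zx zy|].
    by rewrite swap_o.
  rewrite swap_l swap_r Tx Ty /tip [nth _ _ _]/= [nth _ _ _]/= [behead _]/= [behead _]/=.
  by rewrite !edge_seq_cons /=; lia.
Qed.

Lemma swap_tips v : tips (swap T x y) v = tips T v.
Proof.
apply/esym/(eq_sum_two xy) => [z zx zy|]; first by rewrite swap_o.
by rewrite swap_l swap_r /= addnC.
Qed.

End Swap.

(** Turning the initial cycle of the trail around makes the other edge of the
cycle at the tip [w] the hanging one. *)
Definition flip T x w : I -> seq G := fun z =>
  if z == x then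
    let P := behead (T x) in w :: rev (take (index w P) P) ++ drop (index w P) P
  else T z.

Section Flip.
Variables (T : I -> seq G) (x : I) (w : G).
Hypotheses (aT : almost_paths T) (tx : tip (T x) = w) (wP : w \in behead (T x)).

Lemma flip_split : exists u p1 u' p2,
  [/\ behead (T x) = u :: p1 ++ w :: p2, u' = last u p1, w \notin u :: p1
    & flip T x w x = w :: rev (u :: p1) ++ w :: p2].
Proof.
have [t [u [q [Tx tu sq uq szq]]]] := almost_pathsE x aT.
rewrite /flip eqxx /=.
have := wP; case/splitPr E : _ / => [p1 p2].
have wp1 : w \notin p1.
  case: aT => _ /(_ x) + _ _ _; rewrite E cat_uniq /= => /and3P [_ + _].
  by rewrite negb_or => /andP [].
have -> : index w (p1 ++ w :: p2) = size p1.
  by rewrite index_cat (negbTE wp1) /= eqxx addn0.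
rewrite take_size_cat // drop_size_cat //.
case: p1 E wp1 => [|u1 p1] E wp1.
  move: E; rewrite Tx /= => - [uw _].
  by move: tu; rewrite -tx Tx /tip /= in uw *; rewrite uw adj_irrefl.
by exists u1, p1, (last u1 p1), p2.
Qed.

Lemma flip_o z : z != x -> flip T x w z = T z.
Proof. by rewrite /flip => /negbTE ->. Qed.

Lemma flip_sum (f f' : seq G -> nat) : (forall z, z != x -> f (T z) = f' (T z)) ->
  f (T x) = f' (flip T x w x) -> \sum_z f (T z) = \sum_z f' (flip T x w z).
Proof.
move=> fo fx; rewrite (bigD1 x) //= [RHS](bigD1 x) //= fx; congr (_ + _).
by apply: eq_bigr => z zx; rewrite flip_o // fo.
Qed.

Lemma flip_almost : almost_paths (flip T x w).
Proof.
have [u [p1 [u' [p2 [E du' wn Fx]]]]] := flip_split.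
have Tx : T x = w :: u :: p1 ++ w :: p2.
  have [t [u1 [q [Tx _ _ _ _]]]] := almost_pathsE x aT.
  by move: tx E; rewrite Tx /tip /= => -> ->.
have edg : perm_eq (edge_seq (flip T x w x)) (edge_seq (T x)).
  rewrite Fx Tx -[w :: rev _ ++ _]/([:: w] ++ _ ++ _).
  have nz : rev (u :: p1) != [::] by rewrite -size_eq0 size_rev.
  rewrite (edge_seq_cat v0) //; last by case: (rev _) nz.
  rewrite (edge_seq_cat v0 nz) // -cat_cons edge_seq_cons.
  rewrite -[u :: p1 ++ _]/((u :: p1) ++ (w :: p2)) (edge_seq_cat v0) //.
  have -> : head v0 (rev (u :: p1) ++ w :: p2) = last u p1.
    by rewrite lastI rev_rcons.
  have -> : last v0 (rev (u :: p1)) = u by rewrite rev_cons last_rcons.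
  rewrite [edge_seq [:: w]]/= cat0s [last v0 [:: w]]/= [head v0 (w :: p2)]/=.
  rewrite [last v0 (u :: p1)]/=.
  rewrite [X in perm_eq X](_ : _ = [:: [set w; last u p1]] ++
     (edge_seq (rev (u :: p1)) ++ ([:: [set u; w]] ++ edge_seq (w :: p2)))) //.
  rewrite [X in perm_eq _ X](_ : _ = [:: [set w; u]] ++
     (edge_seq (u :: p1) ++ ([:: [set last u p1; w]] ++ edge_seq (w :: p2)))) //.
  rewrite (setUC [set u]) (setUC [set last u p1]).
  apply/permP => a; have /permP/(_ a) := edge_seq_rev (u :: p1).
  by rewrite !count_cat; lia.
case: (aT) => so un sz ct mult; split=> [z|z|z|z|e].
- have [->|zx] := eqVneq z x; last by rewrite flip_o.
  rewrite Fx; have := so x; rewrite Tx.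
  rewrite -[w :: u :: _ ++ _]/((w :: u :: p1) ++ w :: p2) sorted_cat_cons.
  case/andP=> C p2P; rewrite -[w :: rev _ ++ _]/((w :: rev (u :: p1)) ++ w :: p2).
  rewrite sorted_cat_cons p2P andbT -sorted_adj_rev rev_rcons rev_cons revK.
  exact: C.
- have [->|zx] := eqVneq z x; last by rewrite flip_o.
  rewrite Fx /behead; have := un x; rewrite E -(cat_cons u) !cat_uniq rev_uniq.
  case/and3P=> -> h ->; rewrite andbT andTb; apply: contra h => /hasP [z' zi].
  by rewrite mem_rev => zz; apply/hasP; exists z'.
- have [->|zx] := eqVneq z x; last by rewrite flip_o.
  have := sz x; rewrite Tx Fx /= !size_cat size_rev /= => <-.
  by lia.
- have [->|zx] := eqVneq z x; last by rewrite flip_o.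
  by rewrite Fx /tip /= -(ct x) Tx.
- rewrite -mult /multiplicity; apply/esym.
  pose f p := count_mem e (edge_seq p).
  apply: (flip_sum (f := f) (f' := f)) => //.
  by have /permP/(_ (pred1 e)) := edg.
Qed.

Lemma flip_tips v : tips (flip T x w) v = tips T v.
Proof.
have [u [p1 [u' [p2 [E du' wn Fx]]]]] := flip_split.
pose f p := (tip p == v : nat).
by apply/esym/(flip_sum (f := f) (f' := f)) => //; rewrite /f Fx tx.
Qed.

Lemma flip_not_uniq : ~~ uniq (flip T x w x).
Proof.
have [u [p1 [u' [p2 [E du' wn Fx]]]]] := flip_split.
by rewrite Fx /= mem_cat mem_head orbT.
Qed.

End Flip.

(** Trails hanging at the same vertex have different tips, since no edge is used
twice, and at most half of the vertices of [behead (T x)] are on the side of the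
tips. *)
Lemma fresh_tip T x (S : {set I}) u : almost_paths T ->
  (forall z, z \in S -> hung (T z) = u) -> n.+1./2 < #|S| ->
  exists2 z, z \in S & tip (T z) \notin behead (T x).
Proof.
move=> aT Su cS; apply/exists_inP; apply: contraLR cS => /exists_inPn all_in.
have [t [u1 [q [Tx tu sq uq szq]]]] := almost_pathsE x aT.
rewrite -leqNgt -{1}szq; have ct : col t = s by case: aT => _ _ _ /(_ x) <- _; rewrite Tx.
have hd : col (head v0 (u1 :: q)) != s by rewrite eq_sym -ct; apply: colP.
apply: leq_trans (count_side colP sq hd).
rewrite cardE -(size_map (tip \o T)) -size_filter; apply: uniq_leq_size.
  rewrite map_inj_in_uniq ?enum_uniq // => y z; rewrite !mem_enum => yS zS /= e.
  by apply: (tip_inj aT) => //; rewrite !Su.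
move=> y /mapP [z]; rewrite mem_enum => zS ->.
have tin : tip (T z) \in u1 :: q by have := all_in z zS; rewrite negbK Tx.
rewrite mem_filter tin andbT /=; case: aT => _ _ _ /(_ z) <- _.
exact: eqxx.
Qed.

Definition improves T T' :=
  [/\ almost_paths T', forall v, tips T' v = tips T v,
      forall u, good T u <= good T' u & bad T' < bad T].

(** The first edge [wu] of a bad trail [x], with tip [w], is exchanged with that of
a good trail [y] hanging at [u] whose tip is not on [x].  If [y] avoids [w] this
repairs [x].  Otherwise [y] has become bad; it is flipped, and the same problem,
with the same [w], arises at the vertex [u'] preceding [w] on [y].  No vertex is
met twice in this way.  Indeed, let [Vis] be the set of the vertices met before:
a good trail that enters [w] from a vertex of [Vis] hangs at a vertex of [Vis],
whereas [y] hangs at [u], which is not in [Vis]. *)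
Lemma repair_at T (Vis : {set G}) x : almost_paths T ->
  (forall u, col u != s -> n.+1./2 < good T u) ->
  ~~ uniq (T x) -> hung (T x) \notin Vis ->
  (forall z, uniq (T z) -> tip (T x) \in behead (T z) ->
     nth v0 (T z) (index (tip (T x)) (behead (T z))) \in Vis ->
     hung (T z) \in Vis) ->
  exists T', improves T T'.
Proof.
have [k] := ubnP #|~: Vis|; elim: k T Vis x => // k IH T Vis x cV aT gT bx hx Inv.
have [t [u [q [Tx tu sq uq szq]]]] := almost_pathsE x aT.
have tip_x : tip (T x) = t by rewrite Tx.
have hung_x : hung (T x) = u by rewrite Tx.
have ct : col t = s by case: aT => _ _ _ /(_ x) <- _; rewrite Tx.
have cu : col u != s by rewrite -ct eq_sym; apply: colP.
pose S := [set z | uniq (T z) && (hung (T z) == u)].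
have [|||y] := @fresh_tip T x S u => //.
- by move=> z; rewrite inE => /andP [_ /eqP].
- by rewrite card_sumb; apply: gT.
rewrite inE => /andP [uy /eqP hy] ty.
have xy : x != y by apply: contraNneq bx => ->.
have hxy : hung (T x) = hung (T y) by rewrite hung_x hy.
pose T1 := swap T x y.
have aT1 : almost_paths T1 by apply: swap_almost.
have ux1 : uniq (T1 x).
  by rewrite /T1 swap_l /= ty; case: aT => _ -> _ _ _.
have ty1 : tip (T1 y) = t by rewrite /T1 swap_r // -tip_x.
have by1 : behead (T1 y) = behead (T y) by rewrite /T1 swap_behead.
have uy1 : uniq (T1 y) = (t \notin behead (T y)).
  rewrite /T1 swap_r // tip_x /=; case: aT => _ /(_ y) -> _ _ _.
  by rewrite andbT.
have ho z : hung (T1 z) = hung (T z) by apply: swap_hung.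
have [tin|tnin] := boolP (t \in behead (T y)); last first.
  exists T1; split=> // [v|v|]; first exact: swap_tips.
    apply: (leq_sum_two xy) => [z zx zy|]; first by rewrite /T1 swap_o.
    by rewrite ux1 uy1 tnin !ho uy (negbTE bx) leq_addl.
  apply: (ltn_sum_two xy) => [z zx zy|]; first by rewrite /T1 swap_o.
  by rewrite ux1 uy1 tnin uy (negbTE bx).
have tin1 : t \in behead (T1 y) by rewrite by1.
pose T2 := flip T1 y t.
have aT2 : almost_paths T2 by apply: flip_almost.
have T2o z : z != y -> T2 z = T1 z by apply: flip_o.
have by2 : ~~ uniq (T2 y) by apply: flip_not_uniq.
have g2 v : good T2 v = good T v.
  apply/esym/(eq_sum_two xy) => [z zx zy|]; first by rewrite T2o // /T1 swap_o.
  by rewrite T2o // ux1 ho uy (negbTE bx) (negbTE by2) hxy addnC.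
have b2 : bad T2 = bad T.
  apply/esym/(eq_sum_two xy) => [z zx zy|]; first by rewrite T2o // /T1 swap_o.
  by rewrite T2o // ux1 uy (negbTE bx) (negbTE by2).
have [u1 [p1 [u' [p2 [E du' tn F2]]]]] := flip_split aT1 ty1 tin1.
have Ty : T y = tip (T y) :: u1 :: p1 ++ t :: p2.
  have [t' [u2 [q' [Ty _ _ _ _]]]] := almost_pathsE y aT.
  by move: E; rewrite by1 Ty /tip /= => ->.
have uu1 : u1 = u by rewrite -hy Ty.
have exit_y : nth v0 (T y) (index t (behead (T y))) = u'.
  rewrite Ty [behead _]/= -(cat_cons u1) index_cat (negbTE tn) index_head addn0.
  by rewrite -cat_cons nth_cat ltnSn du' (last_nth v0).
have hung_y : hung (T2 y) = u'.
  by rewrite /T2 F2 /hung /= lastI rev_rcons /= du'.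
have u'V : u' \notin Vis.
  apply: contra hx => u'V; rewrite hung_x -hy; apply: Inv => //.
    by rewrite tip_x.
  by rewrite tip_x exit_y.
have edge_x : [set t; u] \in edge_seq (T x) by rewrite Tx edge_seq_cons mem_head.
have exit_edge z : t \in behead (T z) -> uniq (T z) ->
    [set t; nth v0 (T z) (index t (behead (T z)))] \in edge_seq (T z).
  move=> tz uz; have [t3 [u3 [q3 [Tz _ _ _ _]]]] := almost_pathsE z aT.
  move: tz; rewrite Tz; rewrite [behead _]/= => tz.
  set i := index t (u3 :: q3); have lt : i < size (u3 :: q3) by rewrite index_mem.
  have lt' : i < size (edge_seq [:: t3, u3 & q3]) by rewrite size_edge_seq.
  have := mem_nth set0 lt'; rewrite /edge_seq (nth_pairmap v0) //.
  by rewrite setUC nth_index.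
have u'u : u' != u.
  apply: contraNneq xy => e; apply/eqP; apply: (owner_unique aT edge_x).
  by rewrite -e -exit_y; apply: exit_edge.
have uV : u \notin Vis by rewrite -hung_x.
have [||||T' [aT' tT' gT' bT']] := IH T2 (u |: Vis) y _ aT2 _ by2.
- rewrite -ltnS; apply: leq_trans cV; rewrite ltnS; apply: proper_card; apply/properP; split.
    by rewrite setCS subsetUr.
  by exists u; rewrite !inE ?uV ?eqxx.
- by move=> v cv; rewrite g2; apply: gT.
- by rewrite hung_y !inE negb_or u'u.
- have -> : tip (T2 y) = t by rewrite /T2 F2.
  move=> z uz; have zy : z != y by apply: contraTneq uz => ->.
  rewrite T2o // ho; have [->|zx] := eqVneq z x; first by rewrite hung_x setU11.
  rewrite T2o // /T1 swap_o // in uz *; rewrite !in_setU1 => tz.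
  case/orP=> [/eqP e|eV]; last by rewrite Inv ?orbT // tip_x.
  case/eqP: zx; apply: (owner_unique aT _ edge_x).
  by rewrite -e; apply: exit_edge.
exists T'; split=> // [v|v|].
- by rewrite tT' /T2 flip_tips // swap_tips.
- by rewrite -g2.
- by rewrite -b2.
Qed.

(** If many trails hang at [u] but few of them are good, then two bad ones can be
swapped so that one of them becomes good. *)
Lemma repair_greedy T u : almost_paths T ->
  2 * n.+1./2 < hanging T u -> good T u <= n.+1./2 ->
  exists T', [/\ almost_paths T', forall v, tips T' v = tips T v,
      forall v, hanging T' v = hanging T v & bad T' < bad T].
Proof.
move=> aT hT gT.
pose S := [set z | ~~ uniq (T z) && (hung (T z) == u)].
have cS : n.+1./2 < #|S|.
  have : hanging T u = good T u + #|S|.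
    rewrite card_sumb -big_split; apply: eq_bigr => z _ /=.
    by case: (uniq _); case: eqP.
  lia.
have Sh z : z \in S -> hung (T z) = u by rewrite inE => /andP [_ /eqP].
have [x xS] : exists x, x \in S by apply/card_gt0P; lia.
have [y yS ty] := fresh_tip x aT Sh cS.
have [ux uy] : ~~ uniq (T x) /\ ~~ uniq (T y).
  by move: xS yS; rewrite !inE => /andP [-> _] /andP [-> _].
have xy : x != y.
  apply: contraNneq ux => e; move: ty; rewrite -e.
  have [t [u1 [q [Tx tu sq uq szq]]]] := almost_pathsE x aT.
  by rewrite Tx /tip /= in uq * => ->.
have hxy : hung (T x) = hung (T y) by rewrite !Sh.
exists (swap T x y); split.
- exact: swap_almost.
- by move=> v; apply: swap_tips.
- move=> v; apply: eq_bigr => z _; rewrite swap_hung //.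
- apply: (ltn_sum_two xy) => [z zx zy|]; first by rewrite swap_o.
  rewrite (negbTE ux) (negbTE uy) swap_l /= ty.
  case: aT => _ /(_ x) -> _ _ _ /=.
  by case: (uniq _).
Qed.

(** Swaps of bad trails first provide enough good trails at every vertex; the
remaining bad trails are then repaired one at a time.  The number of bad trails
decreases throughout. *)
Lemma repair T : almost_paths T ->
  (forall u, col u != s -> 2 * n.+1./2 < hanging T u) ->
  exists T', [/\ almost_paths T', forall v, tips T' v = tips T v
                & forall x, uniq (T' x)].
Proof.
have done_ T0 : bad T0 = 0 -> forall x, uniq (T0 x).
  move=> b0 x; apply/negPn/negP => ux.
  have : 0 < bad T0 by rewrite /bad (bigD1 x) //= ux.
  by rewrite b0.
have phase2 T0 : almost_paths T0 ->
    (forall u, col u != s -> n.+1./2 < good T0 u) ->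
    exists T', [/\ almost_paths T', forall v, tips T' v = tips T0 v
                & forall x, uniq (T' x)].
  have [k] := ubnP (bad T0); elim: k T0 => // k IH T0 bk aT gT.
  have [b0|] := posnP (bad T0); first by exists T0; split => //; apply: done_.
  rewrite lt0n sum_nat_eq0 => /forallPn [x] /=; rewrite eqb0 negbK => bx.
  have [||T1 [aT1 tT1 gT1 bT1]] := repair_at (Vis := set0) aT gT bx.
  - by rewrite inE.
  - by move=> z _ _; rewrite inE.
  have [||T' [aT' tT' uT']] := IH T1 _ aT1.
  - by apply: leq_trans bT1 _; rewrite -ltnS.
  - by move=> u cu; apply: leq_trans (gT1 u); apply: gT.
  by exists T'; split=> // v; rewrite tT'.
have [k] := ubnP (bad T); elim: k T => // k IH T bk aT hT.
have [/existsP [u /andP [cu gu]]|/existsPn allg] :=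
    boolP [exists u, (col u != s) && (good T u <= n.+1./2)].
  have [T1 [aT1 tT1 hT1 bT1]] := repair_greedy aT (hT u cu) gu.
  have [||T' [aT' tT' uT']] := IH T1 _ aT1.
  - by apply: leq_trans bT1 _; rewrite -ltnS.
  - by move=> v cv; rewrite hT1; apply: hT.
  by exists T'; split=> // v; rewrite tT'.
apply: phase2 => // u cu; have := allg u.
by rewrite cu /= -ltnNge.
Qed.

End Repair.

(** * Path decompositions from balanced labellings *)

Lemma fibrewise_bijection (I V E : finType) (f : I -> V) (B : {set E}) (h : E -> V) :
  (forall v, #|[set x | f x == v]| = #|[set e in B | h e == v]|) ->
  exists phi : I -> E, [/\ forall x, phi x \in B, forall x, h (phi x) = f x
    & forall F : E -> nat, \sum_x F (phi x) = \sum_(e in B) F e].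
Proof.
move=> fh; pose A v := [set x | f x == v]; pose C v := [set e in B | h e == v].
have [c|x0] := pickP I; last first.
  have noE e : (e \in B) = false.
    apply/negP => eB; have := fh (h e); rewrite (eq_card0 (A := [set x | _])).
      by move/esym/eqP; rewrite cards_eq0 => /eqP/setP/(_ e); rewrite !inE eB eqxx.
    by move=> x; have := x0 x.
  have absurd (x : I) : False by have := x0 x.
  exists (fun x => False_rect E (absurd x)); split=> [x|x|F]; try by case: (absurd x).
  by rewrite [LHS]big1 ?[RHS]big_pred0 // => x; case: (absurd x).
have [e0 e0B] : exists e0, e0 \in B.
  apply/card_gt0P; apply: (@leq_trans #|C (f c)|).
    by rewrite -fh; apply/card_gt0P; exists c; rewrite inE.
  by apply: subset_leq_card; apply/subsetP => e; rewrite inE => /andP [].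
pose phi x := nth e0 (enum (C (f x))) (index x (enum (A (f x)))).
have ind x : index x (enum (A (f x))) < size (enum (C (f x))).
  by rewrite -cardE -fh cardE index_mem mem_enum inE.
have phiC x : phi x \in C (f x) by rewrite -mem_enum; apply: mem_nth.
have hphi x : h (phi x) = f x by have := phiC x; rewrite inE => /andP [_ /eqP].
have inj : injective phi.
  move=> x y e; have fxy : f x = f y by rewrite -!hphi e.
  move/eqP: e; rewrite /phi fxy nth_uniq ?enum_uniq //; last first.
    by have := ind x; rewrite fxy.
  move/eqP => e; have xA : x \in enum (A (f y)) by rewrite mem_enum inE fxy.
  have yA : y \in enum (A (f y)) by rewrite mem_enum inE.
  by rewrite -(nth_index x xA) e nth_index.
have im : [set phi x | x in I] = B.
  apply/eqP; rewrite eqEcard; apply/andP; split.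
    by apply/subsetP => e /imsetP [x _ ->]; have := phiC x; rewrite inE => /andP [].
  rewrite card_imset // -[X in X <= _]sum1_card (partition_big h predT) //=.
  rewrite -[X in _ <= X]sum1_card (partition_big f predT) //=.
  apply: leq_sum => v _; rewrite !sum1dep_card.
  by rewrite -fh; apply: eq_leq; apply: eq_card => x; rewrite !inE.
exists phi; split=> // [x|F]; first by have := phiC x; rewrite inE => /andP [].
by rewrite -im big_imset // => x y _ _; apply: inj.
Qed.

Lemma card_set_eq (E : finType) (A : {set E}) e : #|[set x in A | x == e]| = (e \in A).
Proof.
have [eA|eA] := boolP (e \in A).
  rewrite (_ : [set x in A | x == e] = [set e]) ?cards1 //.
  by apply/setP => x; rewrite in_set in_set1; case: eqP => [->|]; rewrite ?andbF // eA.
rewrite (_ : [set x in A | x == e] = set0) ?cards0 //.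
apply/setP => x; rewrite in_set in_set0.
by case: eqP => [->|]; rewrite ?andbF // (negbTE eA).
Qed.

Section Layers.
Variables (G : sgraph) (col : G -> bool).
Hypothesis colP : forall x y : G, adj x y -> col x != col y.
Variable v0 : G.

(** Every edge has one end of each colour; [v0] is the default value off the edges. *)
Definition endpoint c (e : {set G}) : G := odflt v0 [pick v in e | col v == c].

Lemma endpointP e : e \in edges G -> forall c,
  [/\ col (endpoint c e) = c, adj (endpoint c e) (endpoint (~~ c) e)
    & e = [set endpoint c e; endpoint (~~ c) e]].
Proof.
move=> /edgesP [x [y [xy ->]]].
suff H x' y' : adj x' y' -> endpoint (col x') [set x'; y'] = x'.
  have yx : adj y x by rewrite adj_sym.
  have Hx := H _ _ xy; have Hy := H _ _ yx; rewrite setUC in Hy.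
  have := colP xy; have cyx : col y = ~~ col x.
    by have := colP xy; case: (col x) (col y) => [] [].
  move=> _ c; rewrite cyx in Hy.
  have [->|cx] : c = col x \/ c = ~~ col x by case: c (col x) => [] []; auto.
    by rewrite Hx Hy.
  by rewrite {c}cx negbK Hx Hy adj_sym xy setUC cyx.
move=> xy'; rewrite /endpoint; case: pickP => [z|/(_ x')]; last first.
  by rewrite !inE !eqxx.
rewrite !inE => /andP [/orP [] /eqP -> //].
by have := colP xy'; rewrite eq_sym => /negbTE ->.
Qed.

Lemma mem_endpoint e v : e \in edges G -> (v \in e) = (endpoint (col v) e == v).
Proof.
move=> eG; have [ce aee ee] := endpointP eG (col v).
have ve w : (w \in e) = (w == endpoint (col v) e) || (w == endpoint (~~ col v) e).
  by rewrite -in_set2 -ee.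
apply/idP/eqP => [|<-]; last by rewrite ve eqxx.
rewrite ve => /orP [/eqP/esym //|/eqP vn].
by have := colP aee; rewrite -vn ce eqxx.
Qed.

Definition degree (F : {set {set G}}) v := #|[set e in F | v \in e]|.

Lemma card_endpoint (F : {set {set G}}) c v : F \subset edges G ->
  #|[set e in F | endpoint c e == v]| = if col v == c then degree F v else 0.
Proof.
move=> FG; have [cv|cv] := eqVneq (col v) c.
  apply: eq_card => e; rewrite !inE; have [eF|//] := boolP (e \in F).
  by rewrite mem_endpoint ?(subsetP FG) // cv.
apply: eq_card0 => e; rewrite !inE; have [eF|//] := boolP (e \in F).
apply: contraNF cv => /eqP <-.
by have [-> //] := endpointP (subsetP FG _ eF) c.
Qed.

Variables (F : {set {set G}}) (l : nat) (lab : {set G} -> nat).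
Hypothesis FG : F \subset edges G.
Definition layer i := [set e in F | lab e == i].

Lemma layer_sub i : layer i \subset edges G.
Proof. by apply: subset_trans FG; apply/subsetP => e; rewrite inE => /andP []. Qed.

(** Stage [i] extends all paths by one edge of [layer i.+1]; the balance
condition makes their number at each vertex right, and the lower bound leaves
enough freedom to repair the resulting trails. *)
Lemma layered_paths_upto i : i < l ->
  (forall j v, j.+1 < l -> col v = odd j.+1 ->
     degree (layer j) v = degree (layer j.+1) v /\ 2 * j.+2./2 < degree (layer j) v) ->
  exists (I : finType) (T : I -> seq G),
  [/\ forall x, sorted (@adj G) (T x), forall x, uniq (T x) /\ size (T x) = i.+2,
      forall x, col (tip v0 (T x)) = odd i.+1,
      forall e, multiplicity T e = (e \in [set e in F | lab e <= i])
    & forall v, tips v0 T v = if col v == odd i.+1 then degree (layer i) v else 0].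
Proof.
move=> + bal; elim: i => [_|i IH il].
  pose A := layer 0; pose I : finType := {e | e \in A}.
  have cardI (P : pred {set G}) : #|[set x : I | P (val x)]| = #|[set e in A | P e]|.
    rewrite -(card_imset _ val_inj); apply: eq_card => e; rewrite [in RHS]inE.
    apply/imsetP/andP => [[x + ->]|[eA Pe]].
      by rewrite inE => Px; split=> //; apply: valP.
    by exists (Sub e eA); rewrite ?inE SubK.
  have AG x : val (x : I) \in edges G by apply: (subsetP (layer_sub 0)); apply: valP.
  exists I, (fun x => [:: endpoint true (val x); endpoint false (val x)]).
  split=> [x|x|x|e|v].
  - by have [_ /= -> _] := endpointP (AG x) true.
  - have [_ /= /adj_neq] := endpointP (AG x) true.
    by rewrite inE andbT.
  - by have [] := endpointP (AG x) true.
  - transitivity (\sum_(x : I) (val x == e)).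
      apply: eq_bigr => x _ /=; rewrite addn0; have [_ _ /= <-] := endpointP (AG x) true.
      by [].
    rewrite -card_sumb (cardI (pred1 e)) -[RHS]/(nat_of_bool _).
    by rewrite (card_set_eq A) !inE leqn0.
  - rewrite /tips /tip /= -card_sumb (cardI (fun e => endpoint true e == v)).
    by rewrite card_endpoint ?layer_sub.
have [I [T [so us ct mult tp]]] := IH (ltnW il).
have [|phi [phiB hphi sphi]] := @fibrewise_bijection I G _ (fun x => tip v0 (T x))
     (layer i.+1) (endpoint (odd i.+1)).
  move=> v; rewrite card_sumb card_endpoint ?layer_sub //.
  transitivity (tips v0 T v); first by [].
  by rewrite tp; case: eqP => // cv; have [] := bal i v il cv.
pose t x := endpoint (odd i.+2) (phi x).
have phiG x : phi x \in edges G by apply: (subsetP (layer_sub i.+1)).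
have phiE x : adj (t x) (tip v0 (T x)) /\ phi x = [set t x; tip v0 (T x)].
  have [_] := endpointP (phiG x) (odd i.+2); rewrite -/(t x).
  by rewrite (_ : ~~ odd i.+2 = odd i.+1) /= ?negbK // hphi.
pose T1 x := t x :: T x.
have aT1 : almost_paths col v0 (odd i.+2) i.+1 [set e in F | lab e <= i.+1] T1.
  split=> [x|x|x|x|e].
  - have := so x; have [] := us x; rewrite /T1; have [+ _] := phiE x; rewrite /tip.
    by case: (T x) => [|y q] //= ->.
  - by have [] := us x.
  - by have [_ /= ->] := us x.
  - by have [] := endpointP (phiG x) (odd i.+2).
  - transitivity (\sum_x ((phi x == e) + count_mem e (edge_seq (T x)))).
      apply: eq_bigr => x _; rewrite /T1; have [_ ->] := phiE x; have [_] := us x.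
      by rewrite /tip; case: (T x) => [|y q].
    rewrite big_split /= -/(multiplicity T e) mult (sphi (fun e' => (e' == e : nat))).
    rewrite -big_mkcondr /= sum1dep_card (card_set_eq (layer i.+1)) !inE.
    case: (e \in F) => //=; rewrite [in RHS]leq_eqVlt ltnS.
    by case: eqP => [->|_]; rewrite ?ltnn.
have [|T' [[so' _ sz' ct' mult'] tT' uT']] := repair colP aT1.
  move=> u cu; have cu' : col u = odd i.+1.
    by move: cu; rewrite /=; case: (col u) (odd i) => [] [].
  have -> : hanging v0 T1 u = tips v0 T u by [].
  by rewrite tp cu' eqxx; have [] := bal i u il cu'.
exists I, T'; split=> // v; rewrite tT' -(card_endpoint _ _ (layer_sub _)).
transitivity (\sum_x (endpoint (odd i.+2) (phi x) == v)); first by [].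
rewrite (sphi (fun e => (endpoint (odd i.+2) e == v : nat))) -big_mkcondr sum1dep_card.
by apply: eq_card => e; rewrite !inE.
Qed.

(** All paths start in the colour [false], so they pass from layer [j] to layer
[j.+1] at a vertex of the colour [odd j.+1]. *)
Lemma layered_paths : 0 < l -> (forall e, e \in F -> lab e < l) ->
  (forall j v, j.+1 < l -> col v = odd j.+1 ->
     degree (layer j) v = degree (layer j.+1) v /\ 2 * j.+2./2 < degree (layer j) v) ->
  exists (I : finType) (T : I -> seq G),
  [/\ forall x, sorted (@adj G) (T x), forall x, uniq (T x), forall x, size (T x) = l.+1
    & forall e, multiplicity T e = (e \in F)].
Proof.
move=> l0 lab_lt bal; have il : l.-1 < l by rewrite prednK.
have [I [T [so us _ mult _]]] := layered_paths_upto il bal.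
exists I, T; split=> // [x|x|e]; first by have [] := us x.
  by have [_ ->] := us x; rewrite prednK.
by rewrite mult inE; case: (boolP (e \in F)) => // /lab_lt lt; rewrite -ltnS prednK // lt.
Qed.

End Layers.

(** * Equitable edge colourings of bipartite multigraphs *)

Section TwoInvolutions.
Variables (X : finType) (a b : X -> X).
Hypotheses (aK : involutive a) (bK : involutive b).

(** The orbits of [a \o b] come in pairs exchanged by [a] and by [b]; one orbit
of each pair is made true. *)
Lemma free_involutions_coloring : (forall x, a x != x) -> (forall x, b x != x) ->
  exists c : X -> bool, forall x, c (a x) = ~~ c x /\ c (b x) = ~~ c x.
Proof.
move=> a_free b_free; pose g x := a (b x).
have gI : injective g by move=> x y /(inv_inj aK) /(inv_inj bK).
have gb x : g (b x) = a x by rewrite /g bK.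
have ag x : a (g x) = b x by rewrite /g aK.
have not_iter n : forall z, a z != iter n g z.
  have [k] := ubnP n; elim: k n => // k IH [|[|n]] nk z /=; first exact: a_free.
    by rewrite /g (inj_eq (inv_inj aK)) eq_sym.
  apply: contra (IH n _ (g z)); last by rewrite ltnS in nk; apply: ltn_trans nk.
  by rewrite ag -gb (inj_eq gI) -iterSr => /eqP ->.
have sym : connect_sym (frel g) by apply: fconnect_sym.
have rg x : froot g (g x) = froot g x.
  by apply/eqP; rewrite (root_connect sym) sym fconnect1.
have ra x y : froot g x = froot g y -> froot g (a x) = froot g (a y).
  move/eqP; rewrite (root_connect sym) => /iter_findex <-.
  elim: (findex _ _ _) => //= n ->; set z := iter n g x.
  by rewrite ag -(rg (b z)) gb.
pose c x := enum_rank (froot g x) < enum_rank (froot g (a x)).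
have neq x : froot g x != froot g (a x).
  rewrite (root_connect sym); apply/negP => /iter_findex e.
  by have := not_iter (findex g x (a x)) x; rewrite e eqxx.
have ca x : c (a x) = ~~ c x.
  rewrite /c aK -leqNgt [in RHS]leq_eqVlt; case: eqP => // /ord_inj /enum_rank_inj e.
  by have := neq x; rewrite e eqxx.
exists c => x; split=> //; rewrite -ca /c aK -[a (b x)]/(g x) rg.
by rewrite -(ag x) (ra _ _ (rg x)).
Qed.
End TwoInvolutions.

(** Fixed points are removed by doubling the set. *)
Lemma involutions_coloring (X : finType) (a b : X -> X) :
  involutive a -> involutive b ->
  exists c : X -> bool, forall x, (a x != x -> c (a x) = ~~ c x)
                               /\ (b x != x -> c (b x) = ~~ c x).
Proof.
pose d (a : X -> X) (x : X * bool) :=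
  if a x.1 == x.1 then (x.1, ~~ x.2) else (a x.1, x.2).
have dK f : involutive f -> involutive (d f).
  move=> fK [x i]; rewrite /d /=; have [e|ne] := eqVneq (f x) x.
    by rewrite /= e eqxx negbK.
  by rewrite /= fK eq_sym (negbTE ne).
have d_free f x : d f x != x.
  case: x => x i; rewrite /d /=; have [_|ne] := eqVneq (f x) x.
    by rewrite xpair_eqE eqxx; case: i.
  by rewrite xpair_eqE (negbTE ne).
move=> aK bK.
have [c cP] := free_involutions_coloring (dK a aK) (dK b bK) (d_free a) (d_free b).
exists (fun x => c (x, false)) => x; have [] := cP (x, false); rewrite /d /=.
by move=> ca cb; split=> [ne|ne]; [rewrite (negbTE ne) in ca|rewrite (negbTE ne) in cb].
Qed.

(** A largest set of disjoint pairs inside the fibres leaves at most one element of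
each fibre alone. *)
Lemma pairing (X : finType) (U : eqType) (f : X -> U) : exists a : X -> X,
  [/\ involutive a, forall x, f (a x) = f x
    & forall x y, f x = f y -> a x = x -> a y = y -> x = y].
Proof.
pose P (a : {ffun X -> X}) := [forall x, (a (a x) == x) && (f (a x) == f x)].
pose N (a : {ffun X -> X}) := #|[set x | a x == x]|.
have P1 : P [ffun x => x] by apply/forallP => x; rewrite !ffunE !eqxx.
have [a Pa amin] := arg_minnP N P1.
have aK x : a (a x) = x by have /andP [/eqP] := forallP Pa x.
have fa x : f (a x) = f x by have /andP [_ /eqP] := forallP Pa x.
exists a; split=> // x y fxy ax ay; apply/eqP/negPn/negP => xy.
pose a' := [ffun z => if z == x then y else if z == y then x else a z].
have yx : (y == x) = false by rewrite eq_sym; apply/negbTE.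
have neq z w : a w = w -> z != w -> a z != w.
  by move=> aw; apply: contra => /eqP e; rewrite -(aK z) e aw.
have /amin : P a'.
  apply/forallP => z; rewrite !ffunE.
  have [->|zx] := eqVneq z x; first by rewrite yx !eqxx fxy eqxx.
  have [->|zy] := eqVneq z y; first by rewrite !eqxx fxy eqxx.
  by rewrite (negbTE (neq _ _ ax zx)) (negbTE (neq _ _ ay zy)) aK fa !eqxx.
apply/negP; rewrite -ltnNge; apply: proper_card; apply/properP; split.
  apply/subsetP => z; rewrite !inE ffunE.
  have [->|zx] := eqVneq z x; first by rewrite yx.
  by have [->|zy] := eqVneq z y; first by rewrite (negbTE xy).
by exists x; rewrite !inE ?ax // ffunE eqxx yx.
Qed.

Definition fibre_count (X U : finType) (C : eqType) (f : X -> U) (c : X -> C) u k :=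
  #|[set x | (f x == u) && (c x == k)]|.

(** The elements are paired up inside the fibres of [f], and also inside those of
[f'], and [c] separates all these pairs. *)
Lemma equitable_split (X U U' : finType) (f : X -> U) (f' : X -> U') :
  exists c : X -> bool,
    (forall u b, fibre_count f c u b <= (fibre_count f c u (~~ b)).+1) /\
    (forall u b, fibre_count f' c u b <= (fibre_count f' c u (~~ b)).+1).
Proof.
have [a [aK fa afix]] := pairing f; have [a' [a'K fa' a'fix]] := pairing f'.
have [c cP] := involutions_coloring aK a'K.
suff H (V : finType) (h : X -> V) (e : X -> X) : involutive e ->
    (forall x, h (e x) = h x) -> (forall x y, h x = h y -> e x = x -> e y = y -> x = y) ->
    (forall x, e x != x -> c (e x) = ~~ c x) ->
    forall u b, fibre_count h c u b <= (fibre_count h c u (~~ b)).+1.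
  exists c; split; [apply: (H _ f a)|apply: (H _ f' a')] => // x.
    by have [] := cP x.
  by have [] := cP x.
move=> eK he efix ce u b.
pose A b := [set x | (h x == u) && (c x == b)]; pose Fx := [set x | e x == x].
rewrite /fibre_count -/(A b) -/(A (~~ b)) -(cardsID Fx) -addn1 addnC; apply: leq_add.
  rewrite -(card_imset _ (inv_inj eK)); apply: subset_leq_card.
  apply/subsetP => y /imsetP [x]; rewrite !inE => /and3P [ex /eqP hx /eqP cx] ->.
  by rewrite he hx ce // cx !eqxx.
rewrite -[X in _ <= X](cards1 u); apply: (@leq_trans #|[set h x | x in A b :&: Fx]|).
  rewrite card_in_imset // => x y; rewrite !inE => /andP [_ /eqP ex] /andP [_ /eqP ey] hxy.
  exact: efix.
apply: subset_leq_card; apply/subsetP => v /imsetP [x].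
by rewrite !inE => /andP [/andP [/eqP -> _] _] ->.
Qed.

Lemma sq_balance p q x y : p + q = x + y -> x <= y.+1 -> y <= x.+1 ->
  x ^ 2 + y ^ 2 <= p ^ 2 + q ^ 2 /\ (q.+1 < p -> x ^ 2 + y ^ 2 < p ^ 2 + q ^ 2).
Proof.
rewrite -!mulnn => e xy yx.
have [xp|px] := leqP x p.
  have [d pd] : exists d, p = x + d by exists (p - x); lia.
  have yd : y = q + d by lia.
  subst; split; nia.
have [d pd] : exists d, x = p + d by exists (x - p); lia.
have yd : q = y + d by lia.
subst; split; nia.
Qed.

(** Any two colour classes of a colouring that minimizes the sum of the squares
of the counts can be split again, so they are balanced at every node. *)
Lemma equitable_coloring (X U U' : finType) (f : X -> U) (f' : X -> U') n : 0 < n ->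
  exists c : X -> 'I_n,
    (forall u i j, fibre_count f c u i <= (fibre_count f c u j).+1) /\
    (forall u i j, fibre_count f' c u i <= (fibre_count f' c u j).+1).
Proof.
move=> n0; pose sq (V : finType) (h : X -> V) (c : {ffun X -> 'I_n}) u :=
  \sum_k fibre_count h c u k ^ 2.
pose Phi c := \sum_u sq _ f c u + \sum_u sq _ f' c u.
have [c _ cmin] := @arg_minnP _ [ffun=> Ordinal n0] predT Phi isT.
suff H i j : i != j ->
    (forall u, fibre_count f c u i <= (fibre_count f c u j).+1) /\
    (forall u, fibre_count f' c u i <= (fibre_count f' c u j).+1).
  exists c; split=> u i j; have [->|ij] := eqVneq i j; rewrite ?leqnSn //.
    by have [] := H i j ij.
  by have [] := H i j ij.
move=> ij.
pose S x := (c x == i) || (c x == j).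
pose r (V : finType) (h : X -> V) x := if S x then Some (h x) else None.
have [b [bf bf']] := equitable_split (r _ f) (r _ f').
pose c' : {ffun X -> 'I_n} := [ffun x => if S x then if b x then i else j else c x].
have Si x : c' x == i = S x && b x.
  rewrite ffunE /S; have [ci|ci] := eqVneq (c x) i; first by case: (b x); rewrite ?eqxx // eq_sym (negbTE ij).
  have [cj|cj] := eqVneq (c x) j; last by rewrite (negbTE ci).
  by case: (b x); rewrite ?eqxx // eq_sym (negbTE ij).
have Sj x : c' x == j = S x && ~~ b x.
  rewrite ffunE /S; have [ci|ci] := eqVneq (c x) i; first by case: (b x); rewrite ?eqxx // (negbTE ij).
  have [cj|cj] := eqVneq (c x) j; last by rewrite (negbTE cj).
  by case: (b x); rewrite ?eqxx // (negbTE ij).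
have So k : k != i -> k != j -> forall x, (c' x == k) = (c x == k).
  rewrite ![k == _]eq_sym => /negbTE ik /negbTE jk x; rewrite ffunE /S.
  have [->|ci] := eqVneq (c x) i.
    by case: (b x); rewrite ik ?jk.
  have [->|cj] //= := eqVneq (c x) j.
  by case: (b x); rewrite jk ?ik.
have main (V : finType) (h : X -> V) :
    (forall u b0, fibre_count (r _ h) b u b0 <= (fibre_count (r _ h) b u (~~ b0)).+1) ->
    (forall u, sq _ h c' u <= sq _ h c u) /\
    (forall u, (fibre_count h c u j).+1 < fibre_count h c u i -> sq _ h c' u < sq _ h c u).
  move=> bh.
  have ei u : fibre_count h c' u i = fibre_count (r _ h) b (Some u) true.
    apply: eq_card => x; rewrite !inE Si /r; case: (S x); rewrite ?andbF ?andbT //.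
    by case: (b x); rewrite ?andbF ?andbT.
  have ej u : fibre_count h c' u j = fibre_count (r _ h) b (Some u) false.
    apply: eq_card => x; rewrite !inE Sj /r; case: (S x); rewrite ?andbF ?andbT //.
    by case: (b x); rewrite ?andbF ?andbT.
  have sum u : fibre_count h c u i + fibre_count h c u j =
               fibre_count h c' u i + fibre_count h c' u j.
    rewrite /fibre_count -cardsUI -[RHS]cardsUI; congr (_ + _).
      apply: eq_card => x; rewrite !inE -!andb_orr Si Sj -/(S x).
      by case: (S x); case: (b x).
    apply: eq_card => x; rewrite !inE Si Sj.
    have [->|_] := eqVneq (c x) i; first by rewrite (negbTE ij) !andbF; case: (b x); rewrite !andbF.
    by rewrite !andbF; case: (b x); rewrite !andbF.
  have b1 u : fibre_count h c' u i <= (fibre_count h c' u j).+1.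
    by rewrite ei ej; apply: (bh _ true).
  have b2 u : fibre_count h c' u j <= (fibre_count h c' u i).+1.
    by rewrite ei ej; apply: (bh _ false).
  have other u k : k != i -> k != j -> fibre_count h c u k ^ 2 = fibre_count h c' u k ^ 2.
    move=> ki kj; congr (_ ^ 2); apply: eq_card => x; rewrite !inE So //.
  split=> u.
    by apply: (leq_sum_two ij (other u)); have [] := sq_balance (sum u) (b1 u) (b2 u).
  move=> gap; apply: (ltn_sum_two ij (other u)).
  by have [_] := sq_balance (sum u) (b1 u) (b2 u); apply.
have [m1 s1] := main _ f bf; have [m2 s2] := main _ f' bf'.
have := cmin c' isT; rewrite leqNgt; split=> u; rewrite leqNgt; apply: contra H => gap.
  rewrite /Phi -addSn leq_add ?leq_sum //.
  rewrite (bigD1 u) //= [X in _ < X](bigD1 u) //= -addSn leq_add ?s1 // leq_sum //.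
rewrite /Phi -addnS leq_add ?leq_sum //.
rewrite (bigD1 u) //= [X in _ < X](bigD1 u) //= -addSn leq_add ?s2 // leq_sum //.
Qed.

(** * Connected edge sets, Euler tours and joins *)

Section EdgeSets.
Variable G : sgraph.
Implicit Types (F : {set {set G}}) (u v w x y z : G) (p q s : seq G).

Definition linked F : rel G := connect (fun u v => [set u; v] \in F).
Definition spanning F := forall u v, linked F u v.
Definition even_degrees F := forall v, ~~ odd (degree F v).

Lemma linked_sym F : symmetric (linked F).
Proof. by apply: sym_connect_sym => u v; rewrite setUC. Qed.

Lemma linked_sub F F' u v : F \subset F' -> linked F u v -> linked F' u v.
Proof.
by move=> FF'; apply: connect_sub => a b ab; apply/connect1/(subsetP FF').
Qed.

Lemma linked_cross F (S : pred G) u v : linked F u v -> S u -> ~~ S v ->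
  exists a b, [/\ S a, ~~ S b & [set a; b] \in F].
Proof.
case/connectP=> p; elim: p u => [|w p IH] u /=; first by move=> _ -> ->.
case/andP=> uw pw lv Su Sv; have [Sw|Sw] := boolP (S w); last by exists u, w.
exact: IH pw lv Sw Sv.
Qed.

Lemma edge_adj u v : ([set u; v] \in edges G) = adj u v.
Proof.
apply/edgesP/idP => [[x [y [xy e]]]|uv]; last by exists u, v.
have xin : x \in [set u; v] by rewrite e !inE eqxx.
have yin : y \in [set u; v] by rewrite e !inE eqxx orbT.
move: xin yin; rewrite !inE => /orP [] /eqP ex /orP [] /eqP ey; move: xy; rewrite ex ey //.
- by rewrite adj_irrefl.
- by rewrite adj_sym.
- by rewrite adj_irrefl.
Qed.

Lemma degree0 v : degree set0 v = 0.
Proof. by apply: eq_card0 => e; rewrite !inE. Qed.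

Lemma degreeE F v : degree F v = \sum_(e in F) (v \in e).
Proof.
rewrite /degree -sum1dep_card big_mkcondr; apply: eq_bigr => e _.
by case: (v \in e).
Qed.

Lemma count_mem_sum (t : seq {set G}) v :
  count (fun e : {set G} => v \in e) t = \sum_(e <- t) (v \in e : nat).
Proof. by elim: t => [|e t IH]; rewrite ?big_nil // big_cons -IH. Qed.

Lemma degree_set (t : seq {set G}) v : uniq t ->
  degree [set e in t] v = count (fun e : {set G} => v \in e) t.
Proof.
move=> us; rewrite degreeE count_mem_sum big_uniq //.
by apply: eq_bigl => e; rewrite inE.
Qed.

Lemma degree_disjoint F F' v : [disjoint F & F'] ->
  degree (F :|: F') v = degree F v + degree F' v.
Proof.
by move=> dj; rewrite !degreeE -bigU //; apply: eq_bigl => e; rewrite !inE.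
Qed.

Lemma degree_setD F F' v : F' \subset F ->
  degree F v = degree F' v + degree (F :\: F') v.
Proof. by move=> sub; rewrite !degreeE (big_setID F') /= (setIidPr sub). Qed.

Lemma mem_edge_xor u w z : u != w -> (z \in [set u; w]) = (z == u) (+) (z == w).
Proof.
by move=> uw; rewrite !inE; have [->|] := eqVneq z u; rewrite ?(negbTE uw).
Qed.

Lemma degree_del F u w z : u != w -> [set u; w] \in F ->
  odd (degree (F :\ [set u; w]) z) = odd (degree F z) (+) (z == u) (+) (z == w).
Proof.
move=> uw eF; rewrite [in RHS](degree_setD z (_ : [set [set u; w]] \subset F)) ?sub1set //.
rewrite oddD {2}/degree.
have -> : [set e in [set [set u; w]] | z \in e]
          = if z \in [set u; w] then [set [set u; w]] else set0.
  apply/setP => e; rewrite inE in_set1; have [->|ne] := eqVneq.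
    by case: ifP; rewrite ?inE // eqxx.
  by case: ifP => _; rewrite !inE ?(negbTE ne).
rewrite (fun_if (fun A : {set {set G}} => #|A|)) cards1 cards0 (fun_if odd) /=.
rewrite mem_edge_xor //.
by case: (z == u) (z == w) (odd _) => [] [] [].
Qed.

Lemma trail_parity u p v : sorted (@adj G) (u :: p) ->
  odd (count (fun e : {set G} => v \in e) (edge_seq (u :: p))) = (v == u) (+) (v == last u p).
Proof.
elim: p u => [|w p IH] u /=; first by rewrite addbb.
case/andP=> /adj_neq uw pw; rewrite oddD -/(edge_seq (w :: p)) IH // oddb.
by rewrite mem_edge_xor // -addbA; case: (v == w); case: (v == last w p).
Qed.

(** A walk that uses no edge twice can be continued as long as it has not come to
[v], by the parity of the remaining degrees. *)
Lemma odd_trail F u v : F \subset edges G ->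
  (forall z, odd (degree F z) = (z == u) (+) (z == v)) ->
  exists p, [/\ last u p = v, uniq (edge_seq (u :: p))
              & {subset edge_seq (u :: p) <= F}].
Proof.
have [n] := ubnP #|F|; elim: n F u => // n IH F u Fn FG par.
have [<-|uv] := eqVneq u v; first by exists [::].
have : 0 < degree F u.
  by rewrite lt0n; apply/eqP => d0; have := par u; rewrite d0 eqxx (negbTE uv).
case/card_gt0P => e; rewrite inE => /andP [eF ue].
have [w ew] : exists w, e = [set u; w].
  have /edgesP [a [b [_ eab]]] := subsetP FG e eF; move: ue; rewrite eab !inE.
  by case/orP=> /eqP ->; [exists b|exists a; rewrite setUC].
subst e; have uw : u != w by apply: adj_neq; rewrite -edge_adj (subsetP FG).
have [|||p [lp up pF]] := IH (F :\ [set u; w]) w.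
- by move: Fn; rewrite (cardsD1 [set u; w]) eF.
- by apply: subset_trans FG; apply: subD1set.
- move=> z; rewrite degree_del // par; case: (z == u); case: (z == w); by case: (z == v).
exists (w :: p); split=> //.
  rewrite edge_seq_cons cons_uniq up andbT.
  by apply/negP => /pF; rewrite !inE eqxx.
move=> e; rewrite edge_seq_cons in_cons => /orP [/eqP -> //|/pF].
by rewrite inE => /andP [].
Qed.

Lemma edge_seq_cat_cons s z q :
  edge_seq (s ++ z :: q) = edge_seq (rcons s z) ++ edge_seq (z :: q).
Proof.
by case: s => [|a s] //; rewrite -cats1 /= !pairmap_cat /= -catA.
Qed.

Lemma sub_edges_sorted s : {subset edge_seq s <= edges G} -> sorted (@adj G) s.
Proof.
elim: s => [|x [|y s] IH] // sub; rewrite /= -edge_adj sub ?mem_head //=.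
by apply: IH => e es; apply: sub; rewrite edge_seq_cons in_cons es orbT.
Qed.

(** A closed trail that misses an edge can be enlarged at a vertex where a missing
edge starts. *)
Lemma euler_tour F u : F \subset edges G -> even_degrees F -> spanning F ->
  exists p, [/\ last u p = u, uniq (edge_seq (u :: p)) & edge_seq (u :: p) =i F].
Proof.
move=> FG ev con.
suff H n p : #|F| - size p < n -> last u p = u -> uniq (edge_seq (u :: p)) ->
    {subset edge_seq (u :: p) <= F} ->
    exists p, [/\ last u p = u, uniq (edge_seq (u :: p)) & edge_seq (u :: p) =i F].
  by apply: (H #|F|.+1 [::]) => //=; rewrite subn0.
elim: n p => // n IH p pn lp up pF.
pose R := F :\: [set e in edge_seq (u :: p)].
have [/eqP R0|/set0Pn [e eR]] := boolP (R == set0).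
  exists p; split=> // e; apply/idP/idP => [/pF //|eF].
  by have := in_set0 e; rewrite -R0 !inE eF andbT => /negbFE.
have RF : R \subset F by apply: subsetDl.
have sP : sorted (@adj G) (u :: p).
  by apply: sub_edges_sorted => f /pF; apply/subsetP.
have [z [w [zp zwR]]] : exists z w, z \in u :: p /\ [set z; w] \in R.
  have /edgesP [x [y [_ exy]]] := subsetP FG _ (subsetP RF _ eR).
  have [xp|xp] := boolP (x \in u :: p); first by exists x, y; rewrite -exy.
  have [a [b [ap bp abF]]] := @linked_cross F (mem (u :: p)) u x (con u x) (mem_head u p) xp.
  exists a, b; split=> //; rewrite !inE abF andbT.
  by apply: contra bp => /edge_seq_sub H; apply: H; rewrite !inE eqxx orbT.
have zw : z != w.
  by apply: adj_neq; rewrite -edge_adj (subsetP FG) // (subsetP RF).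
have Rev x : odd (degree R x) = false.
  have sub : [set e in edge_seq (u :: p)] \subset F.
    by apply/subsetP => f; rewrite inE => /pF.
  have := ev x; rewrite (degree_setD x sub) oddD degree_set // trail_parity // lp addbb.
  by move/negbTE.
have [||q [lq uq qR]] := @odd_trail (R :\ [set z; w]) w z.
- by apply: subset_trans FG; apply: subset_trans RF; apply: subD1set.
- by move=> x; rewrite degree_del // Rev addbC.
have qR' f : f \in edge_seq (w :: q) -> (f != [set z; w]) && (f \in R).
  by move/qR; rewrite !inE.
have [q' eq'] : exists q', w :: q = rcons q' z.
  by exists (belast w q); rewrite -lq -lastI.
have [p1 [p2 ep]] : exists p1 p2, u :: p = p1 ++ z :: p2.
  by case/splitPr: zp => p1 p2; exists p1, p2.
pose s := p1 ++ z :: (w :: q) ++ p2.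
have [p' es] : exists p', s = u :: p'.
  by case: p1 ep @s => [|a p1] /= [-> _]; eexists.
have eds : perm_eq (edge_seq s) (edge_seq (u :: p) ++ [set z; w] :: edge_seq (w :: q)).
  rewrite /s edge_seq_cat_cons ep edge_seq_cat_cons -catA perm_cat2l.
  rewrite eq' cat_rcons -cat_cons edge_seq_cat_cons.
  rewrite -[rcons (z :: q') z]/(z :: rcons q' z) -eq' edge_seq_cons.
  by rewrite perm_catC.
have up' : uniq (edge_seq (u :: p')).
  rewrite -es (perm_uniq eds) cat_uniq up cons_uniq uq andbT andTb; apply/andP; split.
    apply/hasPn => f; rewrite in_cons => /orP [/eqP ->|/qR' /andP [_]].
      by move: zwR; rewrite !inE => /andP [].
    by rewrite !inE => /andP [].
  by apply/negP => /qR' /andP [/eqP].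
have pF' : {subset edge_seq (u :: p') <= F}.
  move=> f; rewrite -es (perm_mem eds) mem_cat in_cons => /or3P [/pF //|/eqP ->|/qR' /andP [_]].
    exact: (subsetP RF).
  exact: (subsetP RF).
have szp : size p < size p'.
  have := perm_size eds; rewrite es size_cat /= !size_pairmap; lia.
apply: (IH p') => //.
  have : size p' <= #|F|.
    have := size_edge_seq (u :: p') => /= <-; rewrite cardE; apply: uniq_leq_size => //.
    by move=> f /pF'; rewrite mem_enum.
  by move: pn szp; clear; lia.
have : last u (u :: p') = last u (u :: p).
  by rewrite -es ep /s !last_cat /= last_cat lq.
by rewrite /= => ->.
Qed.

Definition symdiff (T : finType) (A B : {set T}) := (A :\: B) :|: (B :\: A).

Lemma odd_symdiff (T : finType) (A B : {set T}) :
  odd #|symdiff A B| = odd #|A| (+) odd #|B|.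
Proof.
have dj : [disjoint A :\: B & B :\: A].
  by rewrite -setI_eq0; apply/eqP/setP => x; rewrite !inE; case: (x \in A); rewrite ?andbF.
have := leq_card_setU (A :\: B) (B :\: A); rewrite dj => - [_ /eqP e].
rewrite /symdiff e -(cardsID B A) -(cardsID A B) setIC !oddD.
by case: (odd #|_ :&: _|); case: (odd _); case: (odd _).
Qed.

Lemma degree_symdiff F F' v :
  odd (degree (symdiff F F') v) = odd (degree F v) (+) odd (degree F' v).
Proof.
rewrite /degree -odd_symdiff; congr (odd _); apply: eq_card => e; rewrite !inE.
by case: (v \in e); rewrite ?andbT ?andbF.
Qed.

Lemma symdiff_sub F F' F0 : F \subset F0 -> F' \subset F0 -> symdiff F F' \subset F0.
Proof.
move=> s s'; rewrite subUset; apply/andP; split; apply: subset_trans (subsetDl _ _) _ => //.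
Qed.

(** The elements of [O] are joined in pairs by walks, whose edge sets are added
modulo two. *)
Lemma join F (O : {set G}) : F \subset edges G -> spanning F -> ~~ odd #|O| ->
  exists J : {set {set G}}, J \subset F /\ forall v, odd (degree J v) = (v \in O).
Proof.
move=> FG con.
have pair u v : exists J : {set {set G}}, J \subset F /\
    forall z, odd (degree J z) = (z == u) (+) (z == v).
  have /connectP [p] := con u v; elim: p u => [|w p IH] u /= => [_ ->|/andP [uw pw] lv].
    by exists set0; rewrite sub0set; split=> // z; rewrite degree0 addbb.
  have [J [JF Jp]] := IH w pw lv.
  exists (symdiff [set [set u; w]] J); rewrite symdiff_sub ?sub1set //; split=> // z.
  have nuw : u != w by apply: adj_neq; rewrite -edge_adj (subsetP FG).
  have := degree_del z nuw (set11 [set u; w]); rewrite setDv degree0 /=.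
  rewrite degree_symdiff Jp; set a := odd (degree [set _] z); clearbody a.
  by case: a (z == u) (z == w) (z == v) => [] [] [] [].
have [n] := ubnP #|O|; elim: n O => // n IH O On ev.
have [->|/set0Pn [u uO]] := eqVneq O set0.
  by exists set0; rewrite sub0set; split=> // v; rewrite degree0 inE.
have cO := cardsD1 u O; rewrite uO in cO.
have : 0 < #|O :\ u| by rewrite lt0n; apply: contraNneq ev => c0; rewrite cO c0.
case/card_gt0P => v vO; have cO' := cardsD1 v (O :\ u); rewrite vO in cO'.
have [||J [JF Jp]] := IH (O :\ u :\ v).
- by rewrite cO cO' in On; lia.
- by move: ev; rewrite cO cO' !add1n /= negbK.
have [J' [JF' Jp']] := pair u v.
exists (symdiff J J'); rewrite symdiff_sub //; split=> // z.
rewrite degree_symdiff Jp Jp'; move: vO; rewrite !inE => /andP [vu vO].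
have [->|zu] := eqVneq z u; first by rewrite andbF uO eq_sym (negbTE vu).
by have [->|zv] := eqVneq z v; rewrite /= ?vO // addbF.
Qed.

Lemma card_edge e : e \in edges G -> #|e| = 2.
Proof. by move=> /edgesP [x [y [/adj_neq xy ->]]]; rewrite cards2 xy. Qed.

Lemma handshake F : F \subset edges G -> \sum_v degree F v = 2 * #|F|.
Proof.
move=> FG; under eq_bigr => v _ do rewrite degreeE.
rewrite exchange_big /= mulnC -sum_nat_const; apply: eq_bigr => e eF.
by rewrite -(card_edge (subsetP FG e eF)) -card_sumb; apply: eq_card => v; rewrite inE.
Qed.

Lemma odd_sum (T : finType) (P : pred T) (f : T -> nat) :
  odd (\sum_(x | P x) f x) = odd #|[set x | P x && odd (f x)]|.
Proof.
rewrite -sum1dep_card big_mkcondr /=.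
apply: (big_ind2 (fun a b => odd a = odd b)) => // [a b c d|x _].
  by rewrite !oddD => -> ->.
by case: (odd (f x)).
Qed.

(** A join in [F'] corrects the vertices of odd degree in [F]. *)
Lemma even_supergraph F F' : F \subset edges G -> F' \subset edges G -> [disjoint F & F'] ->
  spanning F -> spanning F' -> exists V : {set {set G}},
  [/\ F \subset V, V \subset F :|: F' & even_degrees V].
Proof.
move=> FG FG' dj con con'.
have [|J [JF Jp]] := join (O := [set v | odd (degree F v)]) FG' con'.
  have := odd_sum predT (degree F); rewrite handshake // oddM /=.
  by move=> e; rewrite [#|_|](_ : _ = #|[set x | predT x && odd (degree F x)]|) // -e.
exists (F :|: J); rewrite subsetUl setUS //; split=> // v.
rewrite degree_disjoint; last by apply: disjointWr dj.
by rewrite oddD Jp inE addbb.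
Qed.

End EdgeSets.

Section ParitySelection.
Variables (G : sgraph) (col : G -> bool).
Hypothesis colP : forall x y : G, adj x y -> col x != col y.
Variable c : bool.

Lemma col_last b p : sorted (@adj G) (b :: p) -> col (last b p) = col b (+) odd (size p).
Proof.
elim: p b => [|a p IH] b /=; first by rewrite addbF.
case/andP=> /colP ba /IH ->.
by case: (col a) (col b) ba => [] [] //=; case: (odd _).
Qed.

(** Along a walk, one edge of each pair of consecutive edges around the vertices
of the other colour is selected.  At the last passage of the walk through a
vertex [y] of colour [c] both parities are still possible. *)
Lemma select_walk b p (P : pred G) :
  sorted (@adj G) (b :: p) -> ~~ odd (size p) -> col b = c ->
  exists sel rest : seq {set G}, [/\ perm_eq (sel ++ rest) (edge_seq (b :: p)),
    forall x, col x != c -> count (fun e : {set G} => x \in e) sel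
                            = count (fun e : {set G} => x \in e) rest,
    size sel = size rest
    & forall y, col y = c -> y \in b :: p -> y != last b p ->
        odd (count (fun e : {set G} => y \in e) sel) = P y].
Proof.
have [n] := ubnP (size p); elim: n b p P => // n IH b [|a [|b1 p]] P //= szp.
  by exists [::], [::]; split=> // y _; rewrite inE => ->.
case/and3P=> ba ab1 pp; rewrite negbK => ev cb.
have ca : col a != c by rewrite -cb eq_sym; apply: colP.
have cb1 : col b1 = c.
  by have := colP ab1; move: ca; case: (col a) (col b1) (c) => [] [] [].
pose first := (b \in b1 :: p) || P b.
pose P' y := P y (+) (y == (if first then b else b1)).
have [|sel [rest [perm x_cnt sz y_par]]] := IH b1 p P' _ pp ev cb1.
  by apply: ltnW; rewrite -ltnS.
have xn b' x : col b' = c -> col x != c -> (x == b') = false.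
  by move=> cb' cx; apply: contraNF cx => /eqP ->; rewrite cb'.
have bn1 x : col x != c -> (x \in [set b; a]) = (x == a).
  by move=> cx; rewrite !inE (xn b).
have bn2 x : col x != c -> (x \in [set a; b1]) = (x == a).
  by move=> cx; rewrite !inE (xn b1) ?orbF.
have yna y : col y = c -> (y == a) = false.
  by move=> cy; apply: contraNF ca => /eqP <-; rewrite cy.
have yn1 y : col y = c -> (y \in [set b; a]) = (y == b).
  by move=> cy; rewrite !inE yna // orbF.
have yn2 y : col y = c -> (y \in [set a; b1]) = (y == b1).
  by move=> cy; rewrite !inE yna.
have sel_mem e : e \in sel -> e \in edge_seq (b1 :: p).
  by move=> es; rewrite -(perm_mem perm) mem_cat es.
have par y : col y = c -> y \in [:: b, a, b1 & p] -> y != last b1 p ->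
    odd ((y == (if first then b else b1)) + count (fun e : {set G} => y \in e) sel) = P y.
  move=> cy yp yl; rewrite oddD oddb.
  have [yp1|yp1] := boolP (y \in b1 :: p).
    by rewrite y_par // /P'; case: (P y); case: (_ == _).
  have -> : count (fun e : {set G} => y \in e) sel = 0.
    apply/eqP; rewrite -leqn0 leqNgt -has_count; apply/hasPn => e /sel_mem es.
    by apply: contra yp1 => ye; apply: edge_seq_sub es ye.
  have yb : y = b.
    move: yp; rewrite in_cons => /orP [/eqP //|]; rewrite in_cons (negbTE yp1) orbF.
    by rewrite yna.
  rewrite yb /first -yb (negbTE yp1) /= addbF.
  case: (P y); rewrite ?eqxx //; apply/negbTE.
  by apply: contraNneq yp1 => ->; rewrite mem_head.
move: par; case: ifP => hf par; rewrite -/(edge_seq (b1 :: p)).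
  exists ([set b; a] :: sel), ([set a; b1] :: rest); split=> /=.
  - apply/permP => pr; have /permP/(_ pr) := perm.
    by rewrite /= !count_cat /= => <-; rewrite (addnCA (count pr sel)).
  - by move=> x cx; rewrite bn1 // bn2 // x_cnt.
  - by rewrite sz.
  - by move=> y cy yp yl; rewrite yn1 // par.
exists ([set a; b1] :: sel), ([set b; a] :: rest); split=> /=.
- apply/permP => pr; have /permP/(_ pr) := perm.
  by rewrite /= !count_cat /= => <-; rewrite (addnCA (count pr sel)) addnCA.
- by move=> x cx; rewrite bn1 // bn2 // x_cnt.
- by rewrite sz.
- by move=> y cy yp yl; rewrite yn2 // par.
Qed.

Lemma one_endpoint e : e \in edges G -> \sum_(y | col y == c) (y \in e) = 1.
Proof.
move=> eG; rewrite -big_mkcondr sum1dep_card.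
have /edgesP [x [y [xy exy]]] := eG.
wlog cx : x y xy exy / col x = c.
  move=> H; have [cx|cx] := eqVneq (col x) c; first exact: H xy exy cx.
  apply: (H y x); rewrite 1?adj_sym 1?setUC //.
  by have := colP xy; move: cx; case: (col x) (col y) (c) => [] [] [].
have cy : col y != c by rewrite -cx eq_sym; apply: colP.
rewrite (_ : [set _ | _] = [set x]) ?cards1 //; apply/setP => z.
rewrite !inE exy !inE; have [->|zx] := eqVneq z x; first by rewrite cx eqxx.
by have [->|zy] := eqVneq z y; rewrite ?andbF // (negbTE cy).
Qed.

(** The selection runs along an Euler tour, so that it only misses the vertex where
the tour closes; there the parity follows from the total number of selected
edges, which is half of [#|V|]. *)
Lemma parity_selection (V : {set {set G}}) (P : pred G) :
  V \subset edges G -> even_degrees V -> spanning V ->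
  odd #|[set y | (col y == c) && P y]| = odd #|V|./2 ->
  exists Y : {set {set G}}, [/\ Y \subset V,
    forall x, col x != c -> degree V x = (degree Y x).*2
    & forall y, col y = c -> odd (degree Y y) = P y].
Proof.
move=> VG ev con tot.
have [b /eqP cb|noc] := pickP (fun b => col b == c); last first.
  have V0 : V = set0.
    apply/setP => e; rewrite inE; apply/negP => /(subsetP VG) /one_endpoint.
    by rewrite big_pred0.
  exists set0; rewrite sub0set; split=> // [x _|y /eqP]; last by rewrite noc.
  by rewrite V0 degree0.
have [p [lp up pV]] := euler_tour b VG ev con.
have sP : sorted (@adj G) (b :: p).
  by apply: sub_edges_sorted => e; rewrite pV; apply/subsetP.
have evp : ~~ odd (size p).
  by have := col_last sP; rewrite lp; case: (col b); case: (odd _).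
have [sel [rest [perm x_cnt sz y_par]]] := select_walk P sP evp cb.
have usr : uniq (sel ++ rest) by rewrite (perm_uniq perm).
have us : uniq sel by move: usr; rewrite cat_uniq => /and3P [].
have VE : V = [set e in edge_seq (b :: p)] by apply/setP => e; rewrite inE pV.
have cnt_perm v : degree V v = count (fun e : {set G} => v \in e) sel
                              + count (fun e : {set G} => v \in e) rest.
  by rewrite VE degree_set // -count_cat; apply/esym/permP.
have selV : {subset sel <= V}.
  by move=> e es; rewrite -pV -(perm_mem perm) mem_cat es.
exists [set e in sel]; split=> [|x cx|y cy].
- by apply/subsetP => e; rewrite inE => /selV.
- by rewrite cnt_perm degree_set // x_cnt // addnn.
rewrite degree_set //; pose cnt z := count (fun e : {set G} => z \in e) sel.
have good z : col z = c -> z != b -> odd (cnt z) = P z.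
  move=> cz zb; apply: y_par => //; last by rewrite lp.
  have bz : predC1 z b by rewrite /= eq_sym.
  have zz : ~~ predC1 z z by rewrite /= eqxx.
  have [a [b' [az zb' e]]] := linked_cross (con b z) bz zz.
  move: zb'; rewrite negbK => /eqP zb'.
  by apply: (@edge_seq_sub _ (b :: p) [set a; b']); rewrite ?pV // zb' !inE eqxx orbT.
have [->|] := eqVneq y b; last exact: good.
pose A := [set z | (col z == c) && odd (cnt z)]; pose B := [set z | (col z == c) && P z].
have AB : A :\ b = B :\ b.
  apply/setP => z; rewrite !inE; have [//|zb] := eqVneq z b.
  by have [cz|] := eqVneq (col z) c; rewrite //= good.
have szV : #|V| = (size sel).*2.
  rewrite VE cardsE (card_uniqP up) -(perm_size perm) size_cat -sz addnn //.
have : odd #|A| = odd #|B|.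
  rewrite tot szV doubleK -odd_sum /cnt; congr (odd _).
  under eq_bigr => z _ do rewrite count_mem_sum.
  rewrite exchange_big /= -sum1_size big_seq [in RHS]big_seq; apply: eq_bigr => e es.
  by apply: one_endpoint; apply: (subsetP VG); apply: selV.
rewrite (cardsD1 b A) (cardsD1 b B) AB !oddD !oddb !inE cb eqxx /=.
by move/addIb.
Qed.

End ParitySelection.

(** * Matroid union *)

Section MatroidUnion.
Variables (T J : finType) (span : J -> {set T} -> {set T}).
Implicit Types (A B : {set T}) (e g : T) (j : J) (f : {ffun T -> option J}).
(* Matroids are given by their closure operators. *)
Hypothesis span_ext : forall j A, A \subset span j A.
Hypothesis span_mono : forall j A B, A \subset span j B -> span j A \subset span j B.
Hypothesis span_exchange : forall j A e g,
  e \in span j (g |: A) -> e \notin span j A -> g \in span j (e |: A).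
Variable E : {set T}.

Definition independent j A := [forall (e | e \in A), e \notin span j (A :\ e)].

Definition part (f : {ffun T -> option J}) j := [set e | f e == Some j].

Definition assignment (f : {ffun T -> option J}) :=
  [forall e, (f e != None) ==> (e \in E)] && [forall j, independent j (part f j)].

Definition free (f : {ffun T -> option J}) := [set e in E | f e == None].

Lemma span_sub j A B : A \subset B -> span j A \subset span j B.
Proof. by move=> AB; apply: span_mono; apply: subset_trans (span_ext j B). Qed.

Lemma independent_sub j A B : A \subset B -> independent j B -> independent j A.
Proof.
move=> AB /forall_inP iB; apply/forall_inP => e eA.
apply: contra (iB e (subsetP AB e eA)); apply/subsetP/span_sub.
exact: setSD.
Qed.

Lemma independent_add j A e : independent j A -> e \notin span j A ->
  independent j (e |: A).
Proof.
move=> /forall_inP iA eA; apply/forall_inP => g.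
have enA : e \notin A by apply: contra eA; apply/subsetP.
rewrite !inE => /orP [/eqP ->|gA]; first by rewrite setU1K.
have ge : g != e by apply: contraNneq enA => <-.
have -> : (e |: A) :\ g = e |: (A :\ g).
  by apply/setP => x; rewrite !inE; case: eqP => [->|//]; rewrite (negbTE ge).
apply: contra eA => gin; have := span_exchange gin (iA g gA).
by rewrite setD1K.
Qed.

(** A minimal subset [M] of [A] spanning [e] is a circuit with [e] removed. *)
Lemma spanning_circuit j A e : independent j A -> e \in span j A ->
  exists M : {set T}, [/\ M \subset A, e \in span j M
    & forall g, g \in M -> e \notin span j (A :\ g)].
Proof.
move=> /forall_inP iA eA.
have [M /minsetP [eM Mmin] MA] := @minset_exists T (fun M => e \in span j M) A eA.
exists M; split=> // g gM; apply/negP => eAg.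
have eMg : e \notin span j (M :\ g).
  apply/negP => eMg; have : M :\ g = M.
    by apply: Mmin; rewrite ?subD1set.
  by move/setP/(_ g); rewrite !inE eqxx gM.
have gin : g \in span j (e |: (M :\ g)).
  by apply: span_exchange eMg; rewrite setD1K.
have := iA g (subsetP MA g gM); apply/negP; rewrite negbK.
apply: (subsetP (span_mono _)) gin; rewrite subUset sub1set eAg.
by apply: subset_trans (span_ext _ _); apply: setSD.
Qed.

Definition exchange (f : {ffun T -> option J}) e j g : {ffun T -> option J} :=
  [ffun x => if x == e then Some j else if x == g then None else f x].

Definition exchanges f f' := [&& assignment f, assignment f' &
  [exists e, exists j, exists g,
    [&& e \in free f, g \in part f j & f' == exchange f e j g]]].

(** Take an assignment with as many elements assigned as possible.  The set [Q]
of the elements that are free in some assignment reachable by exchanges is the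
certificate: exchanges take place inside [Q], so they do not change the span of
the [Q]-part of any class, and an element that is free is spanned by these parts. *)
Lemma matroid_union : exists (f : J -> {set T}) (Q : {set T}),
  [/\ forall j, f j \subset E /\ independent j (f j),
      forall i j, i != j -> [disjoint f i & f j],
      Q \subset E /\ E :\: Q \subset \bigcup_j f j,
      forall j, Q \subset span j (f j :&: Q)
    & forall j q, q \in Q -> q \in span j (Q :\ q)].
Proof.
have a0 : assignment [ffun=> None].
  apply/andP; split; apply/forallP => x; first by rewrite ffunE.
  by apply/forall_inP => e; rewrite inE ffunE.
have [f0 af0 f0min] := arg_minnP (fun f => #|free f|) a0.
pose R f := connect exchanges f0 f.
have freeE f : free f \subset E by apply/subsetP => e; rewrite inE => /andP [].
have R_ok f : R f -> assignment f /\ #|free f| = #|free f0|.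
  case/connectP=> p; elim/last_ind: p f => [|p f' IH] f /=; first by move=> _ ->.
  rewrite rcons_path last_rcons => /andP [pp ex] ->.
  have [ap cp] := IH _ pp (erefl _).
  case/and3P: ex => _ af' /existsP [e /existsP [j /existsP [g /and3P [ef gf /eqP ff']]]].
  split=> //; rewrite -cp; set h := last f0 p in ef gf ff' *.
  have [eE he] : e \in E /\ h e = None by move: ef; rewrite inE => /andP [? /eqP].
  have hg : h g = Some j by move: gf; rewrite inE => /eqP.
  have gE : g \in E.
    by case/andP: ap => /forallP /(_ g); rewrite -/h hg.
  have eg : e != g by apply/eqP => eg; rewrite eg hg in he.
  have -> : free f' = g |: (free h :\ e).
    apply/setP => x; rewrite ff' !inE ffunE.
    have [->|xe] := eqVneq x e; first by rewrite andbF (negbTE eg).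
    by have [->|] := eqVneq x g; rewrite ?gE.
  by rewrite cardsU1 !inE hg andbF andbF (cardsD1 e (free h)) inE eE he.
have R0 : R f0 by apply: connect0.
have R_step f f' : R f -> exchanges f f' -> R f'.
  by move=> Rf ff'; apply: connect_trans Rf (connect1 ff').
pose Q := [set e | [exists f, R f && (e \in free f)]].
have QP f e : R f -> e \in free f -> e \in Q.
  by move=> Rf ef; rewrite inE; apply/existsP; exists f; rewrite Rf.
have indep f j : R f -> independent j (part f j).
  by case/R_ok=> /andP [_ /forallP /(_ j)].
(* The class with [e] added and [g] removed. *)
have part_ex f e j g i : e \in free f -> g \in part f j ->
    part (exchange f e j g) i = if i == j then e |: (part f j :\ g) else part f i.
  rewrite !inE => /andP [eE /eqP fe] /eqP fg; apply/setP => x; rewrite inE ffunE.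
  have eg : e != g by apply/eqP => eg; rewrite eg fg in fe.
  have [->|ij] := eqVneq i j; rewrite !inE.
    have [_|xe] := eqVneq x e; first by rewrite eqxx.
    by have [->|] := eqVneq x g.
  have [->|xe] := eqVneq x e; first by rewrite fe; apply/eqP => [[ji]]; rewrite ji eqxx in ij.
  have [->|//] := eqVneq x g; rewrite fg.
  by apply/esym/eqP => [[ji]]; rewrite ji eqxx in ij.
have free_span f e j : R f -> e \in free f -> e \in span j (part f j :&: Q).
  move=> Rf ef; have [af cf] := R_ok f Rf.
  have [eE fe] : e \in E /\ f e = None by move: ef; rewrite inE => /andP [? /eqP].
  have enp i : e \notin part f i by rewrite inE fe.
  have es : e \in span j (part f j).
    apply/negPn/negP => es.
    pose f' : {ffun T -> option J} := [ffun x => if x == e then Some j else f x].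
    have pf' i : part f' i = if i == j then e |: part f j else part f i.
      apply/setP => x; rewrite inE ffunE; have [->|ij] := eqVneq i j; rewrite !inE.
        by have [_|xe] := eqVneq x e; rewrite ?eqxx.
      have [->|//] := eqVneq x e; rewrite fe.
      by apply/eqP => [[ji]]; rewrite ji eqxx in ij.
    have af' : assignment f'.
      apply/andP; split; apply/forallP => x.
        rewrite ffunE; have [->|_] := eqVneq x e; first by rewrite eE implybT.
        by case/andP: af => /forallP /(_ x).
      rewrite pf'; case: eqP => [->|_]; last exact: indep.
      by apply: independent_add => //; apply: indep.
    have := f0min f' af'; rewrite -cf leqNgt; apply/negP; rewrite negbK.
    apply: proper_card; apply/properP; split.
      apply/subsetP => x; rewrite !inE ffunE; case: (x \in E) => //=.
      by have [_|] := eqVneq x e.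
    by exists e => //; rewrite inE ffunE eqxx andbF.
  have [M [MA eM Mmin]] := spanning_circuit (indep f j Rf) es.
  apply: (subsetP (span_sub _ _)) eM; apply/subsetP => g gM.
  have gp := subsetP MA g gM; rewrite inE gp /=.
  have eg : e != g by apply: contraTneq gp => <-; apply: enp.
  have af' : assignment (exchange f e j g).
    apply/andP; split; apply/forallP => x.
      rewrite ffunE; have [->|_] := eqVneq x e; first by rewrite eE implybT.
      have [//|_] := eqVneq x g.
      by case/andP: af => /forallP /(_ x).
    rewrite part_ex //; case: eqP => [->|_]; last exact: indep.
    apply: independent_add; last exact: Mmin.
    by apply: independent_sub (indep f j Rf); apply: subD1set.
  apply: (QP (exchange f e j g)).
    apply: (R_step f) => //; apply/and3P; split=> //.
    apply/existsP; exists e; apply/existsP; exists j; apply/existsP; exists g.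
    by rewrite ef gp eqxx.
  rewrite inE ffunE [g == e]eq_sym (negbTE eg) eqxx andbT.
  by case/andP: af => /forallP /(_ g) + _; move: gp; rewrite inE => /eqP ->.
have span_inv f j : R f -> span j (part f j :&: Q) = span j (part f0 j :&: Q).
  case/connectP=> p; elim/last_ind: p f => [|p f' IH] f /=; first by move=> _ ->.
  rewrite rcons_path last_rcons => /andP [pp ex] ->; rewrite -(IH _ pp (erefl _)).
  set h := last f0 p in ex *; have Rh : R h by apply/connectP; exists p.
  have Rf' : R f' by apply: R_step ex.
  case/and3P: ex => _ _ /existsP [e /existsP [i /existsP [g /and3P [eh gh /eqP ff']]]].
  rewrite ff' part_ex //; case: eqP => // ji.
  rewrite -ji in gh ff' *; clear ji.
  have eQ : e \in Q by apply: QP eh.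
  have [eE he] : e \in E /\ h e = None by move: eh; rewrite inE => /andP [? /eqP].
  have hg : h g = Some j by move: gh; rewrite inE => /eqP.
  have eg : g != e by apply/eqP => eg; rewrite eg he in hg.
  have gf' : g \in free f'.
    rewrite inE ff' ffunE (negbTE eg) !eqxx andbT.
    by case: (R_ok h Rh) => /andP [/forallP /(_ g)]; rewrite hg.
  have gQ : g \in Q by apply: QP gf'.
  pose A := part h j :&: Q; have gA : g \in A by rewrite inE gh.
  have -> : (e |: (part h j :\ g)) :&: Q = e |: (A :\ g).
    apply/setP => x; rewrite !inE; have [->|xe] := eqVneq x e; first by move: eQ; rewrite inE => ->.
    by rewrite /= andbA.
  have eA : e \in span j A by apply: free_span.
  have eAg : e \notin span j (A :\ g).
    have /forall_inP/(_ e) := indep f' j Rf'; rewrite ff' part_ex // eqxx setU11 => /(_ isT).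
    apply: contra; apply/subsetP/span_sub; apply/subsetP => x; rewrite !inE.
    case/and3P=> xg xh _; rewrite xg xh orbT andbT.
    by apply: contraTneq xh => ->; rewrite he.
  have gin : g \in span j (e |: (A :\ g)).
    by apply: span_exchange eAg; rewrite setD1K.
  apply/eqP; rewrite eqEsubset; apply/andP; split; apply: span_mono.
    rewrite subUset sub1set eA; apply: subset_trans (span_ext _ _).
    exact: subD1set.
  apply/subsetP => x xA; have [->//|xg] := eqVneq x g.
  by apply: (subsetP (span_ext _ _)); rewrite in_setU1 in_setD1 xg xA orbT.
have [af0E af0I] : (forall e, f0 e != None -> e \in E) /\ forall j, independent j (part f0 j).
  by case/andP: af0 => /forallP H /forallP I; split=> // e; apply/implyP.
exists (part f0), Q; split=> [j|i j ij||j|j q qQ].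
- by split=> //; apply/subsetP => e; rewrite inE => /eqP fe; apply: af0E; rewrite fe.
- rewrite -setI_eq0; apply/eqP/setP => x; rewrite !inE.
  by apply/andP => [[/eqP -> /eqP [e]]]; rewrite e eqxx in ij.
- split.
    apply/subsetP => e; rewrite inE => /existsP [f /andP [_ ef]].
    exact: (subsetP (freeE f)).
  apply/subsetP => e; rewrite inE => /andP [eQ eE]; case fe: (f0 e) => [j|].
    by apply/bigcupP; exists j => //; rewrite inE fe.
  by case/negP: eQ; apply: (QP f0) => //; rewrite inE eE fe.
- apply/subsetP => e; rewrite inE => /existsP [f /andP [Rf ef]].
  by rewrite -(span_inv f j Rf); apply: free_span.
- move: (qQ); rewrite inE => /existsP [f /andP [Rf qf]].
  apply: (subsetP (span_sub _ _)) (free_span f q j Rf qf).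
  apply/subsetP => x; rewrite in_setD1 => /setIP [xp ->]; rewrite andbT.
  by apply: contraTneq xp => ->; move: qf; rewrite !inE => /andP [_ /eqP ->].
Qed.

End MatroidUnion.

(** * Packing spanning connected subgraphs *)

Section Components.
Variable G : sgraph.
Implicit Types (F Q : {set {set G}}) (a b u v x y : G).

Lemma linked_refl F x : linked F x x.
Proof. exact: connect0. Qed.

Lemma linked_trans F : transitive (linked F).
Proof. exact: connect_trans. Qed.

Lemma linked1 F u v : [set u; v] \in F -> linked F u v.
Proof. exact: connect1. Qed.

Lemma linked_add F a b u v : linked ([set a; b] |: F) u v =
  [|| linked F u v, linked F u a && linked F b v | linked F u b && linked F a v].
Proof.
have sub x y : linked F x y -> linked ([set a; b] |: F) x y.
  by apply: linked_sub; apply: subsetUr.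
have ab : linked ([set a; b] |: F) a b by apply: linked1; apply: setU11.
apply/idP/or3P => [/connectP [p]|[/sub //|/andP [/sub ua /sub bv]|/andP [/sub ub /sub av]]];
  last first.
- by apply: linked_trans ub _; apply: linked_trans av; rewrite linked_sym.
- by apply: linked_trans ua _; apply: linked_trans bv.
elim: p u => [|w p IH] u /=; first by move=> _ ->; apply: Or31; apply: linked_refl.
case/andP=> uw pw lv; have {IH} := IH w pw lv.
move: uw; rewrite in_setU1 => /orP [/eqP e|uw].
  have [[-> ->]|[-> ->]] : (u = a /\ w = b) \/ (u = b /\ w = a).
    have uin : u \in [set a; b] by rewrite -e !inE eqxx.
    have win : w \in [set a; b] by rewrite -e !inE eqxx orbT.
    have ain : a \in [set u; w] by rewrite e !inE eqxx.
    have bin : b \in [set u; w] by rewrite e !inE eqxx orbT.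
    move: uin win ain bin; rewrite !inE => /orP [] /eqP -> /orP [] /eqP ->; auto.
      by move=> _; rewrite orbb => /eqP ->; auto.
    by rewrite orbb => /eqP -> _; auto.
  - case=> [bv|/andP [ba bv]|/andP [_ av]].
    + by apply: Or32; rewrite linked_refl.
    + by apply: Or32; rewrite linked_refl.
    + by apply: Or31.
  - case=> [av|/andP [_ bv]|/andP [ab' av]].
    + by apply: Or33; rewrite linked_refl.
    + by apply: Or31.
    + by apply: Or33; rewrite linked_refl.
have {}uw := linked1 uw.
case=> [wv|/andP [wa bv]|/andP [wb av]].
- by apply: Or31; apply: linked_trans uw wv.
- by apply: Or32; rewrite (linked_trans uw wa).
- by apply: Or33; rewrite (linked_trans uw wb).
Qed.

Definition component F x := [set y | linked F x y].
Definition components F := [set component F x | x in G].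

Lemma component_eq F x y : linked F x y -> component F x = component F y.
Proof.
move=> xy; apply/setP => z; rewrite !inE; apply/idP/idP; apply: linked_trans => //.
by rewrite linked_sym.
Qed.

Lemma mem_component F x : x \in component F x.
Proof. by rewrite inE linked_refl. Qed.

Lemma card_components_add F a b : ~~ linked F a b ->
  #|components F| = #|components ([set a; b] |: F)|.+1.
Proof.
move=> ab; pose A := component F a; pose B := component F b.
have AC : A \in components F by apply: imset_f.
have BC : B \in components F by apply: imset_f.
have AB : A != B.
  by apply: contraNneq ab => e; have := mem_component F b; rewrite -/B -e inE.
have new x : component ([set a; b] |: F) x =
    if (x \in A) || (x \in B) then A :|: B else component F x.
  apply/setP => y; rewrite in_set linked_add (linked_sym F x a) (linked_sym F x b).
  rewrite [x \in A]in_set [x \in B]in_set.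
  have [ax|ax] := boolP (linked F a x); have [bx|bx] := boolP (linked F b x).
  - by case/negP: ab; apply: linked_trans ax _; rewrite linked_sym.
  - rewrite /= orbF in_setU !in_set; congr (_ || _); apply/idP/idP.
      exact: linked_trans.
    by apply: linked_trans; rewrite linked_sym.
  - rewrite /= in_setU !in_set orbC; congr (_ || _); apply/idP/idP.
      exact: linked_trans.
    by apply: linked_trans; rewrite linked_sym.
  - by rewrite /= !orbF in_set.
have UC : A :|: B \notin components F.
  apply/imsetP => [[x _ e]].
  have := mem_component F a; rewrite -/A => aA.
  have ax : a \in component F x by rewrite -e inE aA.
  have bx : b \in component F x by rewrite -e inE mem_component orbT.
  by case/negP: ab; move: ax bx; rewrite !inE linked_sym; apply: linked_trans.
have -> : components ([set a; b] |: F) = (A :|: B) |: (components F :\ A :\ B).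
  apply/setP => X; rewrite !in_setU1 !in_setD1; apply/imsetP/idP.
    case=> x _ ->; rewrite new; case: ifP => [_|/norP [xA xB]]; first by rewrite eqxx.
    rewrite imset_f // andbT; apply/orP; right; apply/andP; split.
      by apply: contraNneq xB => <-; apply: mem_component.
    by apply: contraNneq xA => <-; apply: mem_component.
  case/orP=> [/eqP ->|/and3P [XB XA /imsetP [x _ eX]]].
    by exists a => //; rewrite new mem_component.
  exists x => //; rewrite new eX; case: ifP => // /orP [] xin.
    by case/eqP: XA; rewrite eX; apply/esym/component_eq; move: xin; rewrite inE.
  by case/eqP: XB; rewrite eX; apply/esym/component_eq; move: xin; rewrite inE.
rewrite cardsU1 !in_setD1 (negbTE UC) !andbF /= add1n.
by rewrite (cardsD1 A) AC (cardsD1 B (components F :\ A)) in_setD1 eq_sym AB BC.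
Qed.

Lemma card_components_add_le F e : e \in edges G ->
  #|components F| <= #|components (e |: F)|.+1.
Proof.
case/edgesP=> a [b [_ ->]]; have [ab|/card_components_add -> //] := boolP (linked F a b).
suff -> : components ([set a; b] |: F) = components F by [].
apply: eq_imset => x; apply/setP => y; rewrite !inE linked_add.
apply/or3P/idP => [[//|/andP [xa by_]|/andP [xb ay]]|]; last by move=> ?; apply: Or31.
  by apply: linked_trans xa _; apply: linked_trans by_.
by apply: linked_trans xb _; apply: linked_trans ay; rewrite linked_sym.
Qed.

Lemma card_components_setU F (R : {set {set G}}) : R \subset edges G ->
  #|components F| <= #|components (R :|: F)| + #|R|.
Proof.
have [n] := ubnP #|R|; elim: n R => // n IH R Rn RG.
have [->|/set0Pn [e eR]] := eqVneq R set0; first by rewrite set0U cards0 addn0.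
have cR := cardsD1 e R; rewrite eR in cR.
have := IH (R :\ e); rewrite cR ltnS in Rn *; move=> /(_ Rn (subset_trans (subD1set _ _) RG)).
move/leq_trans; apply; rewrite addnA leq_add2r addn1.
have := card_components_add_le ((R :\ e) :|: F) (subsetP RG e eR).
by rewrite setUA setD1K.
Qed.

Lemma spanning_components F : spanning F <-> #|components F| <= 1.
Proof.
split=> [sF|/card_le1_eqP le1 u v].
  apply/card_le1_eqP => X Y /imsetP [x _ ->] /imsetP [y _ ->].
  by apply: component_eq; apply: sF.
have := le1 (component F u) (component F v) (imset_f _ isT) (imset_f _ isT).
by move=> e; have := mem_component F v; rewrite e inE.
Qed.

Lemma components_gt0 F (x : G) : 0 < #|components F|.
Proof. by apply/card_gt0P; exists (component F x); apply: imset_f. Qed.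

(** ** The graphic matroid *)

(** The sets that are not edges are independent of all others; in this way the
closure axioms hold without side conditions. *)
Definition graphic_span F : {set {set G}} := F :|: [set e in edges G |
  [forall u in e, forall v in e, linked (F :&: edges G) u v]].

Lemma graphic_ext F : F \subset graphic_span F.
Proof. exact: subsetUl. Qed.

Lemma graphic_edge F u v : adj u v -> F \subset edges G ->
  ([set u; v] \in graphic_span F) = linked F u v.
Proof.
move=> uv FG; rewrite inE inE edge_adj uv /= (setIidPl FG).
apply/orP/idP => [[/linked1 //|/forall_inP/(_ u)]|l].
  by rewrite !inE eqxx => /(_ isT)/forall_inP/(_ v); rewrite !inE eqxx orbT; apply.
right; apply/forall_inP => x xe; apply/forall_inP => y ye.
move: xe ye; rewrite !inE => /orP [] /eqP -> /orP [] /eqP -> //; rewrite ?linked_refl //.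
by rewrite linked_sym.
Qed.

Lemma graphic_linked F Q u v : Q \subset graphic_span F ->
  linked (Q :&: edges G) u v -> linked (F :&: edges G) u v.
Proof.
move=> QF; apply: connect_sub => a b; rewrite inE => /andP [abQ abG].
have := subsetP QF _ abQ; rewrite inE => /orP [abF|].
  by apply: linked1; rewrite inE abF.
rewrite inE => /andP [_ /forall_inP/(_ a)]; rewrite !inE eqxx => /(_ isT)/forall_inP/(_ b).
by rewrite !inE eqxx orbT; apply.
Qed.

Lemma graphic_mono F Q : F \subset graphic_span Q -> graphic_span F \subset graphic_span Q.
Proof.
move=> FQ; rewrite subUset FQ /=; apply/subsetP => e; rewrite !inE => /andP [eG /forall_inP l].
apply/orP; right; rewrite eG; apply/forall_inP => u ue; apply/forall_inP => v ve.
by apply: graphic_linked FQ _; have /forall_inP := l u ue; apply.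
Qed.

Lemma graphic_exchange F e f : e \in graphic_span (f |: F) -> e \notin graphic_span F ->
  f \in graphic_span (e |: F).
Proof.
move=> es en; have [->|ef] := eqVneq f e; first by rewrite inE setU11.
have eF : e \notin F by apply: contra en; apply/subsetP/graphic_ext.
have eG : e \in edges G.
  by move: es; rewrite !inE eq_sym (negbTE ef) (negbTE eF) => /andP [].
have /edgesP [u [v [uv euv]]] := eG.
pose F' := F :&: edges G.
have spanE (Q : {set {set G}}) : e \notin Q ->
    (e \in graphic_span Q) = linked (Q :&: edges G) u v.
  move=> eQ; rewrite -graphic_edge ?subsetIr // -euv !inE (negbTE eQ) eG /=.
  by rewrite -setIA setIid.
have luv : ~~ linked F' u v by rewrite -spanE.
have := es; rewrite spanE //; last by rewrite !inE eq_sym (negbTE ef).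
have [fG|fG] := boolP (f \in edges G); last first.
  rewrite (_ : (f |: F) :&: edges G = F') ?(negbTE luv) //.
  by apply/setP => x; rewrite !inE; case: eqP => [->|//]; rewrite (negbTE fG) !andbF.
have /edgesP [a [b [ab fab]]] := fG.
rewrite (_ : (f |: F) :&: edges G = [set a; b] |: F'); last first.
  by apply/setP => x; rewrite -fab !inE; case: eqP => [->|//]; rewrite fG.
rewrite linked_add (negbTE luv) /= => H.
rewrite fab; apply: (subsetP (_ : graphic_span ([set u; v] |: F') \subset _)).
  apply: graphic_mono; apply: subset_trans (graphic_ext _); rewrite -euv.
  by apply: setUS; apply: subsetIl.
rewrite graphic_edge //; last by rewrite subUset sub1set edge_adj uv subsetIr.
rewrite linked_add; case/orP: H => /andP [H1 H2].
  by rewrite linked_sym in H1; rewrite linked_sym in H2; rewrite H1 H2 orbT.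
by rewrite H2 H1 !orbT.
Qed.

(** Every edge of an independent set joins two components. *)
Lemma card_forest F F' : F \subset edges G -> independent (fun _ : unit => graphic_span) tt F ->
  F' \subset F -> #|components F'| = #|components F| + #|F :\: F'|.
Proof.
move=> FG /forall_inP indF.
have [n] := ubnP #|F :\: F'|; elim: n F' => // n IH F' Fn F'F.
have [e0|/set0Pn [e eD]] := eqVneq (F :\: F') set0.
  rewrite e0 cards0 addn0; congr #|components _|; apply/eqP.
  by rewrite eqEsubset F'F -setD_eq0 e0 eqxx.
have [eF eF'] : e \in F /\ e \notin F' by move: eD; rewrite inE => /andP [].
have cD : #|F :\: F'| = #|F :\: (e |: F')|.+1.
  by rewrite (cardsD1 e) eD setDDl setUC.
rewrite cD addnS -IH; last first.
- by rewrite subUset sub1set eF.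
- by rewrite cD in Fn.
have /edgesP [a [b [ab eab]]] := subsetP FG e eF.
rewrite eab; apply: card_components_add; rewrite -graphic_edge //; last first.
  exact: subset_trans FG.
rewrite -eab; apply: contra (indF e eF); apply/subsetP; apply: graphic_mono.
apply: subset_trans (graphic_ext _); apply/subsetP => x xF'.
by rewrite !inE (subsetP F'F) // andbT; apply: contraNneq eF' => <-.
Qed.

End Components.

Section Packing.
Variables (G : sgraph) (col : G -> bool).
Hypothesis colP : forall x y : G, adj x y -> col x != col y.
Variables (v0 : G) (c : bool).
Implicit Types (F Q : {set {set G}}) (e : {set G}) (x y : G).

Local Notation end_ e := (endpoint col v0 c e).

(** ** The partition matroid of the degrees on one side *)

Section Partition.
Variable cap : G -> nat.

Definition star F x := [set e in F | end_ e == x].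

(** The closure for which the independent sets are those with at most [cap x]
elements in the star of each [x]: full stars are closed up. *)
Definition partition_span F := F :|: [set e | cap (end_ e) <= #|star F (end_ e)|].

Lemma star_sub F F' x : F \subset F' -> star F x \subset star F' x.
Proof.
by move=> sub; apply/subsetP => e; rewrite !inE => /andP [/(subsetP sub) -> ->].
Qed.

Lemma partition_ext F : F \subset partition_span F.
Proof. exact: subsetUl. Qed.

Lemma partition_mono F Q :
  F \subset partition_span Q -> partition_span F \subset partition_span Q.
Proof.
move=> FQ; rewrite subUset FQ; apply/subsetP => e; rewrite !inE => le.
have [_|lt] := leqP (cap (end_ e)) #|star Q (end_ e)|; first by rewrite orbT.
have sub : star F (end_ e) \subset star Q (end_ e).
  apply/subsetP => f; rewrite !inE => /andP [fF /eqP ef].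
  by have := subsetP FQ f fF; rewrite !inE ef leqNgt lt orbF => ->; rewrite eqxx.
by have := leq_trans le (subset_leq_card sub); rewrite leqNgt lt.
Qed.

Lemma partition_exchange F e f : e \in partition_span (f |: F) ->
  e \notin partition_span F -> f \in partition_span (e |: F).
Proof.
have [->|ef] := eqVneq f e; first by rewrite !inE eqxx.
rewrite !inE negb_or -ltnNge eq_sym (negbTE ef) /= => + /andP [eF lt].
rewrite (negbTE eF) /= => le.
have [fe|fe] := eqVneq (end_ f) (end_ e); last first.
  have : #|star (f |: F) (end_ e)| <= #|star F (end_ e)|.
    apply: subset_leq_card; apply/subsetP => x; rewrite !inE.
    by case/andP=> /orP [/eqP ->|->] //; rewrite (negbTE fe).
  by move/(leq_trans le); rewrite leqNgt lt.
rewrite fe (_ : star (e |: F) (end_ e) = e |: star F (end_ e)); last first.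
  by apply/setP => x; rewrite !inE; case: eqP => [->|]; rewrite ?eqxx.
have sub : star (f |: F) (end_ e) \subset f |: star F (end_ e).
  by apply/subsetP => x; rewrite !inE; case: eqP.
have := leq_trans le (subset_leq_card sub); rewrite !cardsU1 !inE (negbTE eF) add1n.
by move=> H; rewrite (leq_trans H) ?orbT //; case: (~~ _).
Qed.

Lemma partition_independent F x : independent (fun _ : unit => partition_span) tt F ->
  #|star F x| <= cap x.
Proof.
move=> /forall_inP indF; rewrite leqNgt; apply/negP => lt.
have /card_gt0P [e es] : 0 < #|star F x| by apply: leq_trans lt.
have [eF /eqP ex] : e \in F /\ end_ e == x by move: es; rewrite inE => /andP [].
have /negP := indF e eF; apply; rewrite !inE eqxx ex /=.
rewrite (_ : star (F :\ e) x = star F x :\ e).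
  by move: lt; rewrite (cardsD1 e) es add1n ltnS.
by apply/setP => f; rewrite !inE andbA.
Qed.

End Partition.

Lemma starE F x : F \subset edges G -> col x = c -> #|star F x| = degree F x.
Proof. by move=> FG cx; rewrite card_endpoint // cx eqxx. Qed.

Lemma card_star_sum F : #|F| = \sum_x #|star F x|.
Proof.
rewrite -sum1_card (partition_big (fun e => end_ e) predT) //=.
by apply: eq_bigr => x _; rewrite sum1dep_card.
Qed.

Lemma eq_of_sum_ge (I : finType) (P : pred I) (a b : I -> nat) :
  (forall i, P i -> a i <= b i) -> \sum_(i | P i) b i <= \sum_(i | P i) a i ->
  forall i, P i -> a i = b i.
Proof.
move=> ab sum i Pi; apply/eqP; rewrite eqn_leq ab //=.
move: sum; rewrite (bigD1 i) //= [X in _ <= X](bigD1 i) //= => sum.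
have : \sum_(j | P j && (j != i)) a j <= \sum_(j | P j && (j != i)) b j.
  by apply: leq_sum => j /andP [Pj _]; apply: ab.
by move: sum; clear; lia.
Qed.

(** Matroid union for [k] copies of the graphic matroid and the partition matroid
of the degrees.  For the certificate [Q] it provides, all the upper bounds on the
number of elements of the classes outside [Q] are attained, because these elements
cover [E :\: Q], which is large by the counting condition; this makes the graphic
classes spanning and the last class full. *)
Theorem packing (E : {set {set G}}) k (cap : G -> nat) : E \subset edges G ->
  (forall Q, Q \subset E ->
     k * #|components Q|.-1 + \sum_(x | (col x == c) && (degree Q x == 0)) cap x
       <= #|E :\: Q|) ->
  exists (T : 'I_k -> {set {set G}}) (N : {set {set G}}),
  [/\ forall i, T i \subset E /\ spanning (T i),
      forall i j, i != j -> [disjoint T i & T j],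
      N \subset E /\ forall i, [disjoint T i & N]
    & forall x, col x = c -> cap x <= degree N x].
Proof.
move=> EG hyp; pose J := option 'I_k.
pose span (j : J) := if j is Some _ then @graphic_span G else partition_span cap.
have [|||f [Q [find fdis [QE Qcov] Qspan Qfree]]] := @matroid_union _ J span _ _ _ E.
- by case=> [i|] A; [apply: graphic_ext|apply: partition_ext].
- by case=> [i|] A B; [apply: graphic_mono|apply: partition_mono].
- by case=> [i|] A e g; [apply: graphic_exchange|apply: partition_exchange].
pose T i := f (Some i); pose N := f None.
have fE j : f j \subset E by have [] := find j.
have fG j : f j \subset edges G by apply: subset_trans EG.
have QG : Q \subset edges G by apply: subset_trans EG.
have indT i : independent (fun _ : unit => @graphic_span G) tt (T i) by have [] := find (Some i).
have indN : independent (fun _ : unit => partition_span cap) tt N by have [] := find None.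
have cT i : #|components Q| = #|components (T i)| + #|T i :\: Q|.
  have eqQ : components (T i :&: Q) = components Q.
    apply: eq_imset => x; apply/setP => y; rewrite !in_set; apply/idP/idP.
      by apply: linked_sub; apply: subsetIr.
    move=> l; have := @graphic_linked G (T i :&: Q) Q x y (Qspan (Some i)).
    rewrite (setIidPl QG) (setIidPl (subset_trans (subsetIr _ _) QG)).
    exact.
  rewrite -eqQ (card_forest (fG _) (indT i) (subsetIl (T i) Q)).
  by rewrite setDIr setDv set0U.
have starN x : #|star N x| <= cap x by apply: partition_independent indN.
have full x : #|star Q x| != 0 -> star (N :\: Q) x = set0 /\ #|star N x| = cap x.
  rewrite -lt0n => /card_gt0P [q]; rewrite inE => /andP [qQ /eqP qx].
  have lt : cap x < #|star Q x|.
    have := Qfree None q qQ; rewrite !inE eqxx /= qx (cardsD1 q (star Q x)).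
    rewrite inE qQ qx eqxx add1n ltnS (_ : star (Q :\ q) x = star Q x :\ q) //.
    by apply/setP => e; rewrite !inE andbA.
  have sub : star (N :&: Q) x \subset star N x by apply: star_sub; apply: subsetIl.
  have le : cap x <= #|star (N :&: Q) x|.
    rewrite leqNgt; apply/negP => lt'.
    have : #|star Q x| <= #|star (N :&: Q) x|.
      apply: subset_leq_card; apply/subsetP => e; rewrite inE => /andP [eQ /eqP ex].
      have := subsetP (Qspan None) e eQ; rewrite in_setU.
      case/orP=> [eNQ|]; first by rewrite inE eNQ ex eqxx.
      by rewrite inE ex leqNgt -/N lt'.
    by move/(leq_trans lt)/(ltn_trans lt'); rewrite ltnn.
  have eqN : star (N :&: Q) x = star N x.
    by apply/eqP; rewrite eqEcard sub (leq_trans (starN x)).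
  split; last by apply/eqP; rewrite eqn_leq starN -eqN.
  apply/setP => e; rewrite !inE; apply/negP => /andP [/andP [eQ eN] ex].
  have : e \in star (N :&: Q) x by rewrite eqN inE eN ex.
  by rewrite !inE (negbTE eQ) andbF.
pose Z x := (col x == c) && (degree Q x == 0).
have colEnd e : e \in edges G -> col (end_ e) = c.
  by move=> eG; have [] := endpointP colP v0 eG c.
have NQsum : #|N :\: Q| = \sum_(x | Z x) #|star (N :\: Q) x|.
  rewrite card_star_sum [RHS]big_mkcond; apply: eq_bigr => x _; rewrite /Z.
  have [cx|cx] := eqVneq (col x) c; last first.
    apply: eq_card0 => e; rewrite inE; apply: contraNF cx => /andP [eN /eqP <-].
    by rewrite colEnd // (subsetP (fG None)) //; move: eN; rewrite inE => /andP [].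
  rewrite -(starE QG cx) /=; case: eqP => // /eqP /full [-> _].
  by rewrite cards0.
have nQ : 0 < #|components Q| by apply: components_gt0.
have nT i : 0 < #|components (T i)| by apply: components_gt0.
have aT i : #|T i :\: Q| <= #|components Q|.-1.
  by rewrite (cT i); move: (nT i); clear; lia.
have aN x : #|star (N :\: Q) x| <= cap x.
  by apply: leq_trans (starN x); apply/subset_leq_card/star_sub/subsetDl.
have cover : #|E :\: Q| <= \sum_i #|T i :\: Q| + #|N :\: Q|.
  have : E :\: Q \subset (\bigcup_i (T i :\: Q)) :|: (N :\: Q).
    apply/subsetP => e eEQ; have /bigcupP [[i|] _ ej] := subsetP Qcov e eEQ.
      apply/setUP; left; apply/bigcupP; exists i => //; rewrite inE ej andbT.
      by move: eEQ; rewrite inE => /andP [].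
    by rewrite !inE ej andbT; move: eEQ; rewrite inE => /andP [-> _]; rewrite orbT.
  move/subset_leq_card/leq_trans; apply; apply: leq_trans (leq_card_setU _ _) _.
  rewrite leq_add2r; elim/big_rec2: _ => [|i n A _ IH]; first by rewrite cards0.
  by apply: leq_trans (leq_card_setU _ _) _; rewrite leq_add2l.
have total : \sum_(i < k) #|components Q|.-1 + \sum_(x | Z x) cap x
    <= \sum_i #|T i :\: Q| + \sum_(x | Z x) #|star (N :\: Q) x|.
  rewrite sum_nat_const card_ord -NQsum; apply: leq_trans cover.
  exact: hyp.
have leT : \sum_i #|T i :\: Q| <= \sum_(i < k) #|components Q|.-1.
  by apply: leq_sum => i _.
have leN : \sum_(x | Z x) #|star (N :\: Q) x| <= \sum_(x | Z x) cap x.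
  by apply: leq_sum => x _.
have geT : \sum_(i < k) #|components Q|.-1 <= \sum_i #|T i :\: Q|.
  by move: total leN; clear; lia.
have geN : \sum_(x | Z x) cap x <= \sum_(x | Z x) #|star (N :\: Q) x|.
  by move: total leT; clear; lia.
exists T, N; split=> [i|i j ij||x cx].
- split; first exact: fE.
  apply/spanning_components.
  have : #|T i :\: Q| = #|components Q|.-1.
    apply: (@eq_of_sum_ge _ predT (fun i => #|T i :\: Q|) (fun=> #|components Q|.-1)) => //.
  by move: (cT i) (nT i); clear; lia.
- by apply: fdis; apply: contra ij => /eqP [->].
- by split=> [|i]; [apply: fE|apply: fdis].
- rewrite -(starE (fG None) cx); have [Q0|/full [_ ->//]] := eqVneq #|star Q x| 0.
  have Zx : Z x by rewrite /Z cx eqxx -(starE QG cx) Q0.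
  have <- : #|star (N :\: Q) x| = cap x.
    apply: (eq_of_sum_ge (P := Z) (a := fun x => #|star (N :\: Q) x|)) => //.
  by apply/subset_leq_card/star_sub/subsetDl.
Qed.

End Packing.

Section TreePackings.
Variables (G : sgraph) (col : G -> bool).
Hypothesis colP : forall x y : G, adj x y -> col x != col y.
Variables (v0 : G).
Implicit Types (F Q : {set {set G}}) (e : {set G}) (x y : G).

Lemma card_exists_le1 (I : finType) (P : pred I) (b : bool) :
  (forall i j, P i -> P j -> i = j) -> (forall i, P i -> b) -> \sum_i P i <= b.
Proof.
move=> uni Pb; have [i Pi|P0] := pickP P; last first.
  by rewrite big1 // => i _; rewrite P0.
rewrite (Pb i Pi) (bigD1 i) //= Pi big1 // => j ji; apply/eqP; rewrite eqb0.
by apply: contra ji => Pj; apply/eqP/uni.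
Qed.

Lemma degree_family (I : finType) (T : I -> {set {set G}}) F x :
  (forall i, T i \subset F) -> (forall i j, i != j -> [disjoint T i & T j]) ->
  \sum_i degree (T i) x <= degree F x.
Proof.
move=> TF dT; rewrite degreeE; under eq_bigr => i _ do rewrite degreeE big_mkcond.
rewrite exchange_big [X in _ <= X]big_mkcond; apply: leq_sum => e _.
have [xe|xe] := boolP (x \in e); last first.
  by rewrite big1 // => i _; case: ifP.
apply: (@leq_trans (\sum_i (e \in T i))); first by apply: leq_sum => i _; case: (e \in T i).
have -> : (if e \in F then true : nat else 0) = (e \in F) by case: (e \in F).
apply: card_exists_le1 => [i j ei ej|i ei]; last exact: (subsetP (TF i)).
apply/eqP/negPn/negP => /dT; rewrite -setI_eq0 => /eqP/setP/(_ e).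
by rewrite !inE ei ej.
Qed.

Lemma card_family (I : finType) (T : I -> {set {set G}}) F :
  (forall i, T i \subset F) -> (forall i j, i != j -> [disjoint T i & T j]) ->
  \sum_i #|T i| <= #|F|.
Proof.
move=> TF dT; rewrite -sum1_card; under eq_bigr => i _ do rewrite -sum1_card big_mkcond.
rewrite exchange_big [X in _ <= X]big_mkcond; apply: leq_sum => e _.
apply: (@leq_trans (\sum_i (e \in T i))); first by apply: leq_sum => i _; case: (e \in T i).
have -> : (if e \in F then 1 else 0) = (e \in F) by case: (e \in F).
apply: card_exists_le1 => [i j ei ej|i ei]; last exact: (subsetP (TF i)).
apply/eqP/negPn/negP => /dT; rewrite -setI_eq0 => /eqP/setP/(_ e).
by rewrite !inE ei ej.
Qed.

Definition cut (X : {set G}) := [set e in edges G | (e :&: X != set0) && ~~ (e \subset X)].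

Lemma cut_large t (X : {set G}) x y : edge_connected G t -> x \in X -> y \notin X ->
  t <= #|cut X|.
Proof.
move=> con xX yX; rewrite leqNgt; apply/negP => lt.
have cE : cut X \subset edges G by apply/subsetP => e; rewrite inE => /andP [].
have /(_ x y) l := con (cut X) cE lt.
have {}l : linked (edges G :\: cut X) x y.
  apply: connect_sub l => a b /andP [ab abX]; apply: connect1.
  by rewrite inE abX edge_adj.
have [a [b [aX bX]]] := @linked_cross _ _ (mem X) _ _ l xX yX.
rewrite inE => /andP [+ abG]; rewrite inE abG /= negb_and !negbK => /orP [/eqP/setP/(_ a)|].
  by rewrite !inE eqxx [a \in X]aX.
by move/subsetP/(_ b); rewrite !inE eqxx orbT => /(_ isT) bX'; case/negP: bX.
Qed.

(** Every component of [Q] is left by at least [2 * t] edges, and an edge leaves at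
most two components. *)
Lemma card_crossing t Q : Q \subset edges G -> edge_connected G (2 * t) ->
  t * #|components Q|.-1 <= #|edges G :\: Q|.
Proof.
move=> QG con; have [le1|gt1] := leqP #|components Q| 1.
  by rewrite (_ : _.-1 = 0) ?muln0 //; move: le1; case: #|_| => [|[]].
suff H : t * #|components Q| <= #|edges G :\: Q|.
  by apply: leq_trans H; rewrite leq_mul2l leq_pred orbT.
rewrite -(leq_pmul2l (ltn0Sn 1)) mulnA.
apply: (@leq_trans (\sum_(X in components Q) #|cut X|)).
  rewrite mulnC -sum_nat_const; apply: leq_sum => X XQ.
  have /imsetP [x _ eX] := XQ.
  have [Y YQ YX] : exists2 Y, Y \in components Q & Y != X.
    have : 0 < #|components Q :\ X| by move: gt1; rewrite (cardsD1 X) XQ.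
    by case/card_gt0P => Y; rewrite !inE => /andP [YX YQ]; exists Y.
  have /imsetP [y _ eY] := YQ.
  apply: (@cut_large _ _ x y con); first by rewrite eX mem_component.
  by apply: contraNN YX; rewrite eX inE => xy; rewrite eY (component_eq xy).
have -> : \sum_(X in components Q) #|cut X|
        = \sum_e #|[set X in components Q | e \in cut X]|.
  under eq_bigr => X _ do rewrite -sum1_card big_mkcond.
  rewrite exchange_big; apply: eq_bigr => e _.
  by rewrite -big_mkcondr sum1dep_card.
rewrite mulnC -sum_nat_const [X in _ <= X]big_mkcond; apply: leq_sum => e _.
have cutQ X : X \in components Q -> e \in cut X -> [/\ e \in edges G, e \notin Q
    & X \in [set component Q a | a in e]].
  case/imsetP=> x _ ->; rewrite inE => /and3P [eG /set0Pn [a]]; rewrite inE => /andP [ae ax] nsub.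
  split=> //.
    apply: contra nsub => eQ; apply/subsetP => b be; rewrite inE in ax; rewrite inE.
    have [->|ab] := eqVneq b a; first by [].
    apply: linked_trans ax _; apply: linked1.
    suff -> : [set a; b] = e by [].
    apply/eqP; rewrite eqEcard cards2 eq_sym ab (card_edge eG) leqnn andbT.
    by rewrite subUset !sub1set ae be.
  by apply/imsetP; exists a => //; apply: component_eq; move: ax; rewrite inE.
case: ifP => eDQ.
  apply: (@leq_trans #|[set component Q a | a in e]|).
    by apply: subset_leq_card; apply/subsetP => X; rewrite inE => /andP [XQ /(cutQ X XQ) []].
  apply: leq_trans (leq_imset_card _ _) _.
  by rewrite card_edge //; move: eDQ; rewrite inE => /andP [].
rewrite leqn0 cards_eq0; apply/eqP/setP => X; rewrite [in LHS]inE [in RHS]inE.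
apply/negP => /andP [XQ /(cutQ X XQ) [eG eQ _]].
by move: eDQ; rewrite inE eG eQ.
Qed.

(** The theorem of Nash-Williams and Tutte: here the partition matroid has rank zero. *)
Theorem tree_packing t : edge_connected G (2 * t) ->
  exists T : 'I_t -> {set {set G}},
    (forall i, T i \subset edges G /\ spanning (T i)) /\
    (forall i j, i != j -> [disjoint T i & T j]).
Proof.
move=> con; have [|Q QG|T [N [sT dT _ _]]] := packing colP v0 (c := true) (E := edges G) (k := t)
  (cap := fun=> 0).
- by [].
- by rewrite big1 // addn0; apply: card_crossing.
by exists T.
Qed.

(** At each vertex [x] of colour [c], [degree U x - f x] edges are reserved for the
class of the partition matroid.  The counting condition of [packing] is then the
mean, with the weights [k] and [p - k], of two lower bounds on the number of edges
outside [Q]: each [D i] connects the components of [Q], and the stars of the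
vertices that [Q] avoids lie outside [Q]. *)
Theorem light_tree_packing c (U : {set {set G}}) p k (D : 'I_p -> {set {set G}}) (f : G -> nat) :
  U \subset edges G -> 0 < p -> k <= p ->
  (forall i, D i \subset U /\ spanning (D i)) ->
  (forall i j, i != j -> [disjoint D i & D j]) ->
  (forall x, col x = c -> k * degree U x <= p * f x) ->
  exists T : 'I_k -> {set {set G}}, [/\ forall i, T i \subset U /\ spanning (T i),
    forall i j, i != j -> [disjoint T i & T j]
    & forall x, col x = c -> \sum_i degree (T i) x <= f x].
Proof.
move=> UG p0 kp sD dD fU; pose cap x := degree U x - f x.
have [//|Q QU|T [N [sT dT [NU dN] capN]]] :=
    packing colP v0 (c := c) (E := U) (k := k) (cap := cap); last first.
  exists T; split=> // x cx.
  have : \sum_i degree (T i) x <= degree (U :\: N) x.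
    apply: degree_family => // i; rewrite subsetD dN andbT.
    by have [] := sT i.
  have := degree_setD x NU; have := capN x cx; rewrite /cap.
  by clear; lia.
have cD i : #|components Q|.-1 <= #|D i :\: Q|.
  have [DU /spanning_components sp] := sD i.
  have DQ : (D i :\: Q) :|: Q = D i :|: Q.
    by apply/setP => e; rewrite !inE; case: (e \in Q); rewrite ?orbT ?orbF.
  have := @card_components_setU G Q (D i :\: Q); rewrite DQ.
  have : #|components (D i :|: Q)| <= 1.
    apply/spanning_components => u v; apply: (@linked_sub _ (D i)); first exact: subsetUl.
    by apply/spanning_components: u v.
  move=> le1 /(_ (subset_trans (subsetDl _ _) (subset_trans DU UG))).
  by move: le1; clear; lia.
have R1 : p * #|components Q|.-1 <= #|U :\: Q|.
  apply: (@leq_trans (\sum_i #|D i :\: Q|)).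
    rewrite -[X in X * _]card_ord -sum_nat_const; apply: leq_sum => i _; exact: cD.
  apply: card_family => [i|i j ij]; first by apply: setSD; have [] := sD i.
  apply: disjointWl (subsetDl _ _) _; apply: disjointWr (subsetDl _ _) _; exact: dD.
pose Z x := (col x == c) && (degree Q x == 0).
have R2 : \sum_(x | Z x) degree U x <= #|U :\: Q|.
  rewrite (card_star_sum col v0 c) big_mkcond; apply: leq_sum => x _; rewrite /Z.
  have [cx|//] := eqVneq (col x) c; case: eqP => //= Q0.
  rewrite (starE colP) //; last by apply: subset_trans UG; apply: subsetDl.
  by rewrite (degree_setD x QU) Q0.
rewrite -(leq_pmul2l p0) mulnDr.
have R3 : p * \sum_(x | Z x) cap x <= (p - k) * \sum_(x | Z x) degree U x.
  rewrite !big_distrr /=; apply: leq_sum => x /andP [/eqP cx _].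
  by rewrite /cap mulnBr mulnBl leq_sub2l // fU.
rewrite -/Z in R3 *; apply: leq_trans (leq_add (leqnn _) R3) _.
rewrite mulnCA; apply: (@leq_trans (k * #|U :\: Q| + (p - k) * #|U :\: Q|)).
  by apply: leq_add; rewrite leq_mul2l ?R1 ?R2 orbT.
by rewrite -mulnDl subnKC.
Qed.

End TreePackings.

(** * Balanced labellings *)

Lemma balanced_halves D t f : D = t + f -> t <= f.+1 -> f <= t.+1 -> ~~ odd D ->
  D = t.*2 /\ D = f.*2.
Proof.
move=> -> tf ft; rewrite oddD; have [->|tnf] := eqVneq t f; first by rewrite addnn.
have [->|->] : t = f.+1 \/ f = t.+1 by lia.
  by rewrite /= addNb addbb.
by rewrite /= addbN addbb.
Qed.

Lemma fibre_exact (X U : finType) n (f : X -> U) (c : X -> 'I_n) u q : 0 < n ->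
  (forall i j, fibre_count f c u i <= (fibre_count f c u j).+1) ->
  #|[set x | f x == u]| = n * q -> forall k, fibre_count f c u k = q.
Proof.
move=> n0 eqt tot k.
have sumE : \sum_i fibre_count f c u i = n * q.
  rewrite -tot -[RHS]sum1dep_card (partition_big c predT) //=; apply: eq_bigr => i _.
  by rewrite sum1dep_card.
have nE : n * q = q + n.-1 * q by rewrite -mulSn prednK.
move: sumE; rewrite (bigD1 k) //= nE.
have cn : #|[pred i : 'I_n | i != k]| = n.-1 by rewrite cardC1 card_ord.
have [lt|gt|//] := ltngtP (fibre_count f c u k) q.
  have : \sum_(i < n | i != k) fibre_count f c u i <= n.-1 * q.
    rewrite -cn -sum_nat_const; apply: leq_sum => i _.
    exact: leq_trans (eqt i k) _.
  by move: lt; move: (fibre_count _ _ _ _) (n.-1 * q) (\sum_(_ | _) _); clear; lia.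
have : n.-1 * q <= \sum_(i < n | i != k) fibre_count f c u i.
  rewrite -cn -sum_nat_const; apply: leq_sum => i _.
  by rewrite -ltnS; apply: leq_trans gt (eqt k i).
by move: gt; move: (fibre_count _ _ _ _) (n.-1 * q) (\sum_(_ | _) _); clear; lia.
Qed.

Lemma card_sum_type (X Y : finType) (P : pred (X + Y)) :
  #|[set z | P z]| = #|[set x | P (inl x)]| + #|[set y | P (inr y)]|.
Proof. by rewrite !card_sumb big_sumType. Qed.

Lemma card_first (T : finType) (A : {set T}) s : s <= #|A| ->
  #|[set x in A | index x (enum A) < s]| = s.
Proof.
move=> sA; rewrite (_ : [set _ in _ | _] = [set x in take s (enum A)]).
  by rewrite cardsE (card_uniqP _) ?take_uniq ?enum_uniq // size_takel // -cardE.
apply/setP => x; rewrite !inE -mem_enum; have [xA|xA] := boolP (x \in enum A).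
  by rewrite in_take.
by apply/esym/negP => /mem_take xt; case/negP: xA.
Qed.

Section Layerings.
Variables (G : sgraph) (col : G -> bool).
Hypothesis colP : forall x y : G, adj x y -> col x != col y.
Variables (v0 : G).
Implicit Types (F : {set {set G}}) (e : {set G}) (x y : G).

Local Notation endp := (endpoint col v0).

(** The parts of an equitable split differ by at most one at each vertex, hence not
at all where the degree is even. *)
Lemma halving F : F \subset edges G -> exists b : {set G} -> bool,
  forall v, ~~ odd (degree F v) ->
    degree F v = (degree [set e in F | b e] v).*2 /\
    degree F v = (degree [set e in F | ~~ b e] v).*2.
Proof.
move=> FG; pose f c e := if e \in F then Some (endp c e) else None.
have [b [b1 b2]] := equitable_split (f true) (f false).
exists b => v ev.
have cnt B : fibre_count (f (col v)) b (Some v) B = degree [set e in F | b e == B] v.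
  apply: eq_card => e; rewrite !inE /f; have [eF|] := boolP (e \in F); last by [].
  rewrite andTb (mem_endpoint colP v0) ?(subsetP FG) // andbC; congr (_ && _).
have tot : degree F v = degree [set e in F | b e == true] v
                       + degree [set e in F | b e == false] v.
  rewrite !degreeE (bigID (fun e => b e == true)) /=; congr (_ + _).
    by apply: eq_bigl => e; rewrite !inE.
  by apply: eq_bigl => e; rewrite !inE; case: (b e).
have bal B : fibre_count (f (col v)) b (Some v) B <= (fibre_count (f (col v)) b (Some v) (~~ B)).+1.
  by case: (col v); [apply: b1|apply: b2].
have [h1 h2] := (bal true, bal false); rewrite !cnt /= in h1 h2.
have -> : [set e in F | b e] = [set e in F | b e == true].
  by apply/setP => e; rewrite !inE eqb_id.
have -> : [set e in F | ~~ b e] = [set e in F | b e == false].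
  by apply/setP => e; rewrite !inE eqbF_neg.
exact: balanced_halves.
Qed.

Section EulerianLayers.
Variables (c : bool) (n : nat) (d : G -> nat) (E : {set {set G}}).
Hypotheses (n0 : 0 < n) (EG : E \subset edges G).
Hypothesis Ex : forall x, col x = c -> degree E x = 2 * n * d x.
Hypothesis Ey : forall y, col y != c -> ~~ odd (degree E y).

(** The two halves [H true] and [H false] of [E] are coloured with [n] colours.  At
a vertex [y] of degree [n * q + s] in each half, [s] edges of each half are kept
apart, together with [n - s] dummies common to both halves.  Every colour occurs
exactly once among the [n] elements kept apart, and [q] times among the other edges
of each half, so both halves have the same number of edges of each colour at [y].
The layers are the colour classes, alternately of the two halves. *)
Lemma eulerian_layers : exists lab : {set G} -> nat,
  [/\ forall e, e \in E -> 0 < lab e <= 2 * n,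
      forall x i, col x = c -> 0 < i <= 2 * n -> degree [set e in E | lab e == i] x = d x
    & forall y k, col y != c -> k < n ->
      degree [set e in E | lab e == k.*2.+1] y = degree [set e in E | lab e == k.*2.+2] y
      /\ degree E y %/ (2 * n) <= degree [set e in E | lab e == k.*2.+1] y].
Proof.
have [b bP] := halving EG.
pose H B := [set e in E | b e == B].
have HE B : H B \subset E by apply/subsetP => e; rewrite inE => /andP [].
have HG B : H B \subset edges G by apply: subset_trans EG.
have ev v : ~~ odd (degree E v).
  have [cv|] := eqVneq (col v) c; last exact: Ey.
  by rewrite (Ex cv) -mulnA oddM.
have Hdeg B v : degree E v = (degree (H B) v).*2.
  have [h1 h2] := bP v (ev v).
  case: B; [rewrite [LHS]h1|rewrite [LHS]h2]; congr (degree _ v).*2.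
    by apply/setP => e; rewrite !inE eqb_id.
  by apply/setP => e; rewrite !inE eqbF_neg.
pose D v := degree (H true) v.
have HD B v : degree (H B) v = D v.
  by apply: double_inj; rewrite -Hdeg /D -Hdeg.
pose s v := D v %% n.
pose yend e := endp (~~ c) e; pose xend e := endp c e.
pose apart B e := index e (enum (star col v0 (~~ c) (H B) (yend e))) < s (yend e).
(* [node B] sees [H B] from the ends of colour [c], and the other half, with the
   dummies, from the opposite ends; the flag [false] marks what is kept apart. *)
pose node (B : bool) (z : {set G} + G * 'I_n) : option (G * bool) :=
  match z with
  | inl e => if e \notin E then None else
             if b e == B then Some (xend e, true) else Some (yend e, ~~ apart (b e) e)
  | inr (y, k) => if (col y != c) && (s y <= k) then Some (y, false) else None
  end.
have [col' [colT colF]] := equitable_coloring (node true) (node false) n0.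
have eqt B u i j : fibre_count (node B) col' u i <= (fibre_count (node B) col' u j).+1.
  by case: B; [apply: colT|apply: colF].
pose K B (k : 'I_n) := [set e in H B | col' (inl e) == k].
have xyend e x : e \in E -> col x = c -> (yend e == x) = false.
  move=> eE cx; have [cy _ _] := endpointP colP v0 (subsetP EG e eE) (~~ c).
  by apply: contraTF isT => /eqP yx; move: cy; rewrite -/(yend e) yx cx; case: (c).
have yxend e y : e \in E -> col y != c -> (xend e == y) = false.
  move=> eE cy; have [cx _ _] := endpointP colP v0 (subsetP EG e eE) c.
  by apply: contraNF cy => /eqP <-; rewrite cx.
have memx e x : e \in E -> col x = c -> (x \in e) = (xend e == x).
  by move=> eE cx; rewrite (mem_endpoint colP v0) ?(subsetP EG) // cx.
have memy e y : e \in E -> col y != c -> (y \in e) = (yend e == y).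
  move=> eE cy; rewrite (mem_endpoint colP v0) ?(subsetP EG) // /yend.
  by congr (endp _ e == y); move: cy; case: (col y) (c) => [] [].
have someE (p q : G * bool) : (Some p == Some q) = (p == q) by [].
have nodeX B e x : col x = c ->
    (node B (inl e) == Some (x, true)) = (e \in H B) && (x \in e).
  move=> cx; rewrite inE /node; have [eE|//] := boolP (e \in E).
  have [bB|bB] := eqVneq (b e) B; rewrite someE xpair_eqE ?memx ?andbT //.
  by rewrite xyend.
have node_dummy B z w : (node B (inr z) == Some (w, true)) = false.
  by case: z => z j /=; case: ifP => // _; rewrite someE xpair_eqE andbF.
have Kx B k x : col x = c -> degree (K B k) x = d x.
  move=> cx; have tot : #|[set z | node B z == Some (x, true)]| = n * d x.
    rewrite card_sum_type [X in _ + X]eq_card0 ?addn0; last first.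
      by move=> z; rewrite in_set node_dummy.
    apply: double_inj; rewrite -[RHS]mul2n mulnA -(Ex cx) (Hdeg B); congr _.*2.
    by apply: eq_card => e; rewrite [LHS]in_set nodeX // [RHS]in_set.
  rewrite -(fibre_exact n0 (eqt B _) tot k) /fibre_count card_sum_type.
  rewrite [X in _ = _ + X]eq_card0 ?addn0; last by move=> z; rewrite in_set node_dummy.
  by apply: eq_card => e; rewrite [RHS]in_set nodeX // [LHS]in_set [e \in K B k]in_set andbAC.
pose dummies y (k : 'I_n) := #|[set z : G * 'I_n |
  (node true (inr z) == Some (y, false)) && (col' (inr z) == k)]|.
have sn y : s y < n by apply: ltn_pmod.
have DE y : D y = D y %/ n * n + s y by apply: divn_eq.
have Ky B k y : col y != c ->
    degree (K B k) y + dummies y k = (D y %/ n).+1 /\ dummies y k <= 1.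
  move=> cy; pose A := star col v0 (~~ c) (H B) y.
  have cA : #|A| = D y.
    rewrite starE ?HD //.
    by move: cy; case: (col y) (c) => [] [].
  pose Ap := [set e in A | apart B e].
  have ApE : Ap = [set e in A | index e (enum A) < s y].
    apply/setP => e; rewrite [LHS]in_set [RHS]in_set; have [eA|//] := boolP (e \in A).
    by move: eA; rewrite in_set /apart => /andP [_ /eqP ye]; rewrite /yend ye.
  have cAp : #|Ap| = s y by rewrite ApE card_first // cA leq_mod.
  have cM : #|A :\: Ap| = n * (D y %/ n).
    have := cardsID Ap A; rewrite cA (setIidPr _) ?cAp; last first.
      by apply/subsetP => e; rewrite inE => /andP [].
    by rewrite [D y in RHS]DE mulnC; clear; lia.
  (* In [node (~~ B)] the edges of [H B] are seen from their end [y]. *)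
  have nodeE e w : (node (~~ B) (inl e) == Some (y, w)) = (e \in A) && (apart B e == ~~ w).
    rewrite !inE /node; have [eE|//] := boolP (e \in E).
    have [->|bB] := eqVneq (b e) B.
      rewrite (_ : (B == ~~ B) = false); last by case: (B).
      rewrite someE xpair_eqE -/(yend e) /=.
      by congr (_ && _); case: (apart B e) w => [] [].
    rewrite (_ : (b e == ~~ B) = true) /=; last by move: bB; case: (b e) (B) => [] [].
    by rewrite someE xpair_eqE yxend.
  have main : fibre_count (node (~~ B)) col' (Some (y, true)) k = D y %/ n.
    apply: (fibre_exact n0 (eqt _ _)); rewrite -cM card_sum_type [X in _ + X]eq_card0 ?addn0.
      by apply: eq_card => e; rewrite in_set nodeE in_setD [e \in Ap]in_set; case: (e \in A) (apart B e) => [] [].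
    by move=> z; rewrite in_set node_dummy.
  have kept : fibre_count (node (~~ B)) col' (Some (y, false)) k = 1.
    apply: (fibre_exact n0 (eqt _ _)); rewrite muln1 card_sum_type.
    have -> : #|[set e | node (~~ B) (inl e) == Some (y, false)]| = s y.
      by rewrite -cAp; apply: eq_card => e; rewrite in_set nodeE [e \in Ap]in_set eqb_id.
    have -> : #|[set z | node (~~ B) (inr z) == Some (y, false)]| = n - s y.
      rewrite -[RHS](card_ord (n - s y)).
      have inj : injective (fun i : 'I_(n - s y) => (y, cast_ord (subnKC (ltnW (sn y))) (rshift (s y) i))).
        by move=> i j [] /eqP; rewrite eqn_add2l => /eqP/val_inj.
      rewrite -(card_codom inj); apply: eq_card => - [z j]; rewrite inE /=.
      apply/idP/codomP => [|[i [-> ->]]]; last by rewrite cy /= leq_addr.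
      case: ifP => // /andP [_ sj] /eqP [zy]; subst z.
      have lt : j - s y < n - s y by rewrite ltn_sub2r.
      by exists (Ordinal lt); congr (_, _); apply: val_inj; rewrite /= subnKC.
    by rewrite subnKC // ltnW.
  have cK : degree (K B k) y = #|[set e in A | col' (inl e) == k]|.
    apply: eq_card => e; rewrite !inE; have [eE|] := boolP (e \in E) => //=.
    by rewrite memy // -/(yend e); case: (b e == B); case: (yend e == y); rewrite ?andbF ?andbT.
  have dK : fibre_count (node (~~ B)) col' (Some (y, false)) k =
      #|[set e in A :&: Ap | col' (inl e) == k]| + dummies y k.
    rewrite /fibre_count card_sum_type; congr (_ + _).
    apply: eq_card => e; rewrite in_set nodeE [RHS]in_set in_setI [e \in Ap]in_set.
    by case: (e \in A) (apart B e) => [] [].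
  split; last by rewrite -kept dK leq_addl.
  have split : #|[set e in A | col' (inl e) == k]| =
      fibre_count (node (~~ B)) col' (Some (y, true)) k
      + #|[set e in A :&: Ap | col' (inl e) == k]|.
    rewrite /fibre_count card_sum_type [X in _ = _ + X + _]eq_card0 ?addn0; last first.
      by move=> z; rewrite in_set node_dummy.
    rewrite -[LHS](cardsID [set e | apart B e]) addnC; congr addn.
      apply: eq_card => e; rewrite in_setD [RHS]in_set nodeE ![e \in [set _ | _]]in_set.
      by case: (apart B e); rewrite ?eqxx ?andbF ?andbT /= ?andbF.
    apply: eq_card => e; rewrite in_setI [RHS]in_set in_setI [e \in Ap]in_set ![e \in [set _ | _]]in_set.
    by case: (apart B e); rewrite ?andbT ?andbF /= ?andbb ?andbF.
  by rewrite cK split main -addnA -dK kept addn1.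
pose lab e := if b e then (col' (inl e) : nat).*2.+1 else (col' (inl e) : nat).*2.+2.
have labE B (k : 'I_n) : [set e in E | lab e == k.*2.+1 + ~~ B] = K B k.
  apply/setP => e; rewrite !inE /lab -andbA; congr (_ && _).
  case: (b e); case: B; rewrite ?addn0 ?addn1 //= -?val_eqE /=; apply/eqP/eqP; lia.
exists lab; split=> [e eE|x i cx /andP [i0 i2n]|y k cy kn].
- rewrite /lab; have := ltn_ord (col' (inl e)).
  by case: (b e); move: (nat_of_ord _) => j; clear; lia.
- have i1n : i.-1./2 < n by move: i0 i2n; clear; lia.
  have -> : i = (Ordinal i1n : nat).*2.+1 + ~~ odd i by move: i0; clear; rewrite /=; lia.
  by rewrite labE Kx.
- have := labE true (Ordinal kn); have := labE false (Ordinal kn); rewrite /= addn0 addn1.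
  move=> -> ->; have [k1 dle] := Ky true (Ordinal kn) y cy.
  have [k2 _] := Ky false (Ordinal kn) y cy.
  have -> : degree E y %/ (2 * n) = D y %/ n.
    by rewrite (Hdeg true) -mul2n divnMl.
  by move: k1 k2 dle; clear; lia.
Qed.

End EulerianLayers.
End Layerings.

Section Families.
Variables (G : sgraph) (col : G -> bool).
Hypothesis colP : forall x y : G, adj x y -> col x != col y.
Variables (v0 : G).
Implicit Types (F : {set {set G}}) (e : {set G}) (x y v : G).

Local Notation endp := (endpoint col v0).

Lemma col_nth b p i : sorted (@adj G) (b :: p) -> i <= size p ->
  col (nth b (b :: p) i) = col b (+) odd i.
Proof.
elim: i b p => [|i IH] b [|a p] //=; rewrite ?addbF //.
case/andP=> ba pp ip; rewrite (set_nth_default a) // IH //.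
by have := colP ba; case: (col b) (col a) (odd i) => [] [] [].
Qed.

(** Consecutive edges of the tour have consecutive labels and meet at a vertex
whose colour tells the parity of these labels. *)
Lemma tour_layers l b p v j :
  let es := edge_seq (b :: p) in
  let layer i := [set e in es | index e es %% l == i] in
  sorted (@adj G) (b :: p) -> uniq es -> ~~ odd l -> l %| size p ->
  j.+1 < l -> col b (+) col v = odd j.+1 ->
  degree (layer j) v = degree (layer j.+1) v.
Proof.
move=> es layer sp us evl lp jl cv; pose w i := nth b (b :: p) i.
have sz : size es = size p by rewrite size_edge_seq.
have degE i : degree (layer i) v
    = \sum_(0 <= q < size p) (v \in [set w q; w q.+1]) && (q %% l == i).
  have -> : layer i = [set e in [seq e <- es | index e es %% l == i]].
    by apply/setP => e; rewrite !inE mem_filter andbC.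
  rewrite degree_set ?filter_uniq // count_filter -sum1_count big_mkcond /=.
  rewrite (big_nth set0) sz !big_nat; apply: eq_bigr => q /andP [_ qp].
  rewrite index_uniq ?sz //.
  have -> : nth set0 es q = [set w q; w q.+1] by rewrite /es /= (nth_pairmap b).
  by case: (_ && _).
have par q i : q %% l = i -> odd q = odd i.
  by move=> <-; rewrite [in LHS](divn_eq q l) oddD oddM (negbTE evl) andbF.
have cw q : q <= size p -> v == w q -> odd q = odd j.+1.
  move=> qp /eqP vw; move: cv; rewrite vw col_nth //.
  by case: (col b) (odd q) => [] [].
pose h q : nat := (w q == v) && (q %% l == j.+1).
have S1 : degree (layer j.+1) v = \sum_(0 <= q < size p) h q.
  rewrite degE !big_nat; apply: eq_bigr => q /andP [_ qp]; congr (nat_of_bool _).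
  rewrite !inE andbC [RHS]andbC; have [/par oq|//] := eqVneq.
  rewrite !andTb eq_sym; case: (boolP (v == w q.+1)) => [vw|]; last by rewrite orbF.
  by have := cw _ qp vw; rewrite /= oq /=; case: (odd j).
have S0 : degree (layer j) v = \sum_(0 <= q < size p) h q.+1.
  rewrite degE !big_nat; apply: eq_bigr => q /andP [_ qp]; congr (nat_of_bool _).
  have -> : (q.+1 %% l == j.+1) = (q %% l == j).
    rewrite -addn1 -modnDml addn1.
    have ql : q %% l < l by apply: ltn_pmod; apply: leq_ltn_trans jl.
    move: ql; rewrite leq_eqVlt => /orP [/eqP e|lt]; last by rewrite modn_small.
    by rewrite e modnn; apply/eqP/eqP => // qj; move: jl; rewrite -qj e ltnn.
  rewrite !inE andbC [RHS]andbC; have [/par oq|//] := eqVneq.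
  rewrite !andTb [w q.+1 == v]eq_sym; case: (boolP (v == w q)) => [vw|//].
  by have := cw _ (ltnW qp) vw; rewrite oq /=; case: (odd j).
have h0 : h 0 = 0 by rewrite /h mod0n andbF.
have hN : h (size p) = 0 by rewrite /h (eqP lp) andbF.
have := @big_nat_recr _ _ addn (size p) 0 h (leq0n _).
by rewrite (@big_nat_recl _ _ addn) // hN h0 add0n S0 S1 => ->; apply: addn0.
Qed.

Lemma subset_of_degrees c F (a : G -> nat) : F \subset edges G ->
  (forall x, col x = c -> a x <= degree F x) ->
  exists F', F' \subset F /\ forall x, col x = c -> degree F' x = a x.
Proof.
move=> FG aF; pose S := star col v0 c F.
exists [set e in F | index e (enum (S (endp c e))) < a (endp c e)].
split=> [|x cx]; first by apply/subsetP => e; rewrite inE => /andP [].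
have aS : a x <= #|S x| by rewrite starE // aF.
rewrite -[RHS](card_first aS); apply: eq_card => e; rewrite [LHS]in_set [RHS]in_set.
rewrite [e \in [set _ in _ | _]]in_set [e \in S x]in_set.
have [eF|//] := boolP (e \in F); rewrite (mem_endpoint colP v0) ?(subsetP FG) // cx.
by rewrite !andTb andbC; have [->|//] := eqVneq.
Qed.

Lemma side_degree_sum c F : F \subset edges G ->
  \sum_(x | col x == c) degree F x = #|F|.
Proof.
move=> FG; under eq_bigr => x _ do rewrite degreeE.
rewrite exchange_big /= -sum1_card; apply: eq_bigr => e eF.
by apply: (one_endpoint colP); apply: (subsetP FG).
Qed.

Lemma odd_side c F (P : pred G) : F \subset edges G ->
  odd #|[set y | (col y == c) && (P y (+) odd (degree F y))]|
  = odd #|[set y | (col y == c) && P y]| (+) odd #|F|.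
Proof.
move=> FG; rewrite -(side_degree_sum c FG) odd_sum -oddD.
set A := [set y | _ && P y]; set B := [set y | _ && odd _].
have -> : [set y | (col y == c) && (P y (+) odd (degree F y))] = symdiff A B.
  apply/setP => y; rewrite !inE; case: (col y == c) => //=.
  by case: (P y); case: (odd _).
by rewrite odd_symdiff oddD.
Qed.

Lemma half_card c (V : {set {set G}}) : V \subset edges G -> even_degrees V ->
  #|V|./2 = \sum_(x | col x == c) (degree V x)./2.
Proof.
move=> VG ev; rewrite -(side_degree_sum c VG) -[RHS]doubleK -muln2 big_distrl /=.
by congr _./2; apply: eq_bigr => x _; rewrite muln2 even_halfK.
Qed.

(** At the vertices of colour [c] all layers get the degree [d x].  Half of [V1] is
selected so that, together with [B] and with edges of [R] that fill the degrees up
to [2 * n * d x], it has even degrees; this part is labelled by [eulerian_layers].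
Half of [V2] and further edges of [R] similarly form a part with the degrees
[2 * d x] and the parities [P], whose halves are the first and the last layer.  The
selections are possible because both parts have an even number of edges, as their
degrees at the colour [c] show. *)
Lemma balanced_family c n (d : G -> nat) (B R V1 V2 : {set {set G}}) (P : pred G) :
  0 < n -> B \subset edges G -> R \subset edges G ->
  V1 \subset edges G -> V2 \subset edges G ->
  [disjoint B & R] -> [disjoint V1 & V2] -> [disjoint B :|: R & V1 :|: V2] ->
  even_degrees V1 -> spanning V1 -> even_degrees V2 -> spanning V2 ->
  (forall x, col x = c ->
     [/\ degree B x + (degree V1 x)./2 <= 2 * n * d x, (degree V2 x)./2 <= 2 * d x,
         (2 * n + 2) * d x <= degree B x + degree R x & 2 * n + 2 < d x]) ->
  (forall y, col y != c -> 2 * n * (2 * n + 1) <= degree B y) ->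
  ~~ odd #|[set y | (col y == ~~ c) && P y]| ->
  exists F lab, [/\ F \subset B :|: R :|: (V1 :|: V2),
    forall e, e \in F -> lab e < 2 * n + 2,
    forall j v, j.+1 < 2 * n + 2 -> (col v == c) = odd j.+1 ->
      degree [set e in F | lab e == j] v = degree [set e in F | lab e == j.+1] v /\
      2 * j.+2./2 < degree [set e in F | lab e == j] v,
    forall x, col x = c -> degree F x = (2 * n + 2) * d x
    & forall y, col y != c -> odd (degree F y) = P y].
Proof.
move=> n0 BG RG VG1 VG2 dBR dV dBV ev1 sp1 ev2 sp2 Hx Hy Pev.
pose a x := 2 * n * d x - (degree B x + (degree V1 x)./2).
pose a' x := 2 * d x - (degree V2 x)./2.
have [x cx|R1 [R1R R1a]] := subset_of_degrees (c := c) (a := a) RG.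
  by have [h1 h2 h3 _] := Hx x cx; rewrite /a; move: h1 h2 h3; clear; nia.
have RG' : R :\: R1 \subset edges G by apply: subset_trans RG; apply: subsetDl.
have [x cx|R2 [R2R R2a]] := subset_of_degrees (c := c) (a := a') RG'.
  have := degree_setD x R1R; rewrite (R1a x cx).
  by have [h1 h2 h3 _] := Hx x cx; rewrite /a /a'; move: h1 h2 h3; clear; nia.
have R1G := subset_trans R1R RG; have R2G := subset_trans R2R RG'.
have dBR1 : [disjoint B & R1] by apply: disjointWr dBR.
pose E0 := B :|: R1.
have E0G : E0 \subset edges G by rewrite subUset BG.
have E0deg v : degree E0 v = degree B v + degree R1 v by apply: degree_disjoint.
have cc y : (col y == ~~ c) = (col y != c) by case: (col y) (c) => [] [].
have evD N (f : G -> nat) : ~~ odd (\sum_(x | col x == c) 2 * N * f x).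
  have -> : \sum_(x | col x == c) 2 * N * f x = 2 * \sum_(x | col x == c) N * f x.
    by rewrite big_distrr; apply: eq_bigr => x _ /=; rewrite mulnA.
  by rewrite oddM.
have [|Y1 [Y1V Y1x Y1y]] := parity_selection (c := ~~ c) (P := fun y => odd (degree E0 y)) colP VG1 ev1 sp1.
  have := odd_side (~~ c) pred0 E0G; rewrite /= => ->.
  rewrite [X in odd X (+) _]eq_card0 => [|y]; last by rewrite !inE andbF.
  rewrite addFb; apply/eqP; rewrite -negb_add -oddD (half_card c VG1 ev1) -(side_degree_sum c E0G) -big_split /=.
  rewrite (eq_bigr (fun x => 2 * n * d x)) ?evD // => x /eqP cx.
  by have [h1 _ _ _] := Hx x cx; rewrite E0deg R1a // /a; move: h1; clear; lia.
have [|Y2 [Y2V Y2x Y2y]] := parity_selection (c := ~~ c) (P := fun y => P y (+) odd (degree R2 y)) colP VG2 ev2 sp2.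
  rewrite odd_side // (negbTE Pev) addFb.
  apply/eqP; rewrite -negb_add -oddD (half_card c VG2 ev2) -(side_degree_sum c R2G) -big_split /=.
  rewrite (eq_bigr (fun x => 2 * 1 * d x)) ?evD // => x /eqP cx.
  by have [_ h1 _ _] := Hx x cx; rewrite R2a // /a'; move: h1; clear; lia.
pose E := E0 :|: Y1; pose L := R2 :|: Y2.
have sBR : E0 \subset B :|: R by apply: setUS.
have R2R' : R2 \subset R by apply: subset_trans R2R (subsetDl _ _).
have sV1 : Y1 \subset V1 :|: V2 by apply: subset_trans Y1V (subsetUl _ _).
have sV2 : Y2 \subset V1 :|: V2 by apply: subset_trans Y2V (subsetUr _ _).
have sR2 : R2 \subset B :|: R by apply: subset_trans R2R' (subsetUr _ _).
have Edeg v : degree E v = degree E0 v + degree Y1 v.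
  by apply: degree_disjoint; apply: disjointWl sBR (disjointWr sV1 dBV).
have Ldeg v : degree L v = degree R2 v + degree Y2 v.
  by apply: degree_disjoint; apply: disjointWl sR2 (disjointWr sV2 dBV).
have dEL : [disjoint E & L].
  have d1 : [disjoint E0 & Y2] by apply: disjointWl sBR (disjointWr sV2 dBV).
  have d2 : [disjoint Y1 & Y2] by apply: disjointWl Y1V (disjointWr Y2V dV).
  have d3 : [disjoint Y1 & R2].
    by rewrite disjoint_sym; apply: disjointWl sR2 (disjointWr sV1 dBV).
  have d4 : [disjoint E0 & R2].
    rewrite -setI_eq0 setIUl setU_eq0 !setI_eq0 (disjointWr R2R' dBR) /=.
    by rewrite disjoint_sym; apply: disjointWl R2R _; rewrite -setI_eq0 setIDAC -setIDA setDv setI0.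
  by rewrite -setI_eq0 setIUl !setIUr !setU_eq0 !setI_eq0 d1 d2 d3 d4.
have EG : E \subset edges G.
  by rewrite subUset E0G (subset_trans Y1V).
have LG : L \subset edges G.
  by rewrite subUset R2G (subset_trans Y2V).
have Ex x : col x = c -> degree E x = 2 * n * d x.
  move=> cx; rewrite Edeg E0deg R1a // /a.
  have [+ _ _ _] := Hx x cx; have -> : (degree V1 x)./2 = degree Y1 x.
    by rewrite Y1x ?doubleK // cx; case: (c).
  by clear; lia.
have Lx x : col x = c -> degree L x = 2 * d x.
  move=> cx; rewrite Ldeg R2a // /a'.
  have [_ + _ _] := Hx x cx; have -> : (degree V2 x)./2 = degree Y2 x.
    by rewrite Y2x ?doubleK // cx; case: (c).
  by clear; lia.
have Ey y : col y != c -> ~~ odd (degree E y).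
  by rewrite -cc => /eqP cy; rewrite Edeg oddD Y1y // addbb.
have Ly y : col y != c -> odd (degree L y) = P y.
  rewrite -cc => /eqP cy; rewrite Ldeg oddD Y2y //.
  by case: (P y); case: (odd _).
have [labE [labE_lt labE_x labE_y]] := eulerian_layers colP v0 n0 EG Ex Ey.
have [b bP] := halving colP v0 LG.
pose lab e := if e \in E then labE e else if b e then 0 else 2 * n + 1.
have FE i : 0 < i <= 2 * n ->
    [set e in E :|: L | lab e == i] = [set e in E | labE e == i].
  move=> /andP [i0 i2]; apply/setP => e; rewrite [LHS]in_set [RHS]in_set in_setU /lab.
  case: ifP => //= _; case: (e \in L) => //=.
  by case: (b e); apply/eqP; move: i0 i2; clear; lia.
have labL e : e \in L -> lab e = if b e then 0 else 2 * n + 1.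
  by move=> eL; rewrite /lab (disjointFl dEL eL).
have F0 : [set e in E :|: L | lab e == 0] = [set e in L | b e].
  apply/setP => e; rewrite [LHS]in_set [RHS]in_set in_setU.
  have [eL|eL] := boolP (e \in L); first by rewrite labL // orbT; case: (b e) => //; rewrite addn1.
  rewrite orbF /lab; have [/labE_lt eE|//] := boolP (e \in E).
  by apply/andP => - [_ /eqP le]; move: eE; rewrite le; clear; lia.
have F1 : [set e in E :|: L | lab e == 2 * n + 1] = [set e in L | ~~ b e].
  apply/setP => e; rewrite [LHS]in_set [RHS]in_set in_setU.
  have [eL|eL] := boolP (e \in L).
    by rewrite labL // orbT; case: (b e); rewrite ?eqxx // addn1.
  rewrite orbF /lab; have [/labE_lt eE|//] := boolP (e \in E).
  by apply/andP => - [_ /eqP le]; move: eE; rewrite le; clear; lia.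
have dF v : degree (E :|: L) v = degree E v + degree L v by apply: degree_disjoint.
have layer_x x i : col x = c -> i < 2 * n + 2 ->
    degree [set e in E :|: L | lab e == i] x = d x.
  move=> cx il; have [|h1 h2] := bP x; first by rewrite Lx // oddM.
  have hd m : degree L x = m.*2 -> m = d x by rewrite Lx // mul2n => /double_inj.
  have [->|i0] := eqVneq i 0; first by rewrite F0; apply: hd.
  have [->|i1] := eqVneq i (2 * n + 1); first by rewrite F1; apply: hd.
  have i2 : 0 < i <= 2 * n by move: il i0 i1; clear; lia.
  by rewrite FE // labE_x.
exists (E :|: L), lab; split=> [|e|j v jl cv|x cx|y cy].
- apply/subUsetP; split; apply/subUsetP; split.
  + exact: subset_trans sBR (subsetUl _ _).
  + exact: subset_trans sV1 (subsetUr _ _).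
  + exact: subset_trans sR2 (subsetUl _ _).
  + exact: subset_trans sV2 (subsetUr _ _).
- rewrite in_setU; have [eL|eL] := boolP (e \in L).
    by move=> _; rewrite labL //; case: (b e); clear; lia.
  rewrite orbF /lab => eE; rewrite eE; have := labE_lt e eE; clear; lia.
- have [cx|cy] := eqVneq (col v) c.
    rewrite !layer_x // ?(ltnW jl) //; split=> //.
    by have [_ _ _ h] := Hx v cx; move: h jl; clear; lia.
  have oj : odd j by move: cv; rewrite (negbTE cy) oddS => /esym/negbFE.
  have jE : j = j./2.*2.+1 by rewrite -[LHS]odd_double_half oj.
  have jn : j./2 < n by move: oj jl; clear; lia.
  rewrite !FE; [|by move: oj jl; clear; lia..].
  have [e1 e2] := labE_y v j./2 cy jn; rewrite -jE in e1 e2.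
  split=> //; apply: leq_trans e2.
  rewrite (@leq_trans (2 * n + 1)) //; first by move: jn jE; clear; lia.
  rewrite leq_divRL ?muln_gt0 //; apply: leq_trans (leq_trans (Hy v cy) _); first by rewrite mulnC.
  by rewrite Edeg E0deg -addnA leq_addr.
- by rewrite dF Ex // Lx // mulnDl.
- by rewrite dF oddD (negbTE (Ey y cy)) Ly.
Qed.

End Families.

(** * Numerical bounds *)

Lemma equitable_value n (g : 'I_n -> nat) i :
  (forall i j, g i <= (g j).+1) ->
  (\sum_j g j) %/ n <= g i <= ((\sum_j g j) %/ n).+1.
Proof.
move=> eqg; have n0 : 0 < n by apply: leq_ltn_trans (ltn_ord i).
set q := _ %/ n; have qE : \sum_j g j = q * n + (\sum_j g j) %% n by apply: divn_eq.
have rn : (\sum_j g j) %% n < n by apply: ltn_pmod.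
have const (m : nat) : \sum_(j < n) m = m * n by rewrite sum_nat_const card_ord mulnC.
apply/andP; split; rewrite leqNgt; apply/negP => lt.
  have : \sum_j g j < \sum_(j < n) q.
    rewrite (bigD1 i) //= [X in _ < X](bigD1 i) //= -addSn leq_add //.
    by apply: leq_sum => j _; apply: leq_trans (eqg j i) lt.
  by rewrite const qE; clear; lia.
have : \sum_(j < n) q.+1 <= \sum_j g j.
  by apply: leq_sum => j _; rewrite -ltnS; apply: leq_trans lt (eqg i j).
by rewrite const qE; move: rn; clear; lia.
Qed.

(** The arithmetic of the constants: [D] is the degree left after removing the
light even sets from [p = 8 * k + 14] trees of total degree [u]. *)
Lemma degree_numerics k t u v D (d := D %/ (4 * k + 4)) :
  8 * k ^ 2 + 36 * k + 26 <= t -> 140 * k + 74 <= t ->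
  (8 * k + 14) * v <= 4 * u + (8 * k + 13) -> 8 * k + 14 <= u ->
  t + u <= D + v + (16 * k + 29) ->
  2 * k + 4 <= d /\ v./2 + 2 * k <= d.+1.
Proof.
move=> t1 t2 hv hu hD.
have Dd : D < (4 * k + 4) * d.+1 by rewrite mulnC ltn_ceil // addn_gt0 orbT.
have uv : v + (8 * k + 10) <= u.
  case: (leqP 6 v) => [v6|v6]; first by nia.
  by nia.
split; rewrite leqNgt; apply/negP => lt.
  have : D < (4 * k + 4) * (2 * k + 4).
    by apply: leq_trans Dd _; rewrite leq_mul2l lt orbT.
  (* The quadratic bound on [t] is too weak for [k <= 2]. *)
  have [k3|k3] := leqP 3 k; first by move: t1 uv hD k3; clear; nia.
  by move: t2 uv hD k3; clear; nia.
have vE : v = v./2.*2 + odd v by rewrite addnC odd_double_half.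
move: vE lt; set h := v./2 => vE lt.
have {}Dd : D < (4 * k + 4) * (h + 2 * k - 1).
  by apply: leq_trans Dd _; rewrite leq_mul2l; apply/orP; right; move: lt; clear; lia.
have [k0|k0] := posnP k.
  by move: k0 Dd t2 hD hv vE uv; case: (odd v); clear; nia.
by move: k0 Dd t1 hD hv vE uv; case: (odd v); clear; nia.
Qed.

(** * Light even subgraphs *)

Section Reservoirs.
Variables (G : sgraph) (col : G -> bool).
Hypothesis colP : forall x y : G, adj x y -> col x != col y.
Variables (v0 : G).
Hypothesis other : forall x : G, exists y, y != x.
Implicit Types (F : {set {set G}}) (e : {set G}) (x y v : G).

Lemma spanning_degree F v : spanning F -> 0 < degree F v.
Proof.
move=> sp; have [y yv] := other v.
have [a [b [/eqP -> _ eF]]] := linked_cross (sp v y) (S := pred1 v) (eqxx v) yv.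
by apply/card_gt0P; exists [set v; b]; rewrite !inE eqxx /= andbT.
Qed.

Lemma degree_spanning_family s (D : nat -> {set {set G}}) F v :
  (forall i, i < s -> D i \subset F /\ spanning (D i)) ->
  (forall i j, i < s -> j < s -> i != j -> [disjoint D i & D j]) ->
  s <= degree F v.
Proof.
move=> sD dD; apply: (@leq_trans (\sum_(i < s) degree (D i) v)).
  rewrite -[s in s <= _]card_ord -sum1_card; apply: leq_sum => i _.
  by apply: spanning_degree; have [] := sD i (ltn_ord i).
apply: degree_family => [i|i j ij]; first by have [] := sD i (ltn_ord i).
exact: dD.
Qed.

Lemma degree_sub F F' v : F \subset F' -> degree F v <= degree F' v.
Proof. by move=> /(degree_setD v) ->; apply: leq_addr. Qed.

(** Four light trees, two of which serve to make the other two even. *)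
Lemma light_even_pair c p (D : nat -> {set {set G}}) (U := \bigcup_(i < p) D i) :
  3 < p -> U \subset edges G ->
  (forall i, i < p -> spanning (D i)) ->
  (forall i j, i < p -> j < p -> i != j -> [disjoint D i & D j]) ->
  exists V : bool -> {set {set G}},
  [/\ forall b, [/\ V b \subset U, spanning (V b) & even_degrees (V b)],
      [disjoint V true & V false]
    & forall x, col x = c -> p * degree (V true :|: V false) x <= 4 * degree U x + p.-1].
Proof.
move=> p3 UG sD dD; have p0 : 0 < p by apply: leq_trans p3.
pose f x := (4 * degree U x + p.-1) %/ p.
have [|||i|i j ij|x cx|T [sT dT fT]] := light_tree_packing colP v0 (c := c) (U := U) (k := 4)
   (D := fun i : 'I_p => D i) (f := f).
- by [].
- by [].
- by [].
- by split; [apply: (bigcup_sup i)|apply: sD].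
- exact: dD.
- rewrite /f mulnC [X in _ <= X]mulnC.
  have := divn_eq (4 * degree U x + p.-1) p; have := ltn_pmod (4 * degree U x + p.-1) p0.
  by clear -p0; lia.
have TG i : T i \subset edges G by have [TU _] := sT i; apply: subset_trans UG.
have sp i : spanning (T i) by have [] := sT i.
pose t i : 'I_4 := inord i.
have tn i j : i < 4 -> j < 4 -> i != j -> [disjoint T (t i) & T (t j)].
  by move=> i4 j4 ij; apply: dT; rewrite -val_eqE /= !inordK.
have [V1 [TV1 V1T ev1]] := even_supergraph (TG (t 0)) (TG (t 1)) (tn 0 1 isT isT isT) (sp _) (sp _).
have [V2 [TV2 V2T ev2]] := even_supergraph (TG (t 2)) (TG (t 3)) (tn 2 3 isT isT isT) (sp _) (sp _).
have TU i : T i \subset U by have [] := sT i.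
have dV : [disjoint V1 & V2].
  apply: disjointWl V1T (disjointWr V2T _).
  by rewrite -setI_eq0 setIUl !setIUr !setU_eq0 !setI_eq0 !tn.
exists (fun b => if b then V1 else V2); split=> // [[]|x cx].
- split=> //; first by apply: subset_trans V1T _; rewrite subUset !TU.
  by move=> u v; apply: linked_sub TV1 _; apply: sp.
- split=> //; first by apply: subset_trans V2T _; rewrite subUset !TU.
  by move=> u v; apply: linked_sub TV2 _; apply: sp.
rewrite degree_disjoint //.
have h1 := degree_sub x V1T; have h2 := degree_sub x V2T.
rewrite !degree_disjoint ?tn // in h1 h2.
have := fT x cx.
have -> : \sum_(i < 4) degree (T i) x = \sum_(0 <= i < 4) degree (T (t i)) x.
  by rewrite big_mkord; apply: eq_bigr => i _; rewrite /t inord_val.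
rewrite !big_nat_recr //= big_geq // add0n.
have := leq_divM (4 * degree U x + p.-1) p; rewrite -/(f x) mulnC.
move=> le sum; apply: leq_trans le; rewrite leq_mul2l; apply/orP; right.
by move: h1 h2 sum; clear; lia.
Qed.

Lemma bigcup_disjoint2 (T : finType) m n (A B : nat -> {set T}) :
  (forall i j, i < m -> j < n -> [disjoint A i & B j]) ->
  [disjoint \bigcup_(i < m) A i & \bigcup_(j < n) B j].
Proof.
move=> dAB; apply: bigcup_disjoint => j _; rewrite disjoint_sym.
by apply: bigcup_disjoint => i _; rewrite disjoint_sym dAB.
Qed.

(** Two groups of [8 * k + 14] trees are turned into light even sets, one pair for
each side; one tree is kept aside and the others only serve to keep the degrees of
the remaining graph large. *)
Lemma reservoirs k t : 8 * k ^ 2 + 36 * k + 26 <= t -> 140 * k + 74 <= t ->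
  edge_connected G (2 * t) ->
  exists (U : {set {set G}}) (V : bool -> bool -> {set {set G}}),
  let Z c := V c true :|: V c false in
  let W := edges G :\: (U :|: (Z true :|: Z false)) in
  [/\ U \subset edges G /\ spanning U,
      forall c b, [/\ V c b \subset edges G, spanning (V c b) & even_degrees (V c b)],
      forall c, [disjoint V c true & V c false] /\ [disjoint U & Z c],
      [disjoint Z true & Z false]
    & forall c x, col x = c -> 2 * k + 4 <= degree W x %/ (4 * k + 4) /\
        (degree (Z c) x)./2 + 2 * k <= (degree W x %/ (4 * k + 4)).+1].
Proof.
move=> t1 t2 con; have [T0 [sT0 dT0]] := tree_packing colP v0 con.
pose T i := if insub i is Some j then T0 j else set0.
have TE i (it : i < t) : T i = T0 (Ordinal it) by rewrite /T insubT.
have sT i : i < t -> T i \subset edges G /\ spanning (T i).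
  by move=> it; rewrite TE; apply: sT0.
have dT i j : i < t -> j < t -> i != j -> [disjoint T i & T j].
  by move=> it jt ij; rewrite !TE; apply: dT0.
pose p := 8 * k + 14; pose off (c : bool) := if c then 1 else p.+1.
have pt c i : i < p -> off c + i < t.
  by rewrite /off /p; move: t2; case: c; clear; lia.
pose UU c := \bigcup_(i < p) T (off c + i).
have UUG c : UU c \subset edges G.
  by apply/bigcupsP => i _; have [] := sT _ (pt c i (ltn_ord i)).
have [|i ip|i j ip jp ij|V1 [V1P dV1 V1x]] := light_even_pair true (p := p)
    (D := fun i => T (off true + i)) _ (UUG true).
- by rewrite /p; clear; lia.
- by have [] := sT _ (pt true i ip).
- by apply: dT; rewrite ?pt // eqn_add2l.
have [|i ip|i j ip jp ij|V2 [V2P dV2 V2x]] := light_even_pair false (p := p)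
    (D := fun i => T (off false + i)) _ (UUG false).
- by rewrite /p; clear; lia.
- by have [] := sT _ (pt false i ip).
- by apply: dT; rewrite ?pt // eqn_add2l.
pose V c := if c then V1 else V2.
have t0 : 0 < t by move: t2; clear; lia.
exists (T 0), V => Z W.
have VP c b : [/\ V c b \subset UU c, spanning (V c b) & even_degrees (V c b)].
  by case: c; [apply: V1P|apply: V2P].
have VG c b : V c b \subset edges G.
  by have [s _ _] := VP c b; apply: subset_trans (UUG c).
have dV c : [disjoint V c true & V c false] by case: c.
have ZU c : Z c \subset UU c.
  by have [s1 _ _] := VP c true; have [s2 _ _] := VP c false; rewrite subUset s1.
have Zx c x : col x = c -> p * degree (Z c) x <= 4 * degree (UU c) x + p.-1.
  by case: c; [apply: V1x|apply: V2x].
have dU c : [disjoint T 0 & UU c].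
  apply: bigcup_disjoint => i _; apply: dT => //; first exact: pt.
  by rewrite /off; case: (c); clear; lia.
have dUU : [disjoint UU true & UU false].
  apply: (bigcup_disjoint2 (A := fun i => T (off true + i)) (B := fun j => T (off false + j))).
  move=> i j ip jp; apply: dT; try exact: pt.
  by rewrite /off; move: ip jp; clear; lia.
have dZ : [disjoint Z true & Z false] by apply: disjointWl (ZU _) (disjointWr (ZU _) dUU).
have dUZ c : [disjoint T 0 & Z c] by apply: disjointWr (ZU _) (dU c).
split=> // [|c b|c x cx]; first exact: sT.
  by have [_ s e] := VP c b.
have TG : T 0 \subset edges G by have [] := sT 0 t0.
have ZG c' : Z c' \subset edges G by apply: subset_trans (ZU c') (UUG c').
have degW : degree (edges G) x
    = degree W x + (degree (T 0) x + (degree (Z true) x + degree (Z false) x)).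
  rewrite (@degree_setD _ (edges G) (T 0 :|: (Z true :|: Z false))); last first.
    by rewrite !subUset TG !VG.
  rewrite addnC !degree_disjoint //.
  by rewrite -setI_eq0 setIUr setU_eq0 !setI_eq0 !dUZ.
pose R := edges G :\: (T 0 :|: (UU true :|: UU false)).
have degR : degree (edges G) x
    = degree R x + (degree (T 0) x + (degree (UU true) x + degree (UU false) x)).
  rewrite (@degree_setD _ (edges G) (T 0 :|: (UU true :|: UU false))); last first.
    by rewrite !subUset TG !UUG.
  rewrite addnC !degree_disjoint //.
  by rewrite -setI_eq0 setIUr setU_eq0 !setI_eq0 !dU.
have Rt : t - (2 * p + 1) <= degree R x.
  apply: (@degree_spanning_family _ (fun i => T (2 * p + 1 + i))) => [i it|i j it jt ij].
    have it' : 2 * p + 1 + i < t by move: it; clear; lia.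
    split; last by have [] := sT _ it'.
    have [TiG _] := sT _ it'; rewrite subsetD TiG /=.
    have d0 : [disjoint T (2 * p + 1 + i) & T 0] by apply: dT => //; clear; lia.
    rewrite -setI_eq0 !setIUr !setU_eq0 !setI_eq0 d0 /=.
    apply/andP; split; apply: bigcup_disjoint => j _; apply: dT => //; try exact: pt.
      by rewrite /off; have := ltn_ord j; clear; lia.
    by rewrite /off; have := ltn_ord j; clear; lia.
  by apply: dT; rewrite ?eqn_add2l //; [move: it|move: jt]; clear; lia.
have pU : p <= degree (UU c) x.
  apply: (@degree_spanning_family _ (fun i => T (off c + i))) => [i ip|i j ip jp ij].
    split; last by have [] := sT _ (pt c i ip).
    exact: (bigcup_sup (Ordinal ip)).
  by apply: dT; rewrite ?pt // eqn_add2l.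
have Zle c' : degree (Z c') x <= degree (UU c') x by apply: degree_sub.
apply: (degree_numerics t1 t2 (u := degree (UU c) x)) => //.
  by have := Zx c x cx; rewrite /p; clear; lia.
have := degW; rewrite degR; have := Zle (~~ c); move: Rt; rewrite /p.
by case: (c); rewrite /=; clear; lia.
Qed.

End Reservoirs.

(** * Assembling the decomposition *)

Section Final.
Variables (G : sgraph) (col : G -> bool).
Hypothesis colP : forall x y : G, adj x y -> col x != col y.
Variables (v0 : G).
Implicit Types (F : {set {set G}}) (e : {set G}) (x y v : G).

Lemma equitable_edge_coloring n (W : {set {set G}}) : 0 < n -> W \subset edges G ->
  exists cl : {set G} -> nat, forall v i, i < n ->
    degree W v %/ n <= degree [set e in W | cl e == i] v <= (degree W v %/ n).+1.
Proof.
move=> n0 WG; pose f c e := if e \in W then Some (endpoint col v0 c e) else None.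
have [cl [cl1 cl2]] := equitable_coloring (f true) (f false) n0.
exists cl => v i lt.
have cnt (j : 'I_n) : fibre_count (f (col v)) cl (Some v) j = degree [set e in W | cl e == j :> nat] v.
  apply: eq_card => e; rewrite !inE /f val_eqE; have [eW|] := boolP (e \in W); last by [].
  by rewrite andTb (mem_endpoint colP v0) ?(subsetP WG) // andbC.
have -> : degree W v = \sum_(j < n) degree [set e in W | cl e == j :> nat] v.
  rewrite degreeE (partition_big cl predT) //=; apply: eq_bigr => j _.
  by rewrite degreeE; apply: eq_bigl => e; rewrite inE.
apply: (equitable_value (g := fun j : 'I_n => degree [set e in W | cl e == j :> nat] v) (Ordinal lt)).
by move=> j j'; rewrite -!cnt; case: (col v); [apply: cl1|apply: cl2].
Qed.

Lemma degree_color_range (W : {set {set G}}) (cl : {set G} -> nat) n d v a m :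
  (forall i, i < n -> d <= degree [set e in W | cl e == i] v <= d.+1) -> a + m <= n ->
  m * d <= degree [set e in W | a <= cl e < a + m] v <= m * d.+1.
Proof.
move=> bal; elim: m => [_|m IH am].
  rewrite (_ : degree _ v = 0) ?mul0n //; apply: eq_card0 => e; rewrite !inE addn0.
  by apply/negP => /andP [/andP [_ +] _]; clear; lia.
have -> : [set e in W | a <= cl e < a + m.+1]
    = [set e in W | a <= cl e < a + m] :|: [set e in W | cl e == a + m].
  apply/setP => e; rewrite !inE -andb_orr; congr (_ && _); clear; lia.
have amn : a + m < n by rewrite -addnS.
rewrite degree_disjoint.
  have /andP [h1 h2] := IH (ltnW amn); have /andP [h3 h4] := bal _ amn.
  by rewrite !mulSn ![_ + m * _]addnC !leq_add.
rewrite -setI_eq0; apply/eqP/setP => e; rewrite !inE; apply/negP.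
by move=> /andP [/andP [_ h] /andP [_ h']]; move: h h'; clear; lia.
Qed.

(** Of the [2 * k + 2] colour classes, [2 * k - 1] are used completely, which leaves
room for half of [V1], and the other three serve to fill the degrees. *)
Lemma family_of_classes k c (W V1 V2 : {set {set G}}) cl a n :
  0 < k -> W \subset edges G -> V1 \subset edges G -> V2 \subset edges G ->
  [disjoint V1 & V2] -> [disjoint W & V1 :|: V2] ->
  even_degrees V1 -> spanning V1 -> even_degrees V2 -> spanning V2 ->
  ~~ odd #|edges G| -> 0 < n -> a + (2 * k + 2) <= n ->
  (forall v i, i < n ->
    degree W v %/ n <= degree [set e in W | cl e == i] v <= (degree W v %/ n).+1) ->
  (forall v, 2 * k + 4 <= degree W v %/ n) ->
  (forall x, col x = c -> (degree (V1 :|: V2) x)./2 + 2 * k <= (degree W x %/ n).+1) ->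
  exists F lab, [/\ F \subset [set e in W | a <= cl e < a + (2 * k + 2)] :|: (V1 :|: V2),
    forall e, e \in F -> lab e < 2 * k + 2,
    forall j v, j.+1 < 2 * k + 2 -> (col v == c) = odd j.+1 ->
      degree [set e in F | lab e == j] v = degree [set e in F | lab e == j.+1] v /\
      2 * j.+2./2 < degree [set e in F | lab e == j] v,
    forall x, col x = c -> degree F x = (2 * k + 2) * (degree W x %/ n)
    & forall y, col y != c -> odd (degree F y) = odd (degree (edges G) y)].
Proof.
move=> k0 WG VG1 VG2 dV dWV ev1 sp1 ev2 sp2 evG n0 an bal dk Vx.
pose B := [set e in W | a <= cl e < a + (2 * k - 1)].
pose R := [set e in W | a + (2 * k - 1) <= cl e < a + (2 * k - 1) + 3].
have kE : a + (2 * k - 1) + 3 = a + (2 * k + 2) by move: k0; clear; lia.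
have BW : B \subset W by apply/subsetP => e; rewrite inE => /andP [].
have RW : R \subset W by apply/subsetP => e; rewrite inE => /andP [].
have BR : B :|: R = [set e in W | a <= cl e < a + (2 * k + 2)].
  apply/setP => e; rewrite !inE -andb_orr; congr (_ && _).
  by move: k0; clear; lia.
have dBR : [disjoint B & R].
  rewrite -setI_eq0; apply/eqP/setP => e; rewrite !inE; apply/negP.
  by move=> /andP [/andP [_ +] /andP [_]]; clear; lia.
have Bdeg v : (2 * k - 1) * (degree W v %/ n) <= degree B v <= (2 * k - 1) * (degree W v %/ n).+1.
  by apply: degree_color_range (bal v) _; move: an; clear; lia.
have Rdeg v : 3 * (degree W v %/ n) <= degree R v <= 3 * (degree W v %/ n).+1.
  by apply: degree_color_range (bal v) _; rewrite kE.
rewrite -BR; apply: balanced_family => //.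
- exact: subset_trans WG.
- exact: subset_trans WG.
- by rewrite BR; apply: disjointWl dWV; apply/subsetP => e; rewrite inE => /andP [].
- move=> x cx; have := Vx x cx; rewrite degree_disjoint //.
  have /andP [B1 B2] := Bdeg x; have /andP [R1 R2] := Rdeg x.
  have := dk x; move: (degree W x %/ n) (degree V1 x) (degree V2 x) B1 B2 R1 R2 => D u w.
  by move: (degree B x) (degree R x) => b r; move: k0; clear; split; nia.
- move=> y _; have /andP [B1 _] := Bdeg y; apply: leq_trans B1.
  by have := dk y; move: k0; clear; nia.
have := odd_side colP (~~ c) pred0 (subxx (edges G)); rewrite /= => ->.
by rewrite (negbTE evG) addbF eq_card0 // => y; rewrite !inE andbF.
Qed.

Lemma mem_consecutive (p : seq G) e : (e \in consecutive_edges p) = (e \in edge_seq p).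
Proof.
elim: p => [|x [|y p] IH].
- by apply/imsetP => - [xy].
- by apply/imsetP => - [xy].
rewrite edge_seq_cons in_cons -IH; apply/imsetP/orP => [[xy]|[/eqP ->|/imsetP [xy xyp ->]]].
- rewrite in_cons => /orP [/eqP -> ->|xyp ->]; [by left|right].
  by apply/imsetP; exists xy.
- by exists (x, y); rewrite // in_cons eqxx.
- by exists xy; rewrite // in_cons xyp orbT.
Qed.

Lemma decomposition_of_paths l (I : finType) (T : I -> seq G) :
  (forall i, sorted (@adj G) (T i)) -> (forall i, uniq (T i)) ->
  (forall i, size (T i) = l.+1) -> (forall e, multiplicity T e = (e \in edges G)) ->
  exists D : {set pregraph G}, path_decomposition l D.
Proof.
move=> so us sz mult.
have memT i e : (e \in edge_seq (T i)) = (count_mem e (edge_seq (T i)) == 1).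
  by rewrite count_uniq_mem ?edge_seq_uniq //; case: (_ \in _).
pose P i : pregraph G := ([set x in T i], consecutive_edges (T i)).
exists [set P i | i : I]; split.
- move=> _ /imsetP [i _ ->]; split; last by exists (T i).
  split=> [|f] /=; first by apply/subsetP => e; rewrite mem_consecutive; apply: edge_seq_edges.
  rewrite mem_consecutive => fT; apply/subsetP => v vf.
  by rewrite inE; apply: edge_seq_sub fT vf.
- move=> _ _ /imsetP [i _ ->] /imsetP [j _ ->] ij.
  have {}ij : i != j by apply: contraNneq ij => ->.
  rewrite -setI_eq0; apply/eqP/setP => e; rewrite in_setI in_set0 !mem_consecutive.
  apply/negP => /andP []; rewrite !memT => /eqP ei /eqP ej.
  have := mult e; rewrite /multiplicity (sum_two ij) ei ej.
  by case: (e \in _).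
apply/setP => e; apply/bigcupP/idP => [[_ /imsetP [i _ ->]]|eG].
  by rewrite mem_consecutive; apply: edge_seq_edges.
have [i ei] : exists i, e \in edge_seq (T i).
  have := mult e; rewrite eG /multiplicity => /eqP.
  have [i ei _|no] := pickP (fun i => e \in edge_seq (T i)); first by exists i.
  by rewrite big1 // => i _; apply: count_memPn; rewrite no.
by exists (P i); [apply: imset_f|rewrite mem_consecutive].
Qed.

End Final.

Theorem theorem7p4 (k : nat) (k_gt0 : 0 < k) (G : sgraph) :
  let r := maxn (32 * (2 * k + 1)) ((2 * k + 2) * (2 * k + 4)) in
  bipartite G ->
  edge_connected G (2 * (12 * k + 2 * r + 10)) ->
  4 * k + 4 %| #|edges G| ->
  exists D : {set pregraph G}, path_decomposition (2 * k + 2) D.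
Proof.
move=> r [A bip] con div.
have [E0|[e0 e0G]] := set_0Vmem (edges G).
  exists set0; split=> [H|H K|]; rewrite ?inE //.
  by rewrite E0; apply: big_pred0 => H; rewrite inE.
have /edgesP [v0 [v1 [v01 _]]] := e0G.
pose col (x : G) := x \in A.
have colP x y : adj x y -> col x != col y by apply: bip.
have other (x : G) : exists y, y != x.
  have [->|xv] := eqVneq x v0; last by exists v0; rewrite eq_sym.
  by exists v1; rewrite eq_sym; apply: adj_neq.
have r1 : 32 * (2 * k + 1) <= r by apply: leq_maxl.
have r2 : (2 * k + 2) * (2 * k + 4) <= r by apply: leq_maxr.
have [||U [V]] := reservoirs colP v0 other (k := k) _ _ con.
- by move: r2; clear; nia.
- by move: r1; clear; lia.
move=> /[let] Z /[let] W [[UG Usp] VP dV dZ WP].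
pose n := 4 * k + 4; have n0 : 0 < n by rewrite /n addn_gt0 orbT.
have WG : W \subset edges G by apply: subsetDl.
have evG : ~~ odd #|edges G|.
  by case/dvdnP: div => q ->; rewrite oddM oddD oddM andbF.
have dk v : 2 * k + 4 <= degree W v %/ n by have [] := WP (col v) v erefl.
(* Each family below uses half of the colours. *)
have [cl cl_bal] := equitable_edge_coloring colP v0 n0 WG.
have dWZ c : [disjoint W & Z c].
  rewrite disjoint_sym; apply: (@disjointWl _ _ (mem (U :|: (Z true :|: Z false)))).
    by apply/subsetP => e; case: c; rewrite !inE => ->; rewrite ?orbT.
  by rewrite -setI_eq0; apply/eqP/setP => e; rewrite in_setI in_setD in_set0; case: (e \in _).
have fam c a := @family_of_classes G col colP v0 k c W (V c true) (V c false) cl a n k_gt0 WG.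
have {}fam c a : a + (2 * k + 2) <= n -> _ := fun an =>
  let: And3 g1 s1 e1 := VP c true in let: And3 g2 s2 e2 := VP c false in
  fam c a g1 g2 (dV c).1 (dWZ c) e1 s1 e2 s2 evG n0 an cl_bal dk
    (fun x cx => (WP c x cx).2).
have [|FA [labA [FAs labA_lt balA FAx FAy]]] := fam true 0.
  by rewrite /n; clear; lia.
have [|FB [labB [FBs labB_lt balB FBx FBy]]] := fam false (2 * k + 2).
  by rewrite /n; clear; lia.
pose l := 2 * k + 2.
have ZG c : Z c \subset edges G.
  by rewrite subUset; have [-> _ _] := VP c true; have [-> _ _] := VP c false.
have rangeW a : [set e in W | a <= cl e < a + l] \subset W.
  by apply/subsetP => e; rewrite inE => /andP [].
have FAG : FA \subset edges G.
  apply: subset_trans FAs _; rewrite subUset ZG andbT.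
  exact: subset_trans (rangeW 0) WG.
have FBG : FB \subset edges G.
  apply: subset_trans FBs _; rewrite subUset ZG andbT.
  exact: subset_trans (rangeW l) WG.
have dAB : [disjoint FA & FB].
  have dUU (P Q P' Q' : {set {set G}}) : [disjoint P & P'] -> [disjoint P & Q'] ->
      [disjoint Q & P'] -> [disjoint Q & Q'] -> [disjoint P :|: Q & P' :|: Q'].
    by rewrite -!setI_eq0 setIUl !setIUr !setU_eq0 => -> -> -> ->.
  apply: disjointWl FAs (disjointWr FBs _); apply: dUU => //.
  - rewrite -setI_eq0; apply/eqP/setP => e; rewrite !inE; apply/negP.
    by move=> /andP [/andP [_ +] /andP [_]]; clear; lia.
  - exact: disjointWl (rangeW 0) (dWZ false).
  - by rewrite disjoint_sym; apply: disjointWl (rangeW l) (dWZ true).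
pose S := edges G :\: (FA :|: FB).
have SG : S \subset edges G by apply: subsetDl.
have ABG : FA :|: FB \subset edges G by rewrite subUset FAG.
have degS v : degree (edges G) v = degree FA v + degree FB v + degree S v.
  by rewrite (degree_setD v ABG) degree_disjoint.
(* At each vertex one family has a degree divisible by [l] and the other one the
   parity of the degree in [G]. *)
have Sev : even_degrees S.
  move=> v; have := congr1 odd (degS v); rewrite !oddD.
  have evl a : ~~ odd ((2 * k + 2) * a) by rewrite oddM oddD oddM.
  case cv : (col v).
    rewrite (FAx v cv) (negbTE (evl _)) FBy ?cv //.
    by case: (odd (degree S v)); case: (odd _).
  rewrite (FBx v cv) (negbTE (evl _)) FAy ?cv //.
  by case: (odd (degree S v)); case: (odd _).
have dUW : [disjoint U & W].
  rewrite -setI_eq0; apply/eqP/setP => e; rewrite in_setI in_setD in_setU in_set0.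
  by case: (e \in U).
have dUr (P Q : {set {set G}}) : [disjoint U & P] -> [disjoint U & Q] -> [disjoint U & P :|: Q].
  by rewrite -!setI_eq0 setIUr setU_eq0 => -> ->.
have dUF (F P : {set {set G}}) c : P \subset W -> F \subset P :|: Z c -> [disjoint U & F].
  move=> PW FP; apply: disjointWr FP _; apply: dUr; first exact: disjointWr PW dUW.
  by have [] := dV c.
have US : U \subset S.
  by rewrite subsetD UG; apply: dUr; [apply: dUF FAs|apply: dUF FBs]; apply: rangeW.
have Ssp : spanning S by move=> u v; apply: linked_sub US (Usp u v).
have lS : l %| #|S|.
  have cE : #|edges G| = #|FA| + #|FB| + #|S|.
    rewrite -cardsUI (disjoint_setI0 dAB) cards0 addn0 addnC -(cardsID (FA :|: FB) (edges G)).
    by rewrite (setIidPr ABG) addnC.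
  have lF c (F : {set {set G}}) : F \subset edges G ->
      (forall x, col x = c -> degree F x = l * (degree W x %/ n)) -> l %| #|F|.
    move=> FG Fx; rewrite -(side_degree_sum colP c FG); apply: dvdn_sum => x /eqP cx.
    by rewrite Fx // dvdn_mulr.
  have : l %| #|edges G| by apply: dvdn_trans div; apply/dvdnP; exists 2; rewrite /l; clear; lia.
  have lA : l %| #|FA| by apply: (lF true).
  have lB : l %| #|FB| by apply: (lF false).
  by rewrite cE dvdn_addr ?dvdn_add.
have [b cb] : exists b, col b = false.
  have := colP _ _ v01; case E : (col v0); last by move=> _; exists v0.
  by case E1 : (col v1) => // _; exists v1.
have [p [lp up pS]] := euler_tour b SG Sev Ssp.
pose es := edge_seq (b :: p).
have sp : sorted (@adj G) (b :: p).
  by apply: sub_edges_sorted => e; rewrite pS; apply: (subsetP SG).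
have szp : size p = #|S|.
  by rewrite -(eq_card pS) (card_uniqP up) size_edge_seq.
have dAS : [disjoint FA & S].
  rewrite -setI_eq0; apply/eqP/setP => e; rewrite in_setI in_setD in_setU in_set0.
  by case: (e \in FA).
(* The tour starts at the colour where the paths of the first family start. *)
pose lab e := if e \in S then index e es %% l else labA e.
have layer_deg i v : degree [set e in FA :|: S | lab e == i] v =
    degree [set e in FA | labA e == i] v + degree [set e in es | index e es %% l == i] v.
  rewrite -degree_disjoint; last first.
    have s1 : [set e in FA | labA e == i] \subset FA by apply/subsetP => e; rewrite inE => /andP [].
    have s2 : [set e in es | index e es %% l == i] \subset S.
      by apply/subsetP => e; rewrite inE pS => /andP [].
    exact: disjointWl s1 (disjointWr s2 dAS).
  congr (degree _ v); apply/setP => e; rewrite [LHS]in_set [RHS]in_setU [e \in FA :|: S]in_setU.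
  rewrite [X in _ = X || _]in_set [X in _ = _ || X]in_set pS /lab.
  have [eS|eS] := boolP (e \in S); last by rewrite !orbF.
  by rewrite (disjointFl dAS eS).
have l0 : 0 < l by rewrite /l addn_gt0 orbT.
have colP' c (x y : G) : adj x y -> (col x == c) != (col y == c).
  by move/colP; case: (col x) (col y) c => [] [] [].
have ASG : FA :|: S \subset edges G by rewrite subUset FAG.
have lab_lt e : e \in FA :|: S -> lab e < l.
  rewrite in_setU /lab; case: ifP => [_ _|_]; first exact: ltn_pmod.
  by rewrite orbF; apply: labA_lt.
have lab_bal j v : j.+1 < l -> (col v == true) = odd j.+1 ->
    degree [set e in FA :|: S | lab e == j] v = degree [set e in FA :|: S | lab e == j.+1] v /\
    2 * j.+2./2 < degree [set e in FA :|: S | lab e == j] v.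
  move=> jl cv; have [b1 b2] := balA j v jl cv; rewrite !layer_deg; split.
    rewrite b1; congr (_ + _); apply: (tour_layers colP) => //.
    - by rewrite /l oddD oddM.
    - by rewrite szp.
    - by rewrite cb -cv; case: (col v).
  exact: leq_trans b2 (leq_addr _ _).
have [I1 [T1 [so1 us1 sz1 mult1]]] := layered_paths (colP' true) v0 ASG l0 lab_lt lab_bal.
have [I2 [T2 [so2 us2 sz2 mult2]]] := layered_paths (colP' false) v0 FBG l0 labB_lt balB.
pose T (i : I1 + I2) := match i with inl i1 => T1 i1 | inr i2 => T2 i2 end.
apply: (@decomposition_of_paths _ _ _ T) => [[]|[]|[]|e] //.
transitivity (multiplicity T1 e + multiplicity T2 e); first by rewrite /multiplicity big_sumType.
rewrite mult1 mult2 in_setU in_setD in_setU.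
have [eA|eA] := boolP (e \in FA).
  by rewrite (disjointFr dAB eA) (subsetP FAG).
by have [/(subsetP FBG) ->|_] := boolP (e \in FB); case: (e \in edges G).
Qed.
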